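(* Let $\omega$ be a non-quasianalytic weight function and $T\in\mathcal{S}'_\omega(\mathbb{R}^N)$. Consider the following properties. (1) $T\in\mathcal{O}'_{C,\omega}(\mathbb{R}^N)$. (2) For every $f\in\mathcal{S}_\omega(\mathbb{R}^N)$ we have $T\star f\in\mathcal{S}_\omega(\mathbb{R}^N)$. Then (1) implies (2). If, in addition, $\omega$ satisfies $\log(1+t)=o(\omega(t))$ as $t\to\infty$, then (2) implies (1). Moreover, if $T\in\mathcal{O}'_{C,\omega}(\mathbb{R}^N)$, then the linear operator $C_T:\mathcal{S}_\omega(\mathbb{R}^N)\to\mathcal{S}_\omega(\mathbb{R}^N)$ defined by $C_T(f):=T\star f$ is continuous.
   Context: $\mathbb{N}=\{1,2,\dots\}$, $\mathbb{N}_0=\mathbb{N}\cup\{0\}$. A non-quasianalytic weight function is a continuous increasing (i.e. non-decreasing) function $\omega:[0,\infty)\to[0,\infty)$ such that: ($\alpha$) there is $K\ge1$ with $\omega(2t)\le K(1+\omega(t))$ for all $t\ge0$; ($\beta$) $\int_1^\infty\frac{\omega(t)}{1+t^2}\,dt<\infty$; ($\gamma$) there are $a\in\mathbb{R}$, $b>0$ with $\omega(t)\ge a+b\log(1+t)$ for all $t\ge0$; ($\delta$) $\varphi_\omega(t):=\omega(e^t)$ is convex. It is assumed (without loss of generality) that $\omega$ vanishes on $[0,1]$. For $x\in\mathbb{R}^N$, $\omega(x):=\omega(|x|)$. The Young conjugate is $\varphi^*_\omega(s):=\sup_{t\ge0}\{st-\varphi_\omega(t)\}$, $s\ge0$ (with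 $\exp(-\infty)=0$, $\exp(+\infty)=+\infty$, $0\cdot\infty=0$ if the supremum is $+\infty$). $\mathcal{S}_\omega(\mathbb{R}^N)$ is the set of all $f\in L^1(\mathbb{R}^N)$ with $f,\hat f\in C^\infty(\mathbb{R}^N)$ and $\|\exp(\lambda\omega)\partial^\alpha f\|_\infty<\infty$, $\|\exp(\lambda\omega)\partial^\alpha\hat f\|_\infty<\infty$ for all $\lambda>0$, $\alpha\in\mathbb{N}_0^N$; it is a Fréchet space whose topology is generated by the norms $q_{m,m}(f)=\sup_{\alpha}\sup_x|\partial^\alpha f(x)|\exp\left(m\omega(x)-m\varphi^*_\omega\left(\frac{|\alpha|}{m}\right)\right)$, $m\in\mathbb{N}$. $\mathcal{S}'_\omega(\mathbb{R}^N)$ is its strong dual. For $m\in\mathbb{N}$, $n\in\mathbb{Z}$, $\mathcal{O}^m_{n,\omega}(\mathbb{R}^N)$ is the space of all $f\in C^\infty(\mathbb{R}^N)$ with $r_{m,n}(f):=\sup_{\alpha}\sup_{x}|\partial^\alpha f(x)|\exp\left(-n\omega(x)-m\varphi^*_\omega\left(\frac{|\alpha|}{m}\right)\right)<\infty$, normed by $r_{m,n}$. $\mathcal{O}_{C,\omega}(\mathbb{R}^N):=\bigcup_{n=1}^\infty\bigcap_{m=1}^\infty\mathcal{O}^m_{n,\omega}(\mathbb{R}^N)$ with the locally convex topology of $\mathrm{ind}_n\,\mathrm{proj}_m\,\mathcal{O}^m_{n,\omega}(\mathbb{R}^N)$; $\mathcal{O}'_{C,\omega}(\mathbb{R}^N)$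 is its strong dual. The inclusion $\mathcal{S}_\omega(\mathbb{R}^N)\hookrightarrow\mathcal{O}_{C,\omega}(\mathbb{R}^N)$ is continuous with dense range (known), so $\mathcal{O}'_{C,\omega}(\mathbb{R}^N)\subset\mathcal{S}'_\omega(\mathbb{R}^N)$; $T\in\mathcal{O}'_{C,\omega}(\mathbb{R}^N)$ means that $T$ extends to a continuous linear functional on $\mathcal{O}_{C,\omega}(\mathbb{R}^N)$. For $T\in\mathcal{S}'_\omega(\mathbb{R}^N)$ and $f\in\mathcal{S}_\omega(\mathbb{R}^N)$, $(T\star f)(x):=\langle T_y,f(x-y)\rangle$, $x\in\mathbb{R}^N$, where $T_y$ indicates that $T$ acts in the variable $y$. *)

(* Defs.v *)
From HB Require Import structures.
From mathcomp Require Import all_boot all_order all_algebra.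
From mathcomp Require Import all_classical all_reals all_analysis.
From mathcomp Require Export complex.

Set Implicit Arguments.
Unset Strict Implicit.
Unset Printing Implicit Defensive.

Import Order.TTheory GRing.Theory Num.Theory.
Import numFieldNormedType.Exports.

Local Open Scope classical_set_scope.
Local Open Scope ring_scope.

Section WeightFunctions.
Variable R : realType.
Implicit Types w : R -> R.

Definition phi_weight w (t : R) : R := w (expR t).

(* Only the values of [w] on [0, +oo[ are constrained. *)
Record nqa_weight w : Prop := NqaWeight {
  nqa_continuous : {within `[0, +oo[, continuous w};
  nqa_ge0 : forall t : R, 0 <= t -> 0 <= w t;
  nqa_nondecreasing : forall s t : R, 0 <= s -> s <= t -> w s <= w t;
  nqa_alpha : exists2 K : R, 1 <= K &
    forall t : R, 0 <= t -> w (2 * t) <= K * (1 + w t);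
  nqa_beta :
    (\int[lebesgue_measure]_(t in `[1%R, +oo[) (w t / (1 + t ^+ 2))%:E < +oo)%E;
  nqa_gamma : exists a b : R, 0 < b /\
    forall t : R, 0 <= t -> a + b * ln (1 + t) <= w t;
  nqa_delta : convex_function (E := R^o) setT (phi_weight w);
  nqa_vanish : forall t : R, 0 <= t -> t <= 1 -> w t = 0
}.

Definition young_conj w (s : R) : \bar R :=
  ereal_sup [set (s * t - phi_weight w t)%:E | t in [set t : R | 0 <= t]].

Definition pinfty_filter : filter_on R := FilterType (pinfty_nbhs R) _.

Definition log_littleo w : Prop :=
  (fun t : R => ln (1 + t) : R^o) =o_pinfty_filter (w : R -> R^o).

End WeightFunctions.

Section EuclideanSpace.
Variables (R : realType) (N : nat).

(* The library's norm on ['rV[R]_N] is the sup norm; it induces the same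
   topology, but the weights are evaluated at the Euclidean norm. *)
Definition enorm (x : 'rV[R]_N) : R := Num.sqrt (\sum_i x 0 i ^+ 2).

Definition dotprod (x y : 'rV[R]_N) : R := \sum_i x 0 i * y 0 i.

Definition partial (i : 'I_N) (u : 'rV[R]_N -> R) : 'rV[R]_N -> R :=
  fun x => 'D_(delta_mx 0 i) (u : 'rV[R]_N -> R^o) x.

Definition iter_partial (s : seq 'I_N) (u : 'rV[R]_N -> R) : 'rV[R]_N -> R :=
  foldr partial u s.

Definition smooth_real (u : 'rV[R]_N -> R) : Prop :=
  forall s : seq 'I_N,
    (forall i x, derivable (iter_partial s u : 'rV[R]_N -> R^o) x
                           (delta_mx 0 i)) /\
    continuous (iter_partial s u : 'rV[R]_N -> R^o).

Definition multi_index := {ffun 'I_N -> nat}.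

Definition mlen (al : multi_index) : nat := (\sum_i al i)%N.

Definition mseq (al : multi_index) : seq 'I_N :=
  flatten [seq nseq (al i) i | i <- enum 'I_N].

End EuclideanSpace.

(* R[i]^o, the complex numbers as a vector space over themselves: R[i] alone
   carries no canonical topology. *)
Notation cfun R N := ('rV[R]_N -> (R[i])^o).

Section ComplexFunctions.
Variables (R : realType) (N : nat).
Implicit Types f g : cfun R N.

Definition cmod (z : R[i]) : R := ComplexField.Normc.normc z.

Definition cis (t : R) : R[i] := Complex (cos t) (sin t).

Definition re_part f : 'rV[R]_N -> R := fun x => complex.Re (f x).
Definition im_part f : 'rV[R]_N -> R := fun x => complex.Im (f x).

Definition smooth f : Prop := smooth_real (re_part f) /\ smooth_real (im_part f).

Definition mderiv (al : multi_index N) f : cfun R N :=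
  fun x => Complex (iter_partial (mseq al) (re_part f) x)
                   (iter_partial (mseq al) (im_part f) x).

End ComplexFunctions.

Section LebesgueMeasure.
Variable R : realType.

Notation RR := (measurableTypeR R).

Definition prepend n (p : n.-tuple RR * RR) : n.+1.-tuple RR :=
  [the n.+1.-tuple RR of p.2 :: p.1].

Lemma measurable_prepend n : measurable_fun [set: n.-tuple RR * RR] (@prepend n).
Proof. by apply: measurable_cons; [exact: measurable_snd|exact: measurable_fst]. Qed.

Section Step.
Variables (n : nat) (mu : {measure set (n.-tuple RR) -> \bar R}).

Definition lebesgue_step : set (n.+1.-tuple RR) -> \bar R :=
  pushforward (mu \x (@lebesgue_measure R))%E (@prepend n).

Let mprepend := @measurable_prepend n.

Let lebesgue_step0 : lebesgue_step set0 = 0%E.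
Proof. exact: measure0. Qed.

Let lebesgue_step_ge0 A : (0 <= lebesgue_step A)%E.
Proof. exact: measure_ge0. Qed.

Let lebesgue_step_sigma_additive : semi_sigma_additive lebesgue_step.
Proof. exact: measure_semi_sigma_additive. Qed.

HB.instance Definition _ := isMeasure.Build _ _ _ lebesgue_step
  lebesgue_step0 lebesgue_step_ge0 lebesgue_step_sigma_additive.

End Step.

(* The library has no Lebesgue measure on R^n: it is built on n-tuples as the
   n-fold product of the one-dimensional one. *)
Fixpoint lebesgueN (n : nat) : {measure set (n.-tuple RR) -> \bar R} :=
  match n with
  | 0 => dirac ([tuple] : 0.-tuple RR)
  | n'.+1 => lebesgue_step (lebesgueN n')
  end.

End LebesgueMeasure.

Section Fourier.
Variables (R : realType) (N : nat).
Implicit Types f : cfun R N.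

Definition row_of_tuple (t : N.-tuple (measurableTypeR R)) : 'rV[R]_N :=
  \row_i tnth t i.

Definition L1 f : Prop :=
  (lebesgueN R N).-integrable setT (fun t => (re_part f (row_of_tuple t))%:E) /\
  (lebesgueN R N).-integrable setT (fun t => (im_part f (row_of_tuple t))%:E).

Definition cintegral f : R[i] :=
  Complex (\int[lebesgueN R N]_t re_part f (row_of_tuple t))
          (\int[lebesgueN R N]_t im_part f (row_of_tuple t)).

Definition fourier f : cfun R N :=
  fun xi => cintegral (fun x => f x * cis (- dotprod x xi)).

End Fourier.

Section LocallyConvex.
Variables (R : realType) (N : nat).
Implicit Types (f g : cfun R N) (E U V : set (cfun R N)).

(* Neighbourhoods of [f] in the vector space [E], for the locally convex
   topology generated by the (extended-valued) norms [p m], m >= 1; on [E] the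
   norms are finite. *)
Definition norms_nbhs E (p : nat -> cfun R N -> \bar R) f
    : set_system (cfun R N) :=
  [set U | exists (F : seq nat) (e : R), 0 < e /\
    forall g, E g ->
      (forall m, m \in F -> (0 < m)%N -> (p m (g - f)%R < e%:E)%E) -> U g].

Definition absolutely_convex V : Prop :=
  forall (a b : R[i]) f g, cmod a + cmod b <= 1 ->
    V f -> V g -> V (a *: f + b *: g).

(* Neighbourhoods of [f] in the union [E] of the spaces [En n], n >= 1, for
   the locally convex inductive limit topology, i.e. the finest locally convex
   topology making the inclusions of the [En n] continuous; [nbhs0 n] is the
   neighbourhood filter of 0 in [En n]. *)
Definition ind_nbhs E (nbhs0 : nat -> set_system (cfun R N)) f
    : set_system (cfun R N) :=
  [set U | exists V, [/\ absolutely_convex V, V `<=` E,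
     forall n, (0 < n)%N -> nbhs0 n V & forall v, V v -> U (f + v)]].

Definition linear_on (W : lmodType R[i]) E (T : cfun R N -> W) : Prop :=
  forall (a : R[i]) f g, E f -> E g -> T (a *: f + g) = a *: T f + T g.

(* The value of a functional on [E] outside of [E] is irrelevant. *)
Definition continuous_functional E (nb : cfun R N -> set_system (cfun R N))
    (T : cfun R N -> (R[i])^o) : Prop :=
  linear_on E T /\ forall f, E f -> T @ nb f --> T f.

End LocallyConvex.

Section Spaces.
Variables (R : realType) (N : nat) (w : R -> R).
Implicit Types (f : cfun R N) (T : cfun R N -> (R[i])^o).

Definition weighted_sup (lam : R) (al : multi_index N) f : \bar R :=
  ereal_sup (range (fun x => (expR (lam * w (enorm x)) * cmod (mderiv al f x))%:E)).

Definition S_space : set (cfun R N) :=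
  [set f | [/\ L1 f, smooth f, smooth (fourier f) &
    forall (lam : R) (al : multi_index N), 0 < lam ->
      (weighted_sup lam al f < +oo)%E /\
      (weighted_sup lam al (fourier f) < +oo)%E]].

(* [young_conj] may be +oo; [expeR] and the product of [\bar R] follow the
   conventions exp(-oo) = 0 and 0 * oo = 0. *)
Definition q_norm (m : nat) f : \bar R :=
  ereal_sup (range (fun al : multi_index N =>
    ereal_sup (range (fun x : 'rV[R]_N =>
      ((cmod (mderiv al f x))%:E *
       expeR ((m%:R * w (enorm x))%:E -
              m%:R%:E * young_conj w ((mlen al)%:R / m%:R)))%E)))).

Definition r_norm (m : nat) (n : int) f : \bar R :=
  ereal_sup (range (fun al : multi_index N =>
    ereal_sup (range (fun x : 'rV[R]_N =>
      ((cmod (mderiv al f x))%:E *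
       expeR ((- n%:~R * w (enorm x))%:E -
              m%:R%:E * young_conj w ((mlen al)%:R / m%:R)))%E)))).

Definition S_nbhs : cfun R N -> set_system (cfun R N) :=
  norms_nbhs S_space q_norm.

Definition S_dual T : Prop := continuous_functional S_space S_nbhs T.

Definition O_space (m : nat) (n : int) : set (cfun R N) :=
  [set f | smooth f /\ (r_norm m n f < +oo)%E].

Definition O_proj (n : int) : set (cfun R N) :=
  [set f | forall m, (0 < m)%N -> O_space m n f].

Definition OC_space : set (cfun R N) :=
  [set f | exists n : nat, (0 < n)%N /\ O_proj n%:Z f].

Definition OC_nbhs : cfun R N -> set_system (cfun R N) :=
  ind_nbhs OC_space
    (fun n => norms_nbhs (O_proj n%:Z) (fun m => r_norm m n%:Z) 0).

(* For [T] in the dual of [S_space]: [T] extends to a continuous linear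
   functional on [OC_space]. *)
Definition in_OC_dual T : Prop :=
  exists T' : cfun R N -> (R[i])^o,
    continuous_functional OC_space OC_nbhs T' /\
    forall f, S_space f -> T' f = T f.

Definition convol T f : cfun R N := fun x => T (fun y => f (x - y)).

End Spaces.

(* Main.v *)
(* Put J m k := inf_(r >= 1) exp(m w(r)) / r^k = exp(- m phi^*(k / m)), so that
   q_(m,m) and r_(m,n) bound |D^s f(x)| exp(a w(x)) J m |s| with a = m, resp.
   a = - n. Up to changing m, the numbers J m k are submultiplicative and
   supermultiplicative in k and absorb geometric factors C^k, and w(x + y) <=
   K (1 + w(x) + w(y)).

   A function lies in S_w iff all these weighted bounds hold for every m: the
   bound on the Fourier transform controls |D^s f| J m |s| uniformly, and a
   Landau-Gorny inequality on half-lines pointing away from the origin, where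
   the weight increases, combines it with the decay of f.

   (1) => (2), (3): D^s(T * f)(x) = T'((D^s f)(x - .)), and the translate is
   estimated in the norm of O_n with n >= K lam, giving decay exp(- lam w(x)).

   (2) => (1): by the uniform boundedness principle on the Frechet space S_w
   (gliding hump), |T(f(x - .))| exp(lam w(x)) is bounded by a seminorm of f for
   every lam. If S_w <> 0 it contains a bump chi whose translates chi(. - k),
   k in Z^N, sum to 1, and T'(F) := sum_k T(F chi(. - k)) converges absolutely
   on O_(C,w), is continuous there and extends T. *)

From HB Require Import structures.
Require Import Defs.
From mathcomp Require Import all_boot all_order all_algebra.
From mathcomp Require Import all_classical all_reals all_analysis measurable_realfun.
From mathcomp Require Import ring lra zify.

Set Implicit Arguments.
Unset Strict Implicit.
Unset Printing Implicit Defensive.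

Import Order.TTheory GRing.Theory Num.Theory.
Import numFieldNormedType.Exports.
Local Open Scope classical_set_scope.
Local Open Scope ring_scope.

(** * The Young conjugate as an infimum *)

(** The space constrains each derivative of [f] and of its transform separately, while the norms are
    uniform in the order of differentiation. Bridging the two takes no inversion formula, only a
    bound of [|u|] by a weighted supremum of its transform with the constant [8 ^+ N]. Decay at
    order k then comes from order 0 with the weight and order 2k without it. For (2) => (1), decay
    of each single convolution would not suffice: [T (F chi(. - k))] is the value at [k] of the
    convolution with [g_k = chi(- .) F(k - .)], which changes with [k] and whose seminorms may grow
    like [exp (n K w(k))]. Hence the decay must be uniform in the function and available for every
    exponent. Real and imaginary parts are treated separately. Derivatives are indexed by words of
    directions, so that Leibniz's rule is a plain sum over subwords; geometric losses are absorbed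
    by enlarging [m]. Differentiability of integrals, of limits and of convolutions comes from
    explicit quadratic remainders. *)

Section WeightInfimum.
Variables (R : realType) (w : R -> R).

(* [J m k] is [exp (- m * phi^* (k / m))], see [young_conjE]; being an infimum it
   stays a real number, namely 0, when the Young conjugate is infinite. *)
Definition J (m : R) (k : nat) : R :=
  inf [set expR (m * w r) / r ^+ k | r in [set r : R | 1 <= r]].

Lemma J_nonempty m k :
  [set expR (m * w r) / r ^+ k | r in [set r : R | 1 <= r]] !=set0.
Proof. by exists (expR (m * w 1) / 1 ^+ k), 1 => /=. Qed.

Lemma J_has_lbound m k :
  has_lbound [set expR (m * w r) / r ^+ k | r in [set r : R | 1 <= r]].
Proof.
exists 0 => _ [r /= r1 <-]; rewrite divr_ge0 ?expR_ge0// exprn_ge0//.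
exact: le_trans r1.
Qed.

Lemma J_le m k r : 1 <= r -> J m k <= expR (m * w r) / r ^+ k.
Proof. by move=> r1; apply: ge_inf; [exact: J_has_lbound|exists r]. Qed.

Lemma le_J m k c : (forall r, 1 <= r -> c <= expR (m * w r) / r ^+ k) -> c <= J m k.
Proof.
move=> h; apply: lb_le_inf; first exact: J_nonempty.
by move=> _ [r /= r1 <-]; exact: h.
Qed.

Lemma J_ge0 m k : 0 <= J m k.
Proof.
apply: le_J => r r1; rewrite divr_ge0 ?expR_ge0// exprn_ge0//.
exact: le_trans r1.
Qed.

Hypothesis hw : nqa_weight w.

Lemma w1 : w 1 = 0. Proof. by apply: (nqa_vanish hw). Qed.

Lemma w_ge0 r : 0 <= r -> 0 <= w r. Proof. exact: (nqa_ge0 hw). Qed.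

Lemma J_le1 m k : J m k <= 1.
Proof. by have := J_le m k (lexx 1); rewrite w1 mulr0 expR0 expr1n divr1. Qed.

Lemma J0 m : 0 <= m -> J m 0 = 1.
Proof.
move=> m0; apply/eqP; rewrite eq_le J_le1/=; apply: le_J => r r1.
rewrite expr0 divr1 -expR0 ler_expR mulr_ge0// w_ge0//.
exact: le_trans r1.
Qed.

Lemma le_J_m m m' k : m <= m' -> J m k <= J m' k.
Proof.
move=> mm; apply: le_J => r r1; apply: (le_trans (J_le m k r1)).
have r0 : 0 < r by exact: lt_le_trans r1.
by rewrite ler_pM2r ?invr_gt0 ?exprn_gt0// ler_expR ler_wpM2r// w_ge0// ltW.
Qed.

(** The infimum on the left is tested at the larger of two radii: at the smaller one the weight
    factor is at least 1 and the inverse power is larger. For the Young conjugate this is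
    superadditivity. *)
Lemma J_superadd m a b : 0 <= m -> J m (a + b) <= J m a * J m b.
Proof.
move=> m0.
have key r s : 1 <= r -> 1 <= s ->
    J m (a + b) <= (expR (m * w r) / r ^+ a) * (expR (m * w s) / s ^+ b).
  move=> r1 s1.
  have r0 : 0 < r by exact: lt_le_trans r1.
  have s0 : 0 < s by exact: lt_le_trans s1.
  have er : 1 <= expR (m * w r) by rewrite -expR0 ler_expR mulr_ge0// w_ge0// ltW.
  have es : 1 <= expR (m * w s) by rewrite -expR0 ler_expR mulr_ge0// w_ge0// ltW.
  case: (leP r s) => rs.
    apply: (le_trans (J_le m (a + b) s1)).
    rewrite exprD invfM mulrA mulrAC [leRHS]mulrC -mulrA ler_pM2l ?expR_gt0//.
    rewrite mulrA ler_pM2r ?invr_gt0 ?exprn_gt0//.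
    apply: (@le_trans _ _ (r ^- a)).
      by rewrite lef_pV2 ?posrE ?exprn_gt0// lerXn2r// nnegrE ltW.
    by rewrite ler_peMl// invr_ge0 exprn_ge0// ltW.
  apply: (le_trans (J_le m (a + b) r1)).
  rewrite exprD invfM [leLHS]mulrA ler_pM2l ?divr_gt0 ?expR_gt0 ?exprn_gt0//.
  apply: (@le_trans _ _ (s ^- b)).
    by rewrite lef_pV2 ?posrE ?exprn_gt0// lerXn2r// ?nnegrE ltW.
  by rewrite ler_peMl// invr_ge0 exprn_ge0// ltW.
have key2 r : 1 <= r -> J m (a + b) <= (expR (m * w r) / r ^+ a) * J m b.
  move=> r1; have r0 : 0 < r by exact: lt_le_trans r1.
  have p : 0 < expR (m * w r) / r ^+ a by rewrite divr_gt0 ?expR_gt0 ?exprn_gt0.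
  rewrite mulrC -ler_pdivrMr//; apply: le_J => s s1.
  by rewrite ler_pdivrMr// mulrC key.
have [Jb|Jb] := eqVneq (J m b) 0; last first.
  have {}Jb : 0 < J m b by rewrite lt_neqAle eq_sym Jb J_ge0.
  rewrite -ler_pdivrMr//; apply: le_J => r r1.
  by rewrite ler_pdivrMr// key2.
by have := key2 _ (lexx 1); rewrite Jb !mulr0.
Qed.

(** All three infima are tested at one common radius; this is the convexity of the Young conjugate.
    It pays for additional derivatives by enlarging [m]. *)
Lemma J_split m m' a b : J m a * J m' b <= J (m + m') (a + b).
Proof.
apply: le_J => r r1; rewrite mulrDl expRD exprD invfM mulrACA.
by apply: ler_pM; rewrite ?J_ge0// J_le.
Qed.

Lemma J_exp_le m k r : 0 <= r -> r ^+ k * J m k <= expR (m * w r).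
Proof.
move=> r0; case: (leP 1 r) => r1; last first.
  rewrite (_ : w r = 0) ?mulr0 ?expR0; last by apply: (nqa_vanish hw) => //; exact: ltW.
  rewrite -[leRHS]mulr1; apply: ler_pM; rewrite ?exprn_ge0 ?J_ge0 ?J_le1//.
  by rewrite exprn_ile1// ltW.
rewrite mulrC -ler_pdivlMr ?J_le// exprn_gt0//.
exact: lt_le_trans r1.
Qed.

Lemma w_scale B : 1 <= B -> exists2 L, 1 <= L &
  forall r, 0 <= r -> w (B * r) <= L * (1 + w r).
Proof.
move=> B1; have [K K1 hK] := nqa_alpha hw.
have pow n : exists2 L, 1 <= L & forall r, 0 <= r -> w (2 ^+ n * r) <= L * (1 + w r).
  elim: n => [|n [L L1 hL]].
    exists 1 => // r r0; rewrite expr0 !mul1r; lra.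
  exists (K * (1 + L)).
    by rewrite -[leLHS]mulr1 ler_pM//; lra.
  move=> r r0; rewrite exprS -mulrA.
  apply: (le_trans (hK _ _)); first by rewrite mulr_ge0// exprn_ge0.
  rewrite -mulrA ler_pM2l; last lra.
  have := hL _ r0; have := w_ge0 r0; nra.
have [n Bn] : exists n, B <= 2 ^+ n.
  have [n hn] : exists n : nat, B <= n%:R.
    exists (Num.bound B); apply/ltW; apply: archi_boundP; lra.
  exists n; apply: (le_trans hn); rewrite -natrX ler_nat.
  exact/ltnW/ltn_expl.
have [L L1 hL] := pow n; exists L => // r r0.
apply: le_trans (hL _ r0); apply: (nqa_nondecreasing hw).
  by rewrite mulr_ge0//; lra.
by rewrite ler_wpM2r.
Qed.

Lemma w_add : exists2 K, 1 <= K & forall r s, 0 <= r -> 0 <= s ->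
  w (r + s) <= K * (1 + w r + w s).
Proof.
have [K K1 hK] := nqa_alpha hw; exists K => // r s r0 s0.
have wr := w_ge0 r0; have ws := w_ge0 s0.
case: (leP r s) => rs.
  apply: (@le_trans _ _ (w (2 * s))); last by apply: (le_trans (hK _ s0)); nra.
  by apply: (nqa_nondecreasing hw); lra.
apply: (@le_trans _ _ (w (2 * r))); last by apply: (le_trans (hK _ r0)); nra.
by apply: (nqa_nondecreasing hw); lra.
Qed.

(** Dilating the radius by [B] produces the factor [B ^+ k], and condition (alpha), iterated in
    [w_scale], compares the two weights. A geometric factor thus costs a fixed multiple of [m],
    uniformly in [k]. *)
Lemma J_scale B : 1 <= B -> exists2 L, 1 <= L &
  forall m k, 0 <= m -> B ^+ k * J m k <= expR (m * L) * J (m * L) k.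
Proof.
move=> B1; have [L L1 hL] := w_scale B1; exists L => // m k m0.
rewrite [leRHS]mulrC -ler_pdivrMr ?expR_gt0//.
have B0 : 0 < B by exact: lt_le_trans B1.
apply: le_J => r r1.
have r0 : 0 < r by exact: lt_le_trans r1.
rewrite ler_pdivrMr ?expR_gt0// mulrAC ler_pdivlMr ?exprn_gt0//.
rewrite -expRD mulrAC -exprMn.
apply: (@le_trans _ _ (expR (m * w (B * r)))).
  by apply: J_exp_le; rewrite mulr_ge0// ltW.
rewrite ler_expR -!mulrA -mulrDr ler_wpM2l//.
by apply: le_trans (hL _ (ltW r0)) _; lra.
Qed.

Lemma w_poly p : exists m0 C, [/\ 0 <= m0, 0 < C &
  forall r, 0 <= r -> (1 + r) ^+ p <= C * expR (m0 * w r)].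
Proof.
have [a [b [b0 hab]]] := nqa_gamma hw.
(* Condition (gamma), multiplied by p / b and exponentiated. *)
exists (p%:R / b), (expR (- (p%:R / b * a))); split.
- by rewrite divr_ge0// ltW.
- exact: expR_gt0.
move=> r r0; rewrite -expRD -{1}[1 + r]lnK ?posrE; last lra.
rewrite -expRM_natl ler_expR.
rewrite mulrC -mulrN -mulrDr.
have := hab _ r0 => h.
have -> : ln (1 + r) * p%:R = p%:R / b * (b * ln (1 + r)).
  by rewrite mulrA divfK ?gt_eqF// mulrC.
apply: ler_wpM2l; [by rewrite divr_ge0// ltW|lra].
Qed.

(** For a weight of logarithmic growth [J w m k] is 0 when [m] is small compared with [k]; condition
    (gamma) makes it positive once [m] is large. Bounds on one fixed derivative are extracted by
    dividing by such a value. *)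
Lemma J_pos k : exists2 m0, 0 <= m0 & forall m, m0 <= m -> 0 < J m k.
Proof.
have [m0 [C [m00 C0 hC]]] := w_poly k; exists m0 => // m mm.
apply: lt_le_trans (le_J_m k mm).
apply: (@lt_le_trans _ _ C^-1); first by rewrite invr_gt0.
apply: le_J => r r1; have r0 : 0 < r by exact: lt_le_trans r1.
rewrite ler_pdivlMr ?exprn_gt0// mulrC ler_pdivrMr// mulrC.
apply: le_trans (hC _ (ltW r0)); rewrite lerXn2r ?nnegrE//; lra.
Qed.

Lemma phi_subgradient t : 0 <= t ->
  exists2 s, 0 <= s & forall u, phi_weight w t + s * (u - t) <= phi_weight w u.
Proof.
move=> t0; set f := phi_weight w.
have fmono x y : x <= y -> f x <= f y.
  by move=> xy; apply: (nqa_nondecreasing hw); rewrite ?expR_ge0// ler_expR.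
have conv x y : x < t -> t < y -> (f t - f x) / (t - x) <= (f y - f t) / (y - t).
  move=> xt ty.
  have xy : 0 < y - x by lra.
  have p01 : 0 <= (y - t) / (y - x) <= 1.
    by rewrite divr_ge0/= ?ler_pdivrMr//; lra.
  have := @nqa_delta _ _ hw (Itv01 (andP p01).1 (andP p01).2) x y (in_setT _) (in_setT _).
  set p := (_ / _) => h.
  have {}h : f (p * x + (1 - p) * y) <= p * f x + (1 - p) * f y by exact: h.
  have e : p * x + (1 - p) * y = t.
    by rewrite /p; field; rewrite gt_eqF.
  rewrite e in h.
  have {}h : (f t) * (y - x) <= (y - t) * f x + (t - x) * f y.
    have -> : (y - t) * f x + (t - x) * f y = (p * f x + (1 - p) * f y) * (y - x).
      by rewrite /p; field; rewrite gt_eqF.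
    by rewrite ler_pM2r.
  rewrite ler_pdivrMr ?subr_gt0// mulrAC ler_pdivlMr ?subr_gt0//; lra.
(* The slope is the supremum of the left difference quotients, which [conv] bounds by every right
   quotient. *)
set S := [set (f t - f x) / (t - x) | x in [set x | x < t]].
have S0 : S !=set0 by exists ((f t - f (t - 1)) / (t - (t - 1))), (t - 1) => //=; lra.
have Sub : has_ubound S.
  exists ((f (t + 1) - f t) / (t + 1 - t)) => _ [x /= xt <-]; apply: conv => //; lra.
exists (sup S).
  apply: (@le_trans _ _ ((f t - f (t - 1)) / (t - (t - 1)))).
    by rewrite divr_ge0// subr_ge0 ?fmono//; lra.
  by apply: ub_le_sup => //; exists (t - 1) => //=; lra.
move=> u; case: (ltrgtP u t) => ut; last 1 first.
- by rewrite ut subrr mulr0 addr0.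
- have : (f t - f u) / (t - u) <= sup S by apply: ub_le_sup => //; exists u.
  rewrite ler_pdivrMr ?subr_gt0//; lra.
- have : sup S <= (f u - f t) / (u - t).
    by apply: ge_sup => // _ [x /= xt <-]; exact: conv.
  rewrite ler_pdivlMr ?subr_gt0//; lra.
Qed.

(** Converse to [J_exp_le]: a convex function is its own biconjugate, and the supremum is attained
    at a subgradient slope. That slope, times [m], is rounded down to an integer, which costs the
    factor [r]. *)
Lemma J_young m r : 0 <= m -> 1 <= r ->
  exists k, expR (m * w r) <= r * (r ^+ k * J m k).
Proof.
move=> m0 r1; have r0 : 0 < r by exact: lt_le_trans r1.
have [s s0 hs] := phi_subgradient (ln_ge0 r1).
have ms0 : 0 <= m * s by rewrite mulr_ge0.
exists (Num.truncn (m * s)); set k := Num.truncn _.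
have /andP[k1 k2] := truncn_itv ms0; rewrite -/k in k1 k2.
rewrite mulrA -exprS -ler_pdivrMl ?exprn_gt0//; apply: le_J => q q1.
have q0 : 0 < q by exact: lt_le_trans q1.
rewrite mulrC ler_pdivrMr ?exprn_gt0// mulrAC ler_pdivlMr ?exprn_gt0//.
rewrite [X in _ * X <= _](_ : _ = expR (ln q * k%:R)); last by rewrite expRM_natr lnK.
rewrite [X in _ <= _ * X](_ : _ = expR (ln r * k.+1%:R)); last by rewrite expRM_natr lnK.
rewrite -!expRD ler_expR.
have := hs (ln q); rewrite /phi_weight !lnK//.
have lr := ln_ge0 r1; have lq := ln_ge0 q1.
rewrite -natr1 in k2 *.
move: (w r) (w q) (ln r) (ln q) lr lq => wr wq a b a0 b0 h.
have : m * (wr + s * (b - a)) <= m * wq by rewrite ler_wpM2l.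
have : 0 <= (m * s - k%:R) * b by rewrite mulr_ge0// subr_ge0.
have : 0 <= (k%:R + 1 - m * s) * a by rewrite mulr_ge0// subr_ge0 ltW.
nra.
Qed.

Lemma young_conjE m k c : 0 < m ->
  expeR (c%:E - m%:E * young_conj w (k%:R / m))%E = (expR c * J m k)%:E.
Proof.
move=> m0; set y := young_conj _ _.
have yge t : 0 <= t -> ((k%:R / m * t - phi_weight w t)%:E <= y)%E.
  by move=> t0; apply: ereal_sup_ubound; exists t.
have ylt v : 0 < v -> v <= J m k -> (y <= (- ln v / m)%:E)%E.
  move=> v0 vJ; apply: ge_ereal_sup => _ [t /= t0 <-]; rewrite lee_fin.
  rewrite ler_pdivlMr// mulrBl mulrAC divfK ?gt_eqF//.
  have := le_trans vJ (J_le m k (_ : 1 <= expR t)).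
  rewrite -[X in X <= _ -> _]expR0 ler_expR => /(_ t0).
  rewrite -expRM_natl -expRB -{1}(lnK v0) ler_expR /phi_weight.
  lra.
(* An infinite conjugate corresponds to [J w m k = 0], since [ylt] would bound it otherwise; the
   value [-oo] is excluded by testing [t = 0]. *)
move: yge ylt; rewrite /y; case: (young_conj w _) => [v|_ h|/(_ 0 (lexx _))//]; last first.
  rewrite mulry gtr0_sg// mul1e /= .
  have -> : J m k = 0.
    apply/eqP; rewrite eq_le J_ge0 andbT leNgt; apply/negP => J0'.
    by have := h _ J0' (lexx _).
  by rewrite mulr0.
move=> yge ylt; rewrite /= expRB; congr (_ * _)%:E; apply/eqP; rewrite eq_le; apply/andP; split.
  apply: le_J => r r1; have r0 : 0 < r by exact: lt_le_trans r1.
  rewrite [X in _ <= _ / X](_ : _ = expR (ln r * k%:R)); last by rewrite expRM_natr lnK.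
  rewrite -expRN -expRB ler_expR.
  have := yge (ln r) (ln_ge0 r1); rewrite lee_fin /phi_weight lnK// -(ler_pM2l m0).
  rewrite mulrBr mulrA mulrCA divff ?gt_eqF// mulr1; lra.
rewrite leNgt; apply/negP => lt.
have J0' : 0 < J m k by apply: lt_trans lt; rewrite invr_gt0 expR_gt0.
have := ylt _ J0' (lexx _); rewrite lee_fin ler_pdivlMr//.
rewrite leNgt => /negP; apply.
by rewrite ltrNl -ltr_expR lnK// expRN mulrC.
Qed.

End WeightInfimum.

(** Only increments of size at most 1 are constrained, because the weighted estimates of
    translations hold there with a uniform constant. *)
Lemma is_derive_quad (R : realType) (V : normedModType R) (f : V -> R^o) (x v : V) (l C : R) :
  (forall h : R, 0 < `|h| <= 1 -> `|f (x + h *: v) - f x - h * l| <= C * h ^+ 2) ->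
  is_derive x v f l.
Proof.
move=> hC; have C0 : 0 <= C.
  have := hC 1; rewrite normr1 ltr01 lexx expr1n mulr1 => /(_ isT).
  exact: le_trans.
suff cv : h^-1 *: ((f \o shift x) (h *: v) - f x) @[h --> 0^'] --> (l : R^o).
  by split; [apply/cvg_ex; exists l|exact: cvg_lim].
apply/cvgrPdist_le => e e0; near=> h.
have h0 : h != 0 by near: h; exact: nbhs_dnbhs_neq.
have hp : 0 < `|h| by rewrite normr_gt0.
have h1 : `|h| <= 1.
  by near: h; apply: dnbhs0_le.
have he : `|h| <= e / (C + 1).
  by near: h; apply: dnbhs0_le; rewrite divr_gt0//; lra.
rewrite /= [h *: _ + _]addrC distrC.
have -> : h^-1 *: (f (x + h *: v) - f x) - l = h^-1 * (f (x + h *: v) - f x - h * l).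
  by rewrite mulrBr mulKf.
rewrite normrM normfV ler_pdivrMl//.
have := hC h; rewrite hp h1 => /(_ isT) /le_trans; apply.
rewrite -(real_normK (num_real h)) expr2 mulrCA ler_pM2l//.
move: he; rewrite ler_pdivlMr; last lra.
by move=> he; apply: le_trans he; rewrite mulrC ler_pM2l//; lra.
Unshelve. all: by end_near. Qed.

(** * Partial derivatives *)

Section DirectionalDerivatives.
Variables (R : realType) (N : nat).
Implicit Types (u v : 'rV[R]_N -> R) (x y : 'rV[R]_N) (i j : 'I_N) (s : seq 'I_N).

Definition unitv (i : 'I_N) : 'rV[R]_N := delta_mx 0 i.

Definition ddx i u x (l : R) := is_derive x (unitv i) (u : 'rV[R]_N -> R^o) l.

Lemma ddx_partial i u x l : ddx i u x l -> partial i u x = l.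
Proof. by move=> h; rewrite /partial; exact: (@derive_val _ _ _ _ _ _ _ h). Qed.

Lemma slice_quotient i u x t :
  (fun h : R => h^-1 *: (((fun r : R => u (x + r *: unitv i) : R^o) \o shift t) (h *: (1 : R^o)) -
    (u (x + t *: unitv i) : R^o))) =
  (fun h : R => h^-1 *: (((u : 'rV[R]_N -> R^o) \o shift (x + t *: unitv i)) (h *: unitv i) -
    u (x + t *: unitv i))).
Proof.
apply/funext => h /=; congr (_ *: (u _ - _)).
by rewrite [h *: 1]mulr1 scalerDl addrCA.
Qed.

Lemma ddx_slice i u x t l : ddx i u (x + t *: unitv i) l <->
  is_derive t (1 : R^o) (fun r => u (x + r *: unitv i) : R^o) l.
Proof.
have E := slice_quotient i u x t.
split=> -[h1 h2]; split.
- by rewrite /derivable E.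
- by rewrite /derive E.
- by rewrite /derivable -E.
- by rewrite /derive -E.
Qed.

Lemma ddx0_slice i u x l : ddx i u x l <->
  is_derive (0 : R) (1 : R^o) (fun r => u (x + r *: unitv i) : R^o) l.
Proof. by rewrite -ddx_slice scale0r addr0. Qed.

Lemma is_derive_continuous (f : R -> R) (df : R -> R) :
  (forall t, is_derive t (1 : R^o) (f : R -> R^o) (df t)) -> continuous f.
Proof.
move=> h t; apply/differentiable_continuous/derivable1_diffP.
by case: (h t).
Qed.

Lemma mvt_real (f df : R -> R) a b :
  (forall t, is_derive t (1 : R^o) (f : R -> R^o) (df t)) -> a <= b ->
  exists2 c, a <= c <= b & f b - f a = df c * (b - a).
Proof.
move=> h ab.
have H1 t : t \in `]a, b[%R -> is_derive t 1 f (df t) by move=> _; exact: h.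
have H2 : {within `[a, b], continuous f}.
  exact/continuous_subspaceT/(is_derive_continuous h).
have [c cab ->] := MVT_segment ab H1 H2.
by exists c => //; move: cab; rewrite in_itv.
Qed.

Lemma mvt_dir i u du x h : (forall t, ddx i u (x + t *: unitv i) (du (x + t *: unitv i))) ->
  exists2 c, `|c| <= `|h| & u (x + h *: unitv i) - u x = h * du (x + c *: unitv i).
Proof.
move=> d; pose f r := u (x + r *: unitv i); pose df r := du (x + r *: unitv i).
have fd t : is_derive t (1 : R^o) (f : R -> R^o) (df t) by apply/ddx_slice/d.
have f0 : u x = f 0 by rewrite /f scale0r addr0.
rewrite f0; case: (leP 0 h) => h0.
  have [c /andP[c1 c2] e] := mvt_real fd h0.
  exists c; first by rewrite !ger0_norm//.
  by rewrite -[u _]/(f h) e subr0 mulrC.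
have [c /andP[c1 c2] e] := mvt_real fd (ltW h0).
exists c; first by rewrite (ler0_norm c2) (ler0_norm (ltW h0)) lerN2.
by rewrite -[u _]/(f h) -opprB e sub0r mulrN opprK mulrC.
Qed.

Lemma ddx_quad i u x l (C : R) : (forall h, 0 < `|h| <= 1 ->
    `|u (x + h *: unitv i) - u x - h * l| <= C * h ^+ 2) -> ddx i u x l.
Proof. exact: is_derive_quad. Qed.

Lemma quad_bound i u du ddu x h (B : R) :
  (forall y, ddx i u y (du y)) -> (forall y, ddx i du y (ddu y)) ->
  (forall t, `|t| <= `|h| -> `|ddu (x + t *: unitv i)| <= B) ->
  `|u (x + h *: unitv i) - u x - h * du x| <= B * h ^+ 2.
Proof.
move=> d1 d2 b.
have [c ch ->] := mvt_dir h (fun t => d1 (x + t *: unitv i)).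
have [c' cc' e] := mvt_dir c (fun t => d2 (x + t *: unitv i)).
rewrite -mulrBr e normrM normrM -(real_normK (num_real h)) expr2.
have := b _ (le_trans cc' ch).
have := normr_ge0 c; have := normr_ge0 h; have := normr_ge0 (ddu (x + c' *: unitv i)).
move: (`|ddu _|) (`|c|) (`|h|) ch => a p q pq a0 q0 p0 ab.
rewrite [leRHS]mulrCA; apply: ler_wpM2l => //.
by rewrite mulrC; apply: ler_pM.
Qed.

(** A candidate for all iterated partial derivatives at once. Exhibiting a jet computes every
    [iter_partial] ([jet_iter]) and reduces smoothness to continuity, without a new induction for
    each construction. *)
Definition jet (d : seq 'I_N -> 'rV[R]_N -> R) :=
  forall s i x, ddx i (d s) x (d (i :: s) x).

Lemma jet_iter d s : jet d -> iter_partial s (d [::]) = d s.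
Proof.
move=> jd; elim: s => [//|i s IH]; apply/funext => x.
by rewrite /= -/(iter_partial s _) IH; exact/ddx_partial/jd.
Qed.

Lemma smooth_jet u : smooth_real u -> jet (fun s => iter_partial s u).
Proof. by move=> su s i x; apply: derivableP; have [h _] := su s; exact: h. Qed.

Lemma jet_smooth d : jet d -> (forall s, continuous (d s : 'rV[R]_N -> R^o)) ->
  smooth_real (d [::]).
Proof.
move=> jd cd s; rewrite jet_iter//; split=> // i x.
by have [] := jd s i x.
Qed.

Lemma lip_of_partials u (du : 'I_N -> 'rV[R]_N -> R) (B : R) :
  (forall i x, ddx i u x (du i x)) -> (forall i x, `|du i x| <= B) ->
  forall x y, `|u x - u y| <= B * \sum_i `|x 0 i - y 0 i|.
Proof.
move=> d b x y.
have key (l : seq 'I_N) (z : 'I_N -> R) p :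
    `|u (p + \sum_(i <- l) z i *: unitv i) - u p| <= B * \sum_(i <- l) `|z i|.
  elim: l p => [|i l IH] p; first by rewrite !big_nil addr0 subrr normr0 mulr0.
  rewrite !big_cons addrA; set q := p + _.
  rewrite -(subrKA (u q)); apply: (le_trans (ler_normD _ _)).
  rewrite mulrDr [leRHS]addrC lerD//.
  have [c _ ->] := mvt_dir (z i) (fun t => d i (p + t *: unitv i)).
  by rewrite normrM mulrC ler_wpM2r.
have := key (index_enum 'I_N) (fun i => x 0 i - y 0 i) y.
suff -> : y + \sum_i (x 0 i - y 0 i) *: unitv i = x by [].
have -> : \sum_i (x 0 i - y 0 i) *: unitv i = \sum_i (x - y) 0 i *: unitv i.
  by apply: eq_bigr => i _; rewrite !mxE.
by rewrite -row_sum_delta addrC subrK.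
Qed.

Lemma coord_le_norm x i : `|x 0 i| <= `|x|.
Proof. by have := @le_trans; rewrite [`|x|]mx_normrE => _; exact: (le_bigmax _ (fun ij : 'I_1 * 'I_N => `|x ij.1 ij.2|) (0, i)). Qed.

Lemma continuous_of_partials u (du : 'I_N -> 'rV[R]_N -> R) (B : R) :
  (forall i x, ddx i u x (du i x)) -> (forall i x, `|du i x| <= B) ->
  continuous (u : 'rV[R]_N -> R^o).
Proof.
move=> d b x; apply: (proj2 (@cvgrPdist_le _ _ _ (nbhs x) (nbhs_filter x) (u : 'rV[R]_N -> R^o) (u x))).
move=> e e0; near=> y.
apply: (le_trans (lip_of_partials d b x y)).
have Bx : B <= `|B| by exact: ler_norm.
have S0 : 0 <= \sum_i `|x 0 i - y 0 i| by rewrite sumr_ge0.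
apply: (@le_trans _ _ (`|B| * \sum_(i < N) `|x - y|)).
  apply: (@le_trans _ _ (`|B| * \sum_i `|x 0 i - y 0 i|)); first exact: ler_wpM2r.
  apply: ler_wpM2l => //; apply: ler_sum => i _.
  by have := coord_le_norm (x - y) i; rewrite !mxE.
rewrite sumr_const card_ord -mulr_natr mulrC -mulrA mulrC.
have : `|x - y| <= e / (N%:R * `|B| + 1).
  near: y; apply: cvgr_dist_le; last exact: divr_gt0.
  exact: cvg_id.
have p : 0 < N%:R * `|B| + 1 by rewrite ltr_wpDl ?mulr_ge0.
rewrite ler_pdivlMr//; apply: le_trans.
by rewrite mulrC; apply: ler_wpM2l => //; rewrite lerDl.
Unshelve. all: by end_near. Qed.

(** Continuity is automatic: the derivatives of the next order are bounded, so each member of the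
    jet is Lipschitz. *)
Lemma smooth_of_bounded d : jet d -> (forall s, exists B : R, forall x, `|d s x| <= B) ->
  smooth_real (d [::]).
Proof.
move=> jd /choice[B b]; apply: jet_smooth => // s.
apply: (@continuous_of_partials _ (fun i => d (i :: s)) (\sum_i B (i :: s))) => [i x|i x].
  exact: jd.
apply: (le_trans (b _ _)); rewrite (bigD1 i)//= lerDl sumr_ge0// => j _.
exact: le_trans (b (j :: s) x).
Qed.

Lemma iter_partial_cat s s' u :
  iter_partial (s ++ s') u = iter_partial s (iter_partial s' u).
Proof. by rewrite /iter_partial foldr_cat. Qed.

Lemma smooth_iter s u : smooth_real u -> smooth_real (iter_partial s u).
Proof. by move=> su s'; rewrite -iter_partial_cat; exact: su. Qed.

Lemma smooth_ddx u i x : smooth_real u -> ddx i u x (partial i u x).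
Proof. by move=> /smooth_jet/(_ [::] i x). Qed.

Lemma smooth_continuous u : smooth_real u -> continuous (u : 'rV[R]_N -> R^o).
Proof. by move=> su; have [] := su [::]. Qed.

Lemma ddxD i u v x a b : ddx i u x a -> ddx i v x b -> ddx i (u \+ v) x (a + b).
Proof. by move=> ua vb; exact: (@is_deriveD _ _ _ (u : _ -> R^o) v). Qed.

Lemma ddxZ i u x (k a : R) : ddx i u x a -> ddx i (fun y => k * u y) x (k * a).
Proof. by move=> ua; exact: (@is_deriveZ _ _ _ (u : _ -> R^o) k). Qed.

Lemma ddxM i u v x a b : ddx i u x a -> ddx i v x b ->
  ddx i (fun y => u y * v y) x (a * v x + u x * b).
Proof.
move=> ua vb; have := @is_deriveM _ _ (u : _ -> R^o) v _ _ _ _ ua vb.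
have -> : u x *: b + v x *: a = a * v x + u x * b by rewrite addrC [a * _]mulrC.
by [].
Qed.

Lemma ddx_cst i (k : R) x : ddx i (fun=> k) x 0.
Proof. exact: is_derive_cst. Qed.

Lemma ddx_affine i u (a : 'rV[R]_N) (c : R) x l : ddx i u (a + c *: x) l ->
  ddx i (fun y => u (a + c *: y)) x (c * l).
Proof.
move=> /ddx0_slice h; apply/ddx0_slice.
have -> : (fun r => u (a + c *: (x + r *: unitv i)) : R^o) =
    (fun r => u (a + c *: x + r *: unitv i) : R^o) \o (fun r => c * r).
  by apply/funext => r /=; rewrite scalerDr scalerA addrA.
rewrite mulrC; apply: is_derive1_comp; first by rewrite mulr0.
by have := @is_deriveZ _ _ _ (id : R -> R^o) c 0 1 1 (is_derive_id _ _); rewrite [_ *: _]mulr1.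
Qed.

Lemma jetD d d' : jet d -> jet d' -> jet (fun s => d s \+ d' s).
Proof. by move=> h h' s i x; apply: ddxD. Qed.

Lemma smoothD u v : smooth_real u -> smooth_real v -> smooth_real (u \+ v).
Proof.
move=> su sv; apply: (jet_smooth (jetD (smooth_jet su) (smooth_jet sv))) => s.
by move=> x; apply: (@continuousD _ _ _ (iter_partial s u : _ -> R^o)); apply: smooth_continuous; exact: smooth_iter.
Qed.

Lemma iterD s u v : smooth_real u -> smooth_real v ->
  iter_partial s (u \+ v) = iter_partial s u \+ iter_partial s v.
Proof. by move=> su sv; exact: (jet_iter s (jetD (smooth_jet su) (smooth_jet sv))). Qed.

Lemma jetZ d (k : R) : jet d -> jet (fun s x => k * d s x).
Proof. by move=> h s i x; apply: ddxZ. Qed.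

Lemma smoothZ u (k : R) : smooth_real u -> smooth_real (fun x => k * u x).
Proof.
move=> su; apply: (jet_smooth (jetZ k (smooth_jet su))) => s.
by move=> x; apply: (@continuousM _ _ (fun=> k) (iter_partial s u)); [exact: cst_continuous|apply: smooth_continuous; exact: smooth_iter].
Qed.

Lemma iterZ s u (k : R) : smooth_real u ->
  iter_partial s (fun x => k * u x) = (fun x => k * iter_partial s u x).
Proof. by move=> su; exact: (jet_iter s (jetZ k (smooth_jet su))). Qed.

Lemma jet_affine d (a : 'rV[R]_N) (c : R) : jet d ->
  jet (fun s x => c ^+ size s * d s (a + c *: x)).
Proof.
move=> h s i x /=; rewrite exprSr -mulrA; apply: ddxZ.
exact: ddx_affine.
Qed.

Lemma smooth_affine u (a : 'rV[R]_N) (c : R) : smooth_real u ->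
  smooth_real (fun x => u (a + c *: x)).
Proof.
move=> su; have := jet_smooth (jet_affine a c (smooth_jet su)); rewrite /=.
set f := (fun x => _); have -> : f = (fun x => u (a + c *: x)).
  by apply/funext => x; rewrite /f mul1r.
apply => s x; apply: (@continuousM _ _ (fun=> c ^+ size s) (fun x => iter_partial s u (a + c *: x))).
  exact: cst_continuous.
apply: (@continuous_comp _ _ _ (fun x => a + c *: x) (iter_partial s u : _ -> R^o)).
  apply: (@continuousD _ _ _ (fun=> a)); first exact: cst_continuous.
  exact: scaler_continuous.
by apply: smooth_continuous; exact: smooth_iter.
Qed.

Lemma iter_affine s u (a : 'rV[R]_N) (c : R) : smooth_real u ->
  iter_partial s (fun x => u (a + c *: x)) =
  (fun x => c ^+ size s * iter_partial s u (a + c *: x)).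
Proof.
move=> su; rewrite -(jet_iter s (jet_affine a c (smooth_jet su)))/=.
by congr iter_partial; apply/funext => x; rewrite mul1r.
Qed.

Fixpoint masks n : seq (seq bool) :=
  if n is n'.+1 then map (cons true) (masks n') ++ map (cons false) (masks n')
  else [:: [::]].

Lemma size_masks n : size (masks n) = (2 ^ n)%N.
Proof. by elim: n => // n IH; rewrite /= size_cat !size_map IH expnS mul2n addnn. Qed.

Lemma size_mask_masks (T : Type) (s : seq T) m : m \in masks (size s) ->
  (size (mask m s) + size (mask (map negb m) s) = size s)%N.
Proof.
elim: s m => [|a s IH] m /=; first by rewrite !mask0.
rewrite mem_cat => /orP[] /mapP[m' hm' ->] /=; by rewrite ?addSn ?addnS IH.
Qed.

(** Each mask sends the selected letters of [s] to the first factor and the others to the second.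
    All terms have coefficient 1; repeated letters account for the binomial coefficients. *)
Definition leibniz (d d' : seq 'I_N -> 'rV[R]_N -> R) s x :=
  \sum_(m <- masks (size s)) d (mask m s) x * d' (mask (map negb m) s) x.

Lemma ddx_sum (I : Type) (r : seq I) i (F : I -> 'rV[R]_N -> R) (dF : I -> R) x :
  (forall k, ddx i (F k) x (dF k)) ->
  ddx i (fun y => \sum_(k <- r) F k y) x (\sum_(k <- r) dF k).
Proof.
move=> h; elim: r => [|k r IH].
  by rewrite big_nil; under eq_fun do rewrite big_nil; exact: ddx_cst.
by rewrite big_cons; under eq_fun do rewrite big_cons; exact: ddxD.
Qed.

Lemma jetM d d' : jet d -> jet d' -> jet (leibniz d d').
Proof.
move=> h h' s i x.
have -> : leibniz d d' (i :: s) x = \sum_(m <- masks (size s))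
    (d (i :: mask m s) x * d' (mask (map negb m) s) x +
     d (mask m s) x * d' (i :: mask (map negb m) s) x).
  by rewrite /leibniz /= big_cat !big_map big_split.
by apply: ddx_sum => m; apply: ddxM; [exact: h|exact: h'].
Qed.

Lemma continuous_sum_seq (I : Type) (r : seq I) (F : I -> 'rV[R]_N -> R^o) :
  (forall k, continuous (F k)) -> continuous (fun y => \sum_(k <- r) F k y).
Proof.
move=> h; elim: r => [|k r IH].
  by under eq_fun do rewrite big_nil; exact: cst_continuous.
under eq_fun do rewrite big_cons; move=> x.
by apply: (@continuousD _ _ _ (F k)); [exact: h|exact: IH].
Qed.

Lemma leibniz_nil d d' : leibniz d d' [::] = (fun x => d [::] x * d' [::] x).
Proof. by apply/funext => x; rewrite /leibniz /= big_seq1. Qed.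

Lemma smoothM u v : smooth_real u -> smooth_real v -> smooth_real (fun x => u x * v x).
Proof.
move=> su sv; have := jet_smooth (jetM (smooth_jet su) (smooth_jet sv)).
rewrite leibniz_nil; apply => s; apply: continuous_sum_seq => m x.
by apply: (@continuousM _ _ (iter_partial _ u) (iter_partial _ v)); apply: smooth_continuous; exact: smooth_iter.
Qed.

Lemma iterM_bound s u v x (B : R) : smooth_real u -> smooth_real v ->
  (forall p q, (size p + size q = size s)%N ->
    `|iter_partial p u x| * `|iter_partial q v x| <= B) ->
  `|iter_partial s (fun x => u x * v x) x| <= 2 ^+ size s * B.
Proof.
move=> su sv h; have := jet_iter s (jetM (smooth_jet su) (smooth_jet sv)).
rewrite leibniz_nil /= => ->; rewrite /leibniz.
apply: (le_trans (ler_norm_sum _ _ _)).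
apply: (@le_trans _ _ (\sum_(m <- masks (size s)) B)).
  rewrite !big_seq; apply: ler_sum => m hm; rewrite normrM; apply: h.
  exact: size_mask_masks.
by rewrite big_const_seq count_predT iter_addr_0 size_masks -natrX mulr_natl.
Qed.

Lemma dist_le_of_close (p q a b e : R) :
  `|p - a| <= e / 2 -> `|q - b| <= e / 2 -> p = q -> `|a - b| <= e.
Proof.
move=> + + pq; rewrite pq !ler_norml => /andP[? ?] /andP[? ?].
by apply/andP; split; lra.
Qed.

(** The mixed second difference of step [h] is symmetric in the two directions. Two applications of
    the mean value theorem, in either order, express it as [h ^+ 2] times one or the other mixed
    derivative at a point close to [x]. *)
Lemma partial_comm u i j : smooth_real u ->
  partial i (partial j u) = partial j (partial i u).
Proof.
move=> su; apply/funext => x.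
set A := partial i _ x; set B := partial j _ x.
have cA : continuous (partial i (partial j u) : 'rV[R]_N -> R^o).
  by have [] := su [:: i; j].
have cB : continuous (partial j (partial i u) : 'rV[R]_N -> R^o).
  by have [] := su [:: j; i].
have sj := smooth_iter [:: j] su; have si := smooth_iter [:: i] su.
have second i' j' h : exists c c', [/\ `|c| <= `|h|, `|c'| <= `|h| &
    u (x + h *: unitv i' + h *: unitv j') - u (x + h *: unitv i') -
    (u (x + h *: unitv j') - u x) =
    h * (h * partial i' (partial j' u) (x + c *: unitv j' + c' *: unitv i'))].
  pose g y := u (y + h *: unitv i') - u y.
  pose dg y := partial j' u (y + h *: unitv i') - partial j' u y.
  have gd y : ddx j' g y (dg y).
    have := ddxD (ddx_affine (a := h *: unitv i') (c := 1) (x := y) (smooth_ddx j' _ su))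
      (ddxZ (-1) (smooth_ddx j' y su)).
    rewrite mul1r mulN1r scale1r /dg [h *: _ + _]addrC.
    congr ddx; apply/funext => z.
    by rewrite /g /= mulN1r scale1r addrC [h *: _ + _]addrC addrC.
  have [c ch e] := mvt_dir h (fun t => gd (x + t *: unitv j')).
  have [c' ch' e'] := mvt_dir h (fun t => smooth_ddx i' (x + c *: unitv j' + t *: unitv i') (smooth_iter [:: j'] su)).
  exists c, c'; split => //; rewrite -e'.
  transitivity (g (x + h *: unitv j') - g x); last by rewrite e.
  rewrite /g.
  rewrite [x + h *: unitv j' + _]addrAC; ring.
apply/eqP; rewrite -subr_eq0 -normr_le0; apply/ler_addgt0Pl => e e0; rewrite addr0.
have e2 : 0 < e / 2 by rewrite divr_gt0.
have near0 (f : 'rV[R]_N -> R^o) : continuous f -> exists2 r : R, 0 < r &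
    forall y, `|y| < r -> `|f (x + y) - f x| <= e / 2.
  move=> cf; have := cf x => /(@cvgrPdist_le _ _ _ (nbhs x) (nbhs_filter x) f (f x)) /(_ _ e2).
  rewrite near_simpl => /nbhs_normP[r /= r0 hr]; exists r => // y yr.
  rewrite distrC; apply: hr; rewrite /= opprD addNKr normrN//.
have [r1 r10 h1] := near0 _ cA; have [r2 r20 h2] := near0 _ cB.
pose C := `|unitv i| + `|unitv j| + 1.
have C0 : 0 < C by rewrite /C ltr_wpDl// addr_ge0.
pose h := Num.min r1 r2 / C / 2.
have h0 : 0 < h by rewrite /h !divr_gt0// lt_min r10 r20.
have hC : h * C < Num.min r1 r2.
  rewrite /h mulrAC divfK ?gt_eqF// ltr_pdivrMr//.
  have : 0 < Num.min r1 r2 by rewrite lt_min r10 r20.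
  lra.
have small c c' : `|c| <= `|h| -> `|c'| <= `|h| ->
    `|c *: unitv i + c' *: unitv j| < Num.min r1 r2.
  move=> hc hc'; apply: le_lt_trans hC; apply: (le_trans (ler_normD _ _)).
  rewrite (gtr0_norm h0) in hc hc'; rewrite !normrZ /C !mulrDr mulr1.
  rewrite -[leLHS]addr0; apply: lerD; last exact: ltW.
  by apply: lerD; apply: ler_wpM2r.
have [c [c' [hc hc' e1]]] := second i j h.
have [k [k' [hk hk' e2']]] := second j i h.
have E : partial i (partial j u) (x + c *: unitv j + c' *: unitv i) =
    partial j (partial i u) (x + k *: unitv i + k' *: unitv j).
  apply: (mulfI (lt0r_neq0 h0)); apply: (mulfI (lt0r_neq0 h0)).
  apply: (etrans (esym e1)); apply: etrans e2'.
  rewrite [x + h *: unitv j + _]addrAC.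
  move: (u _) (u _) (u _) (u _) => a1 a2 a3 a4; ring.
have s1 := small _ _ hc' hc; rewrite lt_min in s1; case/andP: s1 => s1 _.
have s2 := small _ _ hk hk'; rewrite lt_min in s2; case/andP: s2 => _ s2.
have {s1}a1 := h1 _ s1; have {s2}a2 := h2 _ s2.
have ex : x + (c' *: unitv i + c *: unitv j) = x + c *: unitv j + c' *: unitv i.
  by rewrite addrA addrAC.
rewrite ex in a1; rewrite addrA in a2.
exact: (dist_le_of_close a1 a2 E).
Qed.

(** With [perm_mseq], this transfers estimates between words and the multi-indices of the norms. *)
Lemma iter_partial_perm s s' u : smooth_real u -> perm_eq s s' ->
  iter_partial s u = iter_partial s' u.
Proof.
move=> su; elim: s s' => [|i s IH] s' pe.
  by have /eqP := perm_size pe; rewrite eq_sym => /nilP ->.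
have is' : i \in s' by rewrite -(perm_mem pe) mem_head.
have move_front t : i \in t -> iter_partial t u = partial i (iter_partial (rem i t) u).
  elim: t => [//|j t IHt]; rewrite inE.
  have [-> _|ji /= it] := eqVneq i j; first by rewrite /= eqxx.
  rewrite [j == i]eq_sym (negbTE ji).
  rewrite (IHt it); apply: (partial_comm j i); exact: (smooth_iter _ su).
rewrite (move_front s')//; congr (partial i _); apply: IH.
by rewrite -(perm_cons i); apply: (perm_trans pe); exact: perm_to_rem.
Qed.

End DirectionalDerivatives.

(** * Words of directions and multi-indices *)

Section MultiIndices.
Variable N : nat.

Lemma size_mseq (al : multi_index N) : size (mseq al) = mlen al.
Proof.
rewrite /mseq /mlen size_flatten /shape -map_comp sumnE big_map big_enum/=.
by apply: eq_bigr => i _; rewrite size_nseq.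
Qed.

Lemma perm_mseq (s : seq 'I_N) : exists al : multi_index N, perm_eq s (mseq al).
Proof.
exists [ffun i => count_mem i s]; apply/allP => i _ /=; apply/eqP.
rewrite /mseq count_flatten -map_comp sumnE big_map big_enum/= (bigD1 i)//=.
rewrite count_nseq /= eqxx mul1n ffunE big1 ?addn0// => j ji.
by rewrite count_nseq /= (negbTE ji).
Qed.

End MultiIndices.

(** * A Landau-Gorny inequality *)

Section LagrangeInterpolation.
Variable R : realType.

Definition lagrange n (i : nat) : {poly R} :=
  (\prod_(l <- iota 0 n | l != i) (i%:R - l%:R))^-1 *:
  \prod_(l <- iota 0 n | l != i) ('X - (l%:R)%:P).

Lemma lagrange_eval n i l : (l < n)%N -> (lagrange n i).[l%:R] = (l == i)%:R.
Proof.
move=> ln; rewrite /lagrange hornerZ horner_prod.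
have [->|li] := eqVneq l i.
  rewrite [X in _ * X](eq_bigr (fun j : nat => i%:R - j%:R)) => [|j _]; last by rewrite hornerXsubC.
  rewrite mulVf//.
  rewrite prodf_seq_neq0; apply/allP => j _; apply/implyP => ji.
  by rewrite subr_eq0 eqr_nat eq_sym.
rewrite [X in _ * X]big_mkcond [X in _ * X](bigD1_seq l)/= ?mem_iota ?iota_uniq//= li.
by rewrite !hornerXsubC subrr mul0r mulr0.
Qed.

Lemma size_lagrange n i : (i < n)%N -> (size (lagrange n i) <= n)%N.
Proof.
move=> iln; apply: (leq_trans (size_scale_leq _ _)).
rewrite -big_filter size_prod_XsubC size_filter.
have := count_predC (pred1 i) (iota 0 n).
rewrite size_iota count_uniq_mem ?iota_uniq// mem_iota iln add1n => e.
by rewrite -[X in (_ <= X)%N]e.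
Qed.

Lemma lagrange_interpolation n (p : {poly R}) : (size p <= n)%N ->
  p = \sum_(i < n) p.[i%:R] *: lagrange n i.
Proof.
move=> sp; apply/eqP; rewrite -subr_eq0; apply/eqP.
apply: (@roots_geq_poly_eq0 _ _ [seq i%:R | i <- iota 0 n]).
- apply/allP => x /mapP[l]; rewrite mem_iota/= add0n => ln -> {x}.
  rewrite /root !hornerE horner_sum subr_eq0 (bigD1 (Ordinal ln))//= hornerZ.
  rewrite lagrange_eval// eqxx mulr1 big1 ?addr0// => i il.
  rewrite hornerZ lagrange_eval// (_ : (l == i) = false) ?mulr0//.
  by apply/negbTE; apply: contra il => /eqP e; apply/eqP/val_inj; rewrite /= e.
- by rewrite map_inj_uniq ?iota_uniq// => x y /eqP; rewrite eqr_nat => /eqP.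
- rewrite size_map size_iota; apply: (leq_trans (size_polyD _ _)).
  rewrite geq_max sp size_polyN; apply: (leq_trans (size_sum _ _ _)).
  by apply/bigmax_leqP => i _; apply: (leq_trans (size_scale_leq _ _)); exact: size_lagrange.
Qed.

(** The coefficients are dominated by those of the product of the [X + |c|], which are nonnegative,
    so each monomial is at most the value of that product at [tau]. *)
Lemma coef_prod_XsubC_bound (s : seq R) (tau : R) k : 0 < tau ->
  `|(\prod_(c <- s) ('X - c%:P))`_k| * tau ^+ k <= \prod_(c <- s) (tau + `|c|).
Proof.
move=> t0; elim: s k => [|c s IH] k.
  rewrite !big_nil coef1; case: k => [|k]; rewrite ?normr1 ?normr0 ?mul0r//.
  by rewrite expr0 mulr1.
rewrite !big_cons mulrBl coefB coefXM coefCM mulrDl.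
set P := \prod_(_ <- s) (_ - _); set Q := \prod_(_ <- s) (_ + _).
apply: (@le_trans _ _ ((`|if k == 0%N then 0 else P`_k.-1| + `|c| * `|P`_k|) * tau ^+ k)).
  by rewrite ler_pM2r ?exprn_gt0// -normrM; exact: ler_normB.
rewrite mulrDl lerD//; last by rewrite -mulrA ler_wpM2l// IH.
case: k => [|k] /=.
  rewrite normr0 mul0r; apply: mulr_ge0; first exact: ltW.
  by apply: prodr_ge0 => i _; apply: addr_ge0 => //; exact: ltW.
by rewrite exprS mulrCA ler_pM2l// IH.
Qed.

Lemma prod_dist_fact n i : (i < n)%N ->
  \prod_(l <- iota 0 n | l != i) `|i%:R - l%:R : R| = (i`! * (n.-1 - i)`!)%:R.
Proof.
move=> iln.
have -> : iota 0 n = iota 0 i ++ i :: iota i.+1 (n.-1 - i).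
  rewrite -[i :: _]/(iota (0 + i) (n.-1 - i).+1) -iotaD; congr iota.
  by lia.
rewrite big_cat big_cons /= eqxx/= natrM; congr (_ * _).
  rewrite fact_prod natr_prod big_add1/= big_seq_cond.
  rewrite [RHS](_ : _ = \prod_(0 <= l < i) `|i%:R - l%:R|).
    rewrite /index_iota subn0 [RHS]big_seq; apply: eq_bigl => l.
    by rewrite mem_iota/= add0n; case: ltngtP.
  rewrite [RHS]big_nat_rev/= add0n; apply: eq_big_nat => l /andP[_ li].
  by rewrite natrB// opprB addrC subrK ger0_norm.
rewrite fact_prod natr_prod big_add1/= big_seq_cond.
rewrite -[in LHS](addn0 i.+1) iotaDl big_map /index_iota subn0 [RHS]big_seq_cond.
apply: eq_big => [l|l _].
  by rewrite andbT (mem_map (@addnI _)) neq_ltn (_ : i < i.+1 + l)%N ?orbT ?andbT// addSn ltnS leq_addr.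
by rewrite distrC addSn -addnS natrD addrC addKr ger0_norm.
Qed.

(** A crude form of Stirling's formula, from n^n n! <= (2n)! and the bound 4^n for the central
    binomial coefficient. *)
Lemma exprnn_le_fact n : (n ^ n <= 4 ^ n * n`!)%N.
Proof.
have h1 : (n ^ n * n`! <= (n + n)`!)%N.
  have aux m : (n ^ m * n`! <= (m + n)`!)%N.
    elim: m => [|m IH]; first by rewrite mul1n.
    by rewrite expnS -mulnA addSn factS leq_mul// leqW// leq_addl.
  exact: aux.
have h2 : ((n + n)`! = 'C(n + n, n) * (n`! * n`!))%N.
  by rewrite -{1}(bin_fact (leq_addr n n)) addnK.
have h3 : ('C(n + n, n) <= 4 ^ n)%N.
  rewrite (_ : (4 ^ n = 2 ^ (n + n))%N); last by rewrite expnD -expnMn.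
  rewrite -[2%N]/(1 + 1)%N expnDn (bigD1 (inord n))//= inordK ?ltnS ?leq_addr//.
  by rewrite !exp1n !muln1 leq_addr.
rewrite -(leq_pmul2r (fact_gt0 n)); apply: (leq_trans h1).
by rewrite h2 mulnA leq_mul2r leq_mul// ?orbT// leq_mul2r h3 orbT.
Qed.

Lemma bin_le_pow2 m k : ('C(m, k) <= 2 ^ m)%N.
Proof.
case: (leqP k m) => km; last by rewrite bin_small.
rewrite -[2%N]/(1 + 1)%N expnDn (bigD1 (inord k))//= inordK//.
by rewrite !exp1n !muln1 leq_addr.
Qed.

(** The coefficient bound is applied with [tau = k], and k! <= k^k. The remaining quotient (3k-1)! /
    ((k-1)! i! (2k-1-i)!) equals C(3k-1, 2k) * 2k * C(2k-1, i), a product of factors at most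
    exponential in k. *)
Lemma coef_lagrange k i : (0 < k)%N -> (i < k + k)%N ->
  k`!%:R * `|(lagrange (k + k) i)`_k| <= 2 ^+ (6 * k) :> R.
Proof.
move=> k0 ik; rewrite /lagrange coefZ normrM normfV normr_prod prod_dist_fact//.
set P := \prod_(l <- _ | _) _; set n := (k + k)%N in ik *.
have hP : `|P`_k| * k%:R ^+ k <= \prod_(l <- iota 0 n) (k%:R + l%:R).
  have -> : P = \prod_(c <- [seq l%:R | l <- iota 0 n & l != i]) ('X - c%:P).
    by rewrite big_map big_filter.
  apply: (le_trans (coef_prod_XsubC_bound _ _ _)); first by rewrite ltr0n.
  rewrite big_map big_filter big_mkcond/=; apply: ler_prod => l _.
  by case: ifP => _; rewrite ?ler01 ?normr_nat ?lexx ?addr_ge0//= -natrD ler1n addn_gt0 k0.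
have hQ : \prod_(l <- iota 0 n) (k%:R + l%:R) * (k.-1)`!%:R = ((k.-1 + n)`!)%:R :> R.
  elim: {ik P hP}n => [|n IH]; first by rewrite big_nil mul1r addn0.
  rewrite -addn1 iotaD big_cat big_seq1/= add0n mulrAC IH addn1 addnS factS natrM mulrC.
  by rewrite -natrD -addSn prednK.
have hM : \prod_(l <- iota 0 n) (k%:R + l%:R) =
    ('C(k.-1 + n, n) * (n * ('C(n.-1, i) * (i`! * (n.-1 - i)`!))))%:R :> R.
  have f0 : (k.-1)`!%:R != 0 :> R by rewrite pnatr_eq0 -lt0n fact_gt0.
  apply: (mulIf f0); rewrite hQ -natrM; congr (_%:R).
  have n0 : (0 < n)%N by rewrite addn_gt0 k0.
  rewrite bin_fact; last by rewrite -ltnS prednK.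
  rewrite -[X in (X * (n.-1)`!)%N](prednK n0) -factS prednK//.
  by rewrite -(bin_fact (leq_addl k.-1 n)) addnK mulnA.
have D0 : 0 < (i`! * (n.-1 - i)`!)%:R :> R by rewrite ltr0n muln_gt0 !fact_gt0.
rewrite mulrCA mulrC ler_pdivrMr//.
apply: (@le_trans _ _ (\prod_(l <- iota 0 n) (k%:R + l%:R))).
  apply: le_trans hP; rewrite mulrC ler_wpM2l// -natrX ler_nat.
  have aux m : (m <= k)%N -> (m`! <= k ^ m)%N.
    by elim: m => [//|m IH mk]; rewrite factS expnS leq_mul// IH// ltnW.
  exact: aux.
rewrite hM -natrX -natrM ler_nat !mulnA leq_mul2r leq_mul2r; apply/orP; right; apply/orP; right.
apply: (@leq_trans (2 ^ (k.-1 + n) * 2 ^ k * 2 ^ n.-1)).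
  rewrite !leq_mul ?bin_le_pow2//.
  by rewrite -(prednK k0) expnS /n -{1 2}(prednK k0) addnn -mul2n leq_mul2l ltn_expl.
rewrite -!expnD leq_exp2l// /n; move: k0; case: (k) => [//|m] _ /=.
by lia.
Qed.

Lemma taylor_bound n (h : nat -> R -> R) (B L : R) :
  (forall j t, is_derive t (1 : R^o) (h j : R -> R^o) (h j.+1 t)) ->
  (forall t, 0 <= t -> t <= L -> `|h n t| <= B) ->
  forall t, 0 <= t -> t <= L ->
    `|h 0%N t - (\poly_(j < n) (h j 0 / j`!%:R)).[t]| <= B * t ^+ n / n`!%:R.
Proof.
elim: n h => [|n IH] h dh hB t t0 tL.
  rewrite (_ : (\poly_(j < 0) _) = 0) ?horner0 ?subr0 ?expr0 ?mulr1 ?divr1 ?hB//.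
  by apply/polyP => j; rewrite coef_poly coef0.
set P := \poly_(j < n.+1) _.
have dP : P^`() = \poly_(j < n) (h j.+1 0 / j`!%:R).
  apply/polyP => j; rewrite coef_deriv !coef_poly ltnS; case: ifP => // _; last by rewrite mul0rn.
  rewrite factS natrM -mulr_natr; field.
  by rewrite !pnatr_eq0 -lt0n fact_gt0/=.
have P0 : P.[0] = h 0%N 0 by rewrite horner_coef0 coef_poly/= divr1.
have IH' := IH (fun j => h j.+1) (fun j => dh j.+1) hB.
(* Both signs of the error are treated alike: the function [g] below vanishes at 0, and its
   derivative is nonnegative by the induction hypothesis for the shifted family. *)
have key (sg : R) : `|sg| = 1 ->
    0 <= B * t ^+ n.+1 / n.+1`!%:R - sg * (h 0%N t - P.[t]).
  move=> sg1.
  pose g r := B / n.+1`!%:R * r ^+ n.+1 - sg * (h 0%N r - P.[r]).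
  pose dg r := B * r ^+ n / n`!%:R - sg * (h 1%N r - P^`().[r]).
  have gd r : is_derive r (1 : R^o) (g : R -> R^o) (dg r).
    have h1 := @is_deriveB _ _ _ _ _ _ _ _ _ (dh 0%N r) (is_derive_poly P r).
    have h2 := @is_deriveZ _ _ _ _ sg _ _ _ h1.
    have h3 := @is_deriveZ _ _ _ _ (B / n.+1`!%:R) _ _ _ (@is_deriveX _ _ _ n.+1 _ _ _ (is_derive_id r (1 : R^o))).
    have := @is_deriveB _ _ _ _ _ _ _ _ _ h3 h2.
    rewrite (_ : _ - _ = dg r); last first.
      rewrite /dg/=; congr (_ - _).
      rewrite /GRing.scale /= mulr1 factS natrM; field.
      by rewrite !pnatr_eq0 -lt0n fact_gt0/=.
    set F := (X in is_derive _ _ X _); suff -> : F = g by [].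
    by apply/funext => z; rewrite /F /g !fctE.
  have [c /andP[c0 ct] e] := mvt_real gd t0.
  have : 0 <= g t - g 0.
    rewrite e; apply: mulr_ge0; last by rewrite subr_ge0.
    rewrite /dg dP subr_ge0.
    apply: le_trans (IH' c c0 (le_trans ct tL)).
    by rewrite -[leRHS]mul1r -sg1 -normrM ler_norm.
  rewrite /g P0 subrr mulr0 subr0 expr0n/= mulr0 subr0.
  by rewrite mulrAC.
rewrite ler_norml; apply/andP; split.
  have := key (-1); rewrite normrN1 => /(_ erefl); lra.
by have := key 1; rewrite normr1 => /(_ erefl); lra.
Qed.

(* With the nodes [0, d, ..., (2k - 1) d], interpolation bounds the k-th Taylor
   coefficient; the step [d] balances the sampling term against the remainder. *)
Lemma gorny k (h : nat -> R -> R) (A B : R) : 0 < A -> 0 < B ->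
  (forall j t, is_derive t (1 : R^o) (h j : R -> R^o) (h j.+1 t)) ->
  (forall t, 0 <= t -> `|h 0%N t| <= A) ->
  (forall t, 0 <= t -> `|h (k + k)%N t| <= B) ->
  h k 0 ^+ 2 <= (2 ^+ 20) ^+ k * (A * B).
Proof.
move=> A0 B0 dh hA hB.
have [k0|k0] := posnP k.
  rewrite k0 in hB *; rewrite expr0 mul1r -(real_normK (num_real _)) expr2.
  by apply: ler_pM; rewrite ?normr_ge0 ?hA ?hB.
set n := (k + k)%N in hB; have n0 : (0 < n)%N by rewrite addn_gt0 k0.
have nR : 0 < n%:R :> R by rewrite ltr0n.
have f0 : 0 < n`!%:R :> R by rewrite ltr0n fact_gt0.
(* With [L ^+ n = c] the Taylor remainder is at most [A] on [0, L], so the Taylor polynomial is at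
   most [A + A] at the nodes. *)
pose c : R := n`!%:R * A / B; have c0 : 0 < c by rewrite divr_gt0// mulr_gt0.
pose L := expR (ln c / n%:R); have L0 : 0 < L := expR_gt0 _.
have Ln : L ^+ n = c by rewrite -expRM_natr divfK ?gt_eqF// lnK.
pose d := L / n%:R; have d0 : 0 < d by rewrite divr_gt0.
pose P : {poly R} := \poly_(j < n) (h j 0 / j`!%:R).
pose Q : {poly R} := \poly_(j < n) (h j 0 / j`!%:R * d ^+ j).
have QP t : Q.[t] = P.[d * t].
  rewrite !horner_poly; apply: eq_bigr => j _.
  by rewrite [(d * t) ^+ j]exprMn mulrA.
have kn : (k < n)%N by rewrite /n -[X in (X < _)%N]addn0 ltn_add2l.
have Qk : Q`_k = h k 0 / k`!%:R * d ^+ k by rewrite coef_poly kn.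
have Qi (i : 'I_n) : `|Q.[i%:R]| <= A + A.
  have t0 : 0 <= d * i%:R by rewrite mulr_ge0// ltW.
  have tL : d * i%:R <= L.
    by rewrite /d mulrAC ler_pdivrMr// ler_pM2l// ler_nat ltnW.
  have := taylor_bound dh (fun t h0 _ => hB t h0) t0 tL.
  rewrite -/P QP => ht; rewrite -(subKr (h 0%N (d * i%:R)) P.[_]).
  apply: (le_trans (ler_normB _ _)); apply: lerD; first exact: hA.
  apply: (le_trans ht); rewrite ler_pdivrMr//.
  apply: (@le_trans _ _ (B * L ^+ n)).
    by rewrite ler_pM2l// lerXn2r// nnegrE// ltW.
  by rewrite Ln /c mulrCA divff ?gt_eqF// mulr1 mulrC.
have sQ : (size Q <= n)%N by exact: size_poly.
have hk : `|h k 0| * d ^+ k <= 2 ^+ (7 * k) * (A + A).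
  have -> : `|h k 0| * d ^+ k = k`!%:R * `|Q`_k|.
    rewrite Qk !normrM normfV (ger0_norm (ler0n _ _)) (ger0_norm (exprn_ge0 _ (ltW d0))).
    by rewrite mulrA mulrCA divff ?mulr1// pnatr_eq0 -lt0n fact_gt0.
  rewrite {1}(lagrange_interpolation sQ) coef_sum.
  apply: (@le_trans _ _ (\sum_(i < n) (A + A) * 2 ^+ (6 * k))).
    apply: (@le_trans _ _ (k`!%:R * \sum_(i < n) `|(Q.[i%:R] *: lagrange n i)`_k|)).
      by rewrite ler_wpM2l// ler_norm_sum.
    rewrite mulr_sumr; apply: ler_sum => i _; rewrite coefZ normrM mulrCA.
    by apply: ler_pM; rewrite ?mulr_ge0 ?Qi ?coef_lagrange.
  rewrite sumr_const card_ord -[leLHS]mulr_natr -mulrA mulrC ler_pM2r ?addr_gt0//.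
  rewrite -natrX -natrM -natrX ler_nat (_ : (7 * k = 6 * k + k)%N); last by lia.
  rewrite expnD leq_mul2l /n; apply/orP; right.
  rewrite -(prednK k0) expnS addnn -mul2n leq_mul2l ltn_expl//.
have dn : d ^+ k * d ^+ k = c / n%:R ^+ n by rewrite -exprD exprMn Ln exprVn.
have : (`|h k 0| * d ^+ k) ^+ 2 <= (2 ^+ (7 * k) * (A + A)) ^+ 2.
  by rewrite lerXn2r// nnegrE ?mulr_ge0// ?exprn_ge0// ?addr_ge0// ltW.
rewrite exprMn [in X in X * _ <= _]real_normK ?num_real// [X in _ * X <= _]expr2 dn => hh.
rewrite -(ler_pM2r (_ : 0 < c / n%:R ^+ n)); last by rewrite divr_gt0// exprn_gt0.
apply: (le_trans hh).
have r4 : (4 ^+ n)^-1 <= n`!%:R / n%:R ^+ n :> R.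
  rewrite ler_pdivlMr ?exprn_gt0// mulrC ler_pdivrMr ?exprn_gt0// mulrC.
  by rewrite -!natrX -natrM ler_nat exprnn_le_fact.
have -> : (2 ^+ 20) ^+ k * (A * B) * (c / n%:R ^+ n) =
    (2 ^+ 20) ^+ k * (n`!%:R / n%:R ^+ n) * (A * A).
  by rewrite /c; field; rewrite (gt_eqF B0) (expf_neq0 _ (lt0r_neq0 nR)).
have -> : (2 ^+ (7 * k) * (A + A)) ^+ 2 = (2 ^+ (7 * k)) ^+ 2 * 4 * (A * A) by ring.
rewrite ler_pM2r ?mulr_gt0//.
(* The exponents of 2 add up to 14k + 2 + 4k, which is at most 20k because k > 0. *)
apply: (@le_trans _ _ ((2 ^+ 20) ^+ k / 4 ^+ n)); last first.
  by rewrite ler_wpM2l// !exprn_ge0.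
rewrite ler_pdivlMr ?exprn_gt0// (_ : 4 = 2 ^+ 2 :> R); last by rewrite -natrX.
rewrite -!exprM -!exprD ler_weXn2l ?ler1n// /n; lia.
Qed.

End LagrangeInterpolation.

(** * Fourier inversion on the line *)

Section RealLineIntegrals.
Variable R : realType.
Notation mu := (@lebesgue_measure R).

Definition kappa (x : R) : R := (1 + x ^+ 2)^-1.

Lemma kappa_gt0 x : 0 < kappa x.
Proof. by rewrite invr_gt0 ltr_pwDl// sqr_ge0. Qed.

Lemma kappa_ge0 x : 0 <= kappa x. Proof. exact/ltW/kappa_gt0. Qed.

Lemma kappa_le1 x : kappa x <= 1.
Proof. by rewrite invf_le1 ?lerDl ?sqr_ge0// ltr_pwDl// sqr_ge0. Qed.

Lemma kappaN x : kappa (- x) = kappa x. Proof. by rewrite /kappa sqrrN. Qed.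

Lemma continuous_kappa : continuous kappa.
Proof.
move=> x; apply: (@cvgV _ _ _ _ (fun y : R => 1 + y ^+ 2) (1 + x ^+ 2)).
  by rewrite gt_eqF// ltr_pwDl// sqr_ge0.
by apply: cvgD; [exact: cvg_cst|exact: exprn_continuous].
Qed.

Lemma integral_kappa_half : (\int[mu]_(x in `[0%R, +oo[) (kappa x)%:E = (pi / 2)%:E)%E.
Proof.
rewrite (@ge0_continuous_FTC2y _ _ (@atan R) _ (pi / 2)).
- by rewrite atan0 sube0.
- by move=> x _; exact: kappa_ge0.
- by apply: continuous_subspaceT; exact: continuous_kappa.
- exact: cvgy_atan.
- by move=> x _; exact: derivable_atan.
- exact/cvg_at_right_filter/continuous_atan.
- by move=> x _; rewrite derive1_atan.
Qed.

Lemma integral_kappa : (\int[mu]_x (kappa x)%:E = pi%:E)%E.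
Proof.
rewrite ge0_symfun_integralT; first last.
- by move=> x /=; rewrite kappaN.
- exact: continuous_kappa.
- exact: kappa_ge0.
rewrite -set_itvcy integral_kappa_half -EFinM; congr (_%:E).
by rewrite mulrC divfK.
Qed.

Lemma integrable_kappa : mu.-integrable setT (EFin \o kappa).
Proof.
apply/integrableP; split.
  by apply/measurable_EFinP; apply: continuous_measurable_fun; exact: continuous_kappa.
under eq_integral => x _ do rewrite /= ger0_norm ?kappa_ge0//.
by rewrite integral_kappa ltry.
Qed.

Lemma integrable_of_kappa (f : R -> R) A : measurable_fun setT f ->
  (forall x, `|f x| <= A * kappa x) -> mu.-integrable setT (EFin \o f).
Proof.
move=> mf fA.
have h : mu.-integrable setT (fun x => (A%:E * (kappa x)%:E)%E).
  by apply: integrableZl => //; exact: integrable_kappa.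
apply: (le_integrable _ _ _ h) => //; first exact/measurable_EFinP.
by move=> x _ /=; rewrite lee_fin; apply: (le_trans (fA x)); exact: ler_norm.
Qed.

Lemma Rintegral_kappa_bound (f : R -> R) A : measurable_fun setT f ->
  (forall x, `|f x| <= A * kappa x) -> `|\int[mu]_x f x| <= A * pi.
Proof.
move=> mf fA.
have fi := integrable_of_kappa mf fA.
apply: (le_trans (le_normr_Rintegral _ fi)) => //.
apply: (@le_trans _ _ (\int[mu]_x (A * kappa x))).
  apply: le_Rintegral => //.
  - apply: (@integrable_of_kappa _ A).
      by apply: measurableT_comp.
    by move=> x; rewrite normr_id.
  - have := integrableZl measurableT A integrable_kappa.
    by [].
rewrite RintegralZl//; last exact: integrable_kappa.
by rewrite /Rintegral integral_kappa.
Qed.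

Lemma kappa_shift (x y : R) : kappa (x - y) <= 2 * (1 + x ^+ 2) * kappa y.
Proof.
have p (z : R) : 0 < 1 + z ^+ 2 by rewrite ltr_pwDl// sqr_ge0.
rewrite /kappa ler_pdivlMr// -ler_pdivlMl ?invr_gt0// invrK.
have := sqr_ge0 (x - 2 * (x - y)); have := sqr_ge0 (x * (x - y)).
have := sqr_ge0 (x - y); have := sqr_ge0 x.
nra.
Qed.

Lemma Rintegral_derive0 (f df : R -> R) A :
  (forall t, is_derive t (1 : R^o) (f : R -> R^o) (df t)) -> continuous df ->
  (forall x, `|f x| <= A * kappa x) -> (forall x, `|df x| <= A * kappa x) ->
  \int[mu]_x df x = 0.
Proof.
move=> dfd cdf fA dfA.
have mdf : measurable_fun setT df by exact: continuous_measurable_fun.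
have idf := integrable_of_kappa mdf dfA.
pose I n := `[- n.+1%:R, n.+1%:R]%classic : set R.
have c1 : (\int[mu]_x (df x * \1_(I n) x)%:E)%E @[n --> \oo] --> (\int[mu]_x (df x)%:E)%E.
  apply: (@dominated_cvg _ _ R mu setT measurableT
    (fun n x => (df x * \1_(I n) x)%:E) (fun x => (df x)%:E)
    (fun x => (A * kappa x)%:E)) => //.
  - by move=> n; apply/measurable_EFinP/measurable_funM => //; apply: measurable_indic; exact: measurable_itv.
  - move=> x _; apply: cvg_EFin; first by near=> n.
    apply: cvg_near_cst; near=> n => /=.
    rewrite indicE mem_set ?mulr1// /I /= in_itv/= -ler_norml -natr1.
    apply: (@le_trans _ _ n%:R); last by rewrite lerDl.
    by near: n; exact: nbhs_infty_ger.
  - by have := integrableZl measurableT A integrable_kappa.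
  - move=> n x _; rewrite lee_fin normrM; apply: le_trans (dfA x).
    by rewrite ler_piMr// indicE; case: (_ \in _); rewrite ?normr0 ?normr1.
have e n : (\int[mu]_x (df x * \1_(I n) x)%:E)%E = (f n.+1%:R - f (- n.+1%:R))%:E.
  transitivity (\int[mu]_(x in I n) (df x)%:E)%E.
    rewrite [RHS]integral_mkcond; apply: eq_integral => x _.
    by rewrite patchE indicE; case: (_ \in _); rewrite ?mulr1 ?mulr0.
  rewrite EFinB; apply: continuous_FTC2.
  - by rewrite gtrN.
  - by apply: continuous_subspaceT.
  - split.
    + by move=> x _; case: (dfd x).
    + by apply: cvg_at_right_filter; exact: (is_derive_continuous dfd).
    + by apply: cvg_at_left_filter; exact: (is_derive_continuous dfd).
  - by move=> x _; rewrite derive1E; case: (dfd x).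
have c2 : (f n.+1%:R - f (- n.+1%:R))%:E @[n --> \oo] --> 0%:E.
  apply: cvg_EFin; first by near=> n.
  apply/cvgrPdist_le => eps eps0; near=> n; rewrite sub0r normrN.
  apply: (le_trans (ler_normB _ _)).
  apply: (@le_trans _ _ (A * kappa n.+1%:R + A * kappa n.+1%:R)).
    by apply: lerD; [exact: fA|rewrite -[kappa n.+1%:R]kappaN; exact: fA].
  have A0 : 0 <= A.
    by have := le_trans (normr_ge0 _) (fA 0); rewrite /kappa expr0n/= addr0 invr1 mulr1.
  rewrite -mulrDl /kappa ler_pdivrMr; last by rewrite ltr_pwDl// sqr_ge0.
  have : (A + A) / eps <= n%:R by near: n; exact: nbhs_infty_ger.
  rewrite ler_pdivrMr// mulrC => /le_trans; apply.
  apply: ler_wpM2l; first exact: ltW.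
  rewrite -natrX -[1]/(1%:R) -natrD ler_nat expnS expn1; nia.
have c3 : (f n.+1%:R - f (- n.+1%:R))%:E @[n --> \oo] --> (\int[mu]_x (df x)%:E)%E.
  by rewrite -(_ : (fun n => \int[mu]_x (df x * \1_(I n) x)%:E)%E = (fun n => (f n.+1%:R - f (- n.+1%:R))%:E))//; apply/funext.
by rewrite /Rintegral (cvg_unique _ c3 c2).
Unshelve. all: by end_near. Qed.

Lemma mvt1 (f df : R -> R) t h :
  (forall t, is_derive t (1 : R^o) (f : R -> R^o) (df t)) ->
  exists2 c, `|c| <= `|h| & f (t + h) - f t = h * df (t + c).
Proof.
move=> d; case: (leP 0 h) => h0.
  have [|c /andP[c1 c2] e] := mvt_real (a := t) (b := t + h) d; first by rewrite lerDl.
  exists (c - t); last by rewrite e [t + (c - t)]addrC subrK [t + h]addrC addrK mulrC.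
  by rewrite !ger0_norm ?subr_ge0// lerBlDl.
have [|c /andP[c1 c2] e] := mvt_real (a := t + h) (b := t) d; first by rewrite gerDl ltW.
exists (c - t); last first.
  rewrite -opprB e [t + (c - t)]addrC subrK; ring.
by rewrite !ler0_norm ?subr_le0 ?(ltW h0)// lerN2 lerBrDl.
Qed.

Lemma quad_bound1 (f df ddf : R -> R) t h B :
  (forall t, is_derive t (1 : R^o) (f : R -> R^o) (df t)) ->
  (forall t, is_derive t (1 : R^o) (df : R -> R^o) (ddf t)) ->
  (forall t, `|ddf t| <= B) -> `|f (t + h) - f t - h * df t| <= B * h ^+ 2.
Proof.
move=> d1 d2 b.
have [c ch ->] := mvt1 t h d1; have [c' _ e] := mvt1 t c d2.
rewrite -mulrBr e !normrM -(real_normK (num_real h)) expr2 [leRHS]mulrCA.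
by rewrite ler_wpM2l// mulrC ler_pM.
Qed.

Lemma is_derive_cosM (v xi : R) : is_derive xi (1 : R^o) (fun z => cos (z * v) : R^o) (- v * sin (xi * v)).
Proof.
have h : is_derive xi (1 : R^o) (fun z => z * v : R^o) v.
  have := @is_deriveM R R^o id (cst v) xi 1 1 0 (is_derive_id _ _) (is_derive_cst _ _ _).
  by rewrite scaler0 add0r [_ *: _]mulr1.
have -> : - v * sin (xi * v) = - sin (xi * v) * v by rewrite !mulNr mulrC.
exact: (@is_derive1_comp R cos (fun z => z * v) xi _ _ (is_derive_cos _) h).
Qed.

Lemma is_derive_sinM (v xi : R) : is_derive xi (1 : R^o) (fun z => sin (z * v) : R^o) (v * cos (xi * v)).
Proof.
have h : is_derive xi (1 : R^o) (fun z => z * v : R^o) v.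
  have := @is_deriveM R R^o id (cst v) xi 1 1 0 (is_derive_id _ _) (is_derive_cst _ _ _).
  by rewrite scaler0 add0r [_ *: _]mulr1.
rewrite mulrC.
exact: (@is_derive1_comp R sin (fun z => z * v) xi _ _ (is_derive_sin _) h).
Qed.

(* [fejer2 xi v] is twice the antiderivative in [xi] of [cos (xi * v)], so that
   [fejer2 n v / n] is the Fejer kernel. *)
Definition fejer2 (xi v : R) : R := if v == 0 then xi ^+ 2 / 2 else (1 - cos (xi * v)) / v ^+ 2.
Definition fejer1 (xi v : R) : R := if v == 0 then xi else sin (xi * v) / v.

Lemma is_derive_fejer2 v xi :
  is_derive xi (1 : R^o) (fun z => fejer2 z v : R^o) (fejer1 xi v).
Proof.
rewrite /fejer2 /fejer1; case: eqVneq => [_|v0].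
  have := @is_deriveZ _ _ _ _ (2^-1) _ _ _ (@is_deriveX R R^o id 2 xi 1 1 (is_derive_id _ _)).
  set F := (X in is_derive _ _ X _); rewrite /= (_ : _ *: _ = xi).
    suff -> : F = (fun z => z ^+ 2 / 2) by [].
    by apply/funext => z; rewrite /F !fctE/= mulrC.
  by rewrite /GRing.scale /= mulr1; field.
have := @is_deriveZ _ _ _ _ ((v ^+ 2)^-1) _ _ _ (@is_deriveB _ _ _ _ _ _ _ _ _ (is_derive_cst (1 : R^o) xi (1 : R^o)) (is_derive_cosM v xi)).
set F := (X in is_derive _ _ X _); rewrite /= (_ : _ *: _ = sin (xi * v) / v).
  suff -> : F = (fun z => (1 - cos (z * v)) / v ^+ 2) by [].
  by apply/funext => z; rewrite /F/= [RHS]mulrC.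
by rewrite /GRing.scale /=; field.
Qed.

Lemma is_derive_fejer1 v xi :
  is_derive xi (1 : R^o) (fun z => fejer1 z v : R^o) (cos (xi * v)).
Proof.
rewrite /fejer1; case: eqVneq => [->|v0].
  by rewrite mulr0 cos0; exact: is_derive_id.
have := @is_deriveZ _ _ _ _ v^-1 _ _ _ (is_derive_sinM v xi).
set F := (X in is_derive _ _ X _); rewrite /= (_ : _ *: _ = cos (xi * v)).
  suff -> : F = (fun z => sin (z * v) / v) by [].
  by apply/funext => z; rewrite /F/= [RHS]mulrC.
by rewrite /GRing.scale /= mulKf.
Qed.

Lemma norm_cos (a : R) : `|cos a| <= 1.
Proof. by rewrite ler_norml cos_geN1 cos_le1. Qed.

Lemma norm_sin (a : R) : `|sin a| <= 1.
Proof. by rewrite ler_norml sin_geN1 sin_le1. Qed.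

Lemma fejer2_0 v : fejer2 0 v = 0.
Proof. by rewrite /fejer2 expr0n mul0r mul0r cos0 subrr mul0r; case: ifP. Qed.

Lemma fejer1_0 v : fejer1 0 v = 0.
Proof. by rewrite /fejer1 mul0r sin0 mul0r; case: ifP. Qed.

Lemma fejer2_ge0 xi v : 0 <= fejer2 xi v.
Proof.
rewrite /fejer2; case: ifP => _; first by rewrite divr_ge0// sqr_ge0.
by rewrite divr_ge0 ?sqr_ge0// subr_ge0 cos_le1.
Qed.

Lemma fejer2_le_sqr xi v : fejer2 xi v <= xi ^+ 2.
Proof.
have := @quad_bound1 _ _ _ 0 xi 1 (is_derive_fejer2 v) (is_derive_fejer1 v) (fun t => norm_cos _).
rewrite add0r fejer2_0 fejer1_0 mulr0 !subr0 mul1r ger0_norm//.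
exact: fejer2_ge0.
Qed.

Lemma fejer2_sqr_le xi v : fejer2 xi v * v ^+ 2 <= 2.
Proof.
rewrite /fejer2; case: eqVneq => [->|v0]; first by rewrite expr0n mulr0.
rewrite divfK ?sqrf_eq0//; have := cos_geN1 (xi * v); lra.
Qed.

Lemma fejer1_le xi v : `|fejer1 xi v| <= `|xi|.
Proof.
have [c _] := mvt1 0 xi (is_derive_fejer1 v).
rewrite add0r fejer1_0 subr0 => ->; rewrite normrM -[leRHS]mulr1.
by rewrite ler_wpM2l// norm_cos.
Qed.

Lemma cos_sqr_bound (b : R) : 1 - b ^+ 2 <= cos b.
Proof.
have d2 t : is_derive t (1 : R^o) (fun t => - sin t : R^o) (- cos t).
  exact: is_deriveN.
have := @quad_bound1 _ _ _ 0 b 1 (@is_derive_cos R) d2.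
rewrite add0r cos0 sin0 oppr0 mulr0 subr0 mul1r => /(_ _) h.
have {}h : `|cos b - 1| <= b ^+ 2 by apply: h => t; rewrite normrN norm_cos.
by move: h; rewrite ler_norml => /andP[]; lra.
Qed.

Lemma cos_sqr_bound2 (b : R) : 0 <= b <= 2^-1 -> b ^+ 2 / 4 <= 1 - cos b.
Proof.
move=> /andP[b0 b1].
pose g t : R := - cos t - t ^+ 2 / 4; pose dg t : R := sin t - t / 2.
have gd t : is_derive t (1 : R^o) (g : R -> R^o) (dg t).
  have := @is_deriveB _ _ _ _ _ _ _ _ _ (is_deriveN (is_derive_cos t))
    (@is_deriveZ _ _ _ _ (4^-1) _ _ _ (@is_deriveX R R^o id 2 t 1 1 (is_derive_id _ _))).
  set F := (X in is_derive _ _ X _); rewrite /= (_ : _ - _ = dg t).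
    suff -> : F = g by [].
    by apply/funext => z; rewrite /F /g !fctE/= mulrC.
  by rewrite /dg opprK /GRing.scale /= mulr1; field.
have [c /andP[c0 cb] e] := mvt_real gd b0.
have [c' /andP[c'0 c'c] e'] := mvt_real (@is_derive_sin R) c0.
have : 0 <= dg c.
  move: e'; rewrite /dg sin0 !subr0 => ->.
  have : 2^-1 <= cos c' by have := cos_sqr_bound c'; nra.
  by nra.
move: e; rewrite /g cos0 expr0n mul0r !subr0 => e h.
have : 0 <= dg c * b by rewrite mulr_ge0.
by rewrite -e; lra.
Qed.

(** This lower bound at distance 1 / (2n) already gives the kernel a mass of at least n / 4, so its
    integral need not be computed. *)
Lemma fejer2_lower n v : 0 < n -> `|v| <= (2 * n)^-1 -> n ^+ 2 / 4 <= fejer2 n v.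
Proof.
move=> n0 vn; rewrite /fejer2; case: eqVneq => [_|v0].
  by rewrite ler_pM2l ?exprn_gt0// lef_pV2 ?posrE; lra.
rewrite ler_pdivlMr ?exprn_even_gt0//=.
have -> : n ^+ 2 / 4 * v ^+ 2 = `|n * v| ^+ 2 / 4.
  by rewrite real_normK ?num_real// exprMn mulrAC.
have -> : cos (n * v) = cos `|n * v|.
  by case: (leP 0 (n * v)) => a0; rewrite ?(ger0_norm a0) ?(ltr0_norm a0) ?cosN.
apply: cos_sqr_bound2; rewrite normr_ge0/= normrM (gtr0_norm n0).
apply: (@le_trans _ _ (n * (2 * n)^-1)); first by rewrite ler_pM2l.
by rewrite invfM mulrCA divff ?mulr1// gt_eqF.
Qed.

(** The continuous functions y / (y^2 + 1 / (k + 1)) converge pointwise to the inverse, also at 0,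
    where they vanish in accordance with the convention that the inverse of 0 is 0. *)
Lemma measurable_invr : measurable_fun [set: R] (fun y : R => y^-1).
Proof.
pose F (k : nat) (y : R) := y / (y ^+ 2 + k.+1%:R^-1).
apply: (@measurable_fun_cvg _ _ _ _ F) => [k|y _].
  apply: continuous_measurable_fun => y; apply: cvgM; first exact: cvg_id.
  apply: cvgV; last by apply: cvgD; [exact: exprn_continuous|exact: cvg_cst].
  by rewrite gt_eqF// ltr_wpDl ?sqr_ge0// invr_gt0.
have [->|y0] := eqVneq y 0.
  by rewrite invr0 /F; under eq_fun do rewrite mul0r; exact: cvg_cst.
have -> : y^-1 = y / (y ^+ 2 + 0) by rewrite addr0 expr2 invfM mulrA divff// mul1r.
apply: cvgM; first exact: cvg_cst.
apply: cvgV; first by rewrite addr0 sqrf_eq0.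
by apply: cvgD; [exact: cvg_cst|exact: cvg_harmonic].
Qed.

Lemma measurable_fejer2 x xi : measurable_fun [set: R] (fun y => fejer2 xi (x - y)).
Proof.
have m : measurable_fun [set: R] (fun y => x - y).
  by apply: continuous_measurable_fun => y; apply: cvgB; [exact: cvg_cst|exact: cvg_id].
have m2 : measurable_fun [set: R] (fun y => ((x - y) ^+ 2)^-1).
  apply: (measurableT_comp measurable_invr).
  by apply: measurable_funX.
apply: measurable_fun_ifT; first by apply: measurable_fun_eqr.
  exact: measurable_cst.
apply: measurable_funM => //; apply: measurable_funB; first exact: measurable_cst.
apply: continuous_measurable_fun => y.
apply: (@continuous_comp _ _ _ (fun y => xi * (x - y)) cos); last exact: continuous_cos.
by apply: cvgM; [exact: cvg_cst|apply: cvgB; [exact: cvg_cst|exact: cvg_id]].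
Qed.

Lemma measurable_fejer1 x xi : measurable_fun [set: R] (fun y => fejer1 xi (x - y)).
Proof.
have m : measurable_fun [set: R] (fun y => x - y).
  by apply: continuous_measurable_fun => y; apply: cvgB; [exact: cvg_cst|exact: cvg_id].
apply: measurable_fun_ifT; first by apply: measurable_fun_eqr.
  exact: measurable_cst.
apply: measurable_funM; last exact: (measurableT_comp measurable_invr).
apply: continuous_measurable_fun => y.
apply: (@continuous_comp _ _ _ (fun y => xi * (x - y)) sin); last exact: continuous_sin.
by apply: cvgM; [exact: cvg_cst|apply: cvgB; [exact: cvg_cst|exact: cvg_id]].
Qed.

Lemma kappa_shift_dist (x y : R) : `|x - y| * kappa y <= 2 * (1 + x ^+ 2).
Proof.
have h := kappa_shift y (y - x).
have p (z : R) : 0 < 1 + z ^+ 2 by rewrite ltr_pwDl// sqr_ge0.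
rewrite /kappa ler_pdivrMr//.
have := real_normK (num_real (x - y)).
have := sqr_ge0 (`|x - y| - 1); have := sqr_ge0 (x - y - 2 * x); have := sqr_ge0 (x * y).
have := sqr_ge0 (x + y).
nra.
Qed.

(** * A sup bound from the cosine transforms, by Fejer summation *)

Section Inversion.
Variables (h : R -> R) (A D x : R).
Hypotheses (ch : continuous h) (hA : forall y, `|h y| <= A * kappa y ^+ 2)
  (hD : forall th xi, `|\int[mu]_y (h y * cos (y * xi + th))| <= D * kappa xi).

Let A0 : 0 <= A.
Proof. by have := le_trans (normr_ge0 _) (hA 0); rewrite /kappa expr0n/= addr0 invr1 expr1n mulr1. Qed.

Let mh : measurable_fun [set: R] h. Proof. exact: continuous_measurable_fun. Qed.

Let hAk y : `|h y| <= A * kappa y.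
Proof.
apply: (le_trans (hA y)); rewrite ler_wpM2l// expr2 ler_piMr ?kappa_ge0//.
exact: kappa_le1.
Qed.

Let integrable_hM (g : R -> R) B : measurable_fun [set: R] g ->
  (forall y, `|g y| * kappa y <= B) -> mu.-integrable setT (EFin \o (fun y => h y * g y)).
Proof.
move=> mg gB; apply: (@integrable_of_kappa _ (A * B)).
  exact: measurable_funM.
move=> y; rewrite normrM; apply: (@le_trans _ _ (A * kappa y ^+ 2 * `|g y|)).
  by rewrite ler_wpM2r.
have -> : A * kappa y ^+ 2 * `|g y| = A * kappa y * (`|g y| * kappa y) by ring.
have -> : A * B * kappa y = A * kappa y * B by ring.
by rewrite ler_wpM2l ?mulr_ge0 ?kappa_ge0.
Qed.

Let bounded_kappa (g : R -> R) B : (forall y, `|g y| <= B) ->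
  forall y, `|g y| * kappa y <= B.
Proof.
move=> gB y; apply: le_trans (gB y).
by rewrite ler_piMr// kappa_le1.
Qed.

(** Integrals over frequencies are never interchanged with integrals over [y]: [Phi1] and [Phi] are
    the first and second primitives of [Phi2] in [xi] vanishing at 0, which is checked by
    differentiating under the integral. *)
Let Phi2 xi := \int[mu]_y (h y * cos (xi * (x - y))).
Let Phi1 xi := \int[mu]_y (h y * fejer1 xi (x - y)).
Let Phi xi := \int[mu]_y (h y * fejer2 xi (x - y)).

Let Phi2_le xi : `|Phi2 xi| <= D * kappa xi.
Proof.
have -> : Phi2 xi = \int[mu]_y (h y * cos (y * xi + (- (x * xi)))).
  apply: eq_Rintegral => y _; congr (_ * _).
  by rewrite -cosN; congr cos; ring.
exact: hD.
Qed.

Let i2 xi : mu.-integrable setT (EFin \o (fun y => h y * cos (xi * (x - y)))).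
Proof.
apply: (@integrable_hM _ 1); last by apply: bounded_kappa => y; exact: norm_cos.
apply: continuous_measurable_fun => y.
apply: (@continuous_comp _ _ _ (fun y => xi * (x - y)) cos); last exact: continuous_cos.
by apply: cvgM; [exact: cvg_cst|apply: cvgB; [exact: cvg_cst|exact: cvg_id]].
Qed.

Let i1 xi : mu.-integrable setT (EFin \o (fun y => h y * fejer1 xi (x - y))).
Proof.
apply: (@integrable_hM _ `|xi|); first exact: measurable_fejer1.
by apply: bounded_kappa => y; exact: fejer1_le.
Qed.

Let i0 xi : mu.-integrable setT (EFin \o (fun y => h y * fejer2 xi (x - y))).
Proof.
apply: (@integrable_hM _ (xi ^+ 2)); first exact: measurable_fejer2.
by apply: bounded_kappa => y; rewrite ger0_norm ?fejer2_ge0//; exact: fejer2_le_sqr.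
Qed.

(** One factor [kappa y] in the bound on [h] is spent on the remainder, and the other keeps the
    product integrable. *)
Let parametric (g dg : R -> R -> R) xi C :
  (forall xi, mu.-integrable setT (EFin \o (fun y => h y * g xi y))) ->
  mu.-integrable setT (EFin \o (fun y => h y * dg xi y)) ->
  (forall s y, `|g (xi + s) y - g xi y - s * dg xi y| * kappa y <= C * s ^+ 2) ->
  is_derive xi (1 : R^o) (fun z => \int[mu]_y (h y * g z y) : R^o) (\int[mu]_y (h y * dg xi y)).
Proof.
move=> ig idg gC; apply: (@is_derive_quad R R^o _ _ _ _ (A * C * pi)) => s _.
rewrite [s *: _]mulr1.
have -> : \int[mu]_y (h y * g (xi + s) y) - \int[mu]_y (h y * g xi y) -
    s * \int[mu]_y (h y * dg xi y) =
    \int[mu]_y (h y * (g (xi + s) y - g xi y - s * dg xi y)).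
  rewrite -RintegralZl// -!RintegralB//; last 2 first.
  - have := integrableB measurableT (ig (xi + s)) (ig xi).
    by [].
  - have := integrableZl measurableT s idg.
    by [].
  by apply: eq_Rintegral => y _; ring.
rewrite -mulrA [pi * _]mulrC mulrA.
have -> : A * C * s ^+ 2 * pi = (A * (C * s ^+ 2)) * pi by ring.
apply: Rintegral_kappa_bound.
  have : mu.-integrable setT (EFin \o (fun y => h y * (g (xi + s) y - g xi y - s * dg xi y))).
    have := integrableB measurableT (integrableB measurableT (ig (xi + s)) (ig xi)) (integrableZl measurableT s idg).
    apply: eq_integrable => // y _ /=; congr (_%:E); ring.
  by move=> /measurable_int /measurable_EFinP.
move=> y; rewrite normrM; apply: (@le_trans _ _ (A * kappa y ^+ 2 * `|g (xi + s) y - g xi y - s * dg xi y|)).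
  by rewrite ler_wpM2r.
set X := `|_|.
have -> : A * kappa y ^+ 2 * X = A * kappa y * (X * kappa y) by ring.
have -> : A * (C * s ^+ 2) * kappa y = A * kappa y * (C * s ^+ 2) by ring.
by rewrite ler_wpM2l ?mulr_ge0 ?kappa_ge0// gC.
Qed.

Let dPhi1 xi : is_derive xi (1 : R^o) (Phi1 : R -> R^o) (Phi2 xi).
Proof.
apply: (@parametric (fun z y => fejer1 z (x - y)) (fun z y => cos (z * (x - y))) xi (2 * (1 + x ^+ 2))) => // s y.
have dd t : is_derive t (1 : R^o) (fun z => cos (z * (x - y)) : R^o) (- (x - y) * sin (t * (x - y))).
  exact: is_derive_cosM.
have := @quad_bound1 _ _ _ xi s `|x - y| (is_derive_fejer1 (x - y)) dd (fun t => _).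
move=> q; apply: (@le_trans _ _ (`|x - y| * s ^+ 2 * kappa y)).
  rewrite ler_wpM2r ?kappa_ge0//; apply: q => t.
  by rewrite normrM normrN ler_piMr// norm_sin.
by rewrite mulrAC ler_wpM2r ?sqr_ge0// kappa_shift_dist.
Qed.

Let dPhi xi : is_derive xi (1 : R^o) (Phi : R -> R^o) (Phi1 xi).
Proof.
apply: (@parametric (fun z y => fejer2 z (x - y)) (fun z y => fejer1 z (x - y)) xi 1) => // s y.
have q := @quad_bound1 _ _ _ xi s 1 (is_derive_fejer2 (x - y)) (is_derive_fejer1 (x - y)) (fun t => norm_cos _).
apply: le_trans q; rewrite ler_piMr//; exact: kappa_le1.
Qed.

Let D0 : 0 <= D.
Proof. by have := le_trans (normr_ge0 _) (hD 0 0); rewrite /kappa expr0n/= addr0 invr1 mulr1. Qed.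

(** Comparison with [D * atan], the primitive of the bound on [Phi2]; the limit pi / 2 is rounded up
    to 2. *)
Let Phi1_le xi : 0 <= xi -> `|Phi1 xi| <= D * 2.
Proof.
move=> xi0.
have Phi10 : Phi1 0 = 0.
  rewrite /Phi1; under eq_Rintegral do rewrite fejer1_0 mulr0.
  by rewrite /Rintegral integral0.
have key (sg : R) : `|sg| = 1 -> sg * Phi1 xi <= D * atan xi.
  move=> sg1.
  have gd t : is_derive t (1 : R^o) (fun z => D * atan z - sg * Phi1 z : R^o)
      (D * kappa t - sg * Phi2 t).
    have := @is_deriveB _ _ _ _ _ _ _ _ _ (@is_deriveZ _ _ _ _ D _ _ _ (is_derive1_atan t))
      (@is_deriveZ _ _ _ _ sg _ _ _ (dPhi1 t)).
    by [].
  have [c /andP[c0 _] e] := mvt_real gd xi0.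
  have : 0 <= (D * kappa c - sg * Phi2 c) * (xi - 0).
    apply: mulr_ge0; rewrite ?subr0// subr_ge0.
    by apply: le_trans (Phi2_le c); rewrite -[leRHS]mul1r -sg1 -normrM ler_norm.
  by rewrite -e atan0 Phi10 !mulr0 !subr0; lra.
apply: (@le_trans _ _ (D * atan xi)).
  rewrite ler_norml; apply/andP; split.
    by have := key (-1); rewrite normrN1 => /(_ erefl); lra.
  by have := key 1; rewrite normr1 => /(_ erefl); lra.
rewrite ler_wpM2l// ltW// (lt_trans (atan_ltpi2 xi))//.
exact: pihalf_lt2.
Qed.

Let Phi_le n : 0 <= n -> `|Phi n| <= D * 2 * n.
Proof.
move=> n0.
have Phi0 : Phi 0 = 0.
  rewrite /Phi; under eq_Rintegral do rewrite fejer2_0 mulr0.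
  by rewrite /Rintegral integral0.
have [c /andP[c0 _] e] := mvt_real dPhi n0.
move: e; rewrite Phi0 !subr0 => ->; rewrite normrM (ger0_norm n0).
by rewrite ler_wpM2r// Phi1_le.
Qed.

Let fejer2_le_kappa n y :
  `|fejer2 n (x - y)| <= (n ^+ 2 + 2) * (2 * (1 + x ^+ 2)) * kappa y.
Proof.
rewrite ger0_norm ?fejer2_ge0//.
apply: (@le_trans _ _ ((n ^+ 2 + 2) * kappa (x - y))).
  have p : 0 < 1 + (x - y) ^+ 2 by rewrite ltr_pwDl// sqr_ge0.
  rewrite /kappa ler_pdivlMr// mulrDr mulr1 lerD ?fejer2_le_sqr//.
  exact: fejer2_sqr_le.
by rewrite -mulrA ler_wpM2l ?kappa_shift// addr_ge0// sqr_ge0.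
Qed.

Let ifejer n : mu.-integrable setT (EFin \o (fun y => fejer2 n (x - y))).
Proof. exact: integrable_of_kappa (measurable_fejer2 x n) (fejer2_le_kappa n). Qed.

Let mass n := \int[mu]_y fejer2 n (x - y).

Let mass_lower n : 0 < n -> n / 4 <= mass n.
Proof.
move=> n0; rewrite -lee_fin /mass /Rintegral fineK; last exact: (integrable_fin_num measurableT (ifejer n)).
pose I := `[x - (2 * n)^-1, x + (2 * n)^-1]%classic : set R.
have n20 : 0 < (2 * n)^-1 by rewrite invr_gt0 mulr_gt0.
apply: (@le_trans _ _ (\int[mu]_(y in I) (n ^+ 2 / 4)%:E)%E).
  rewrite integral_cst//=; last exact: measurable_itv.
  rewrite /I lebesgue_measure_itv/= lte_fin ifT; last lra.
  rewrite -EFinB -EFinM lee_fin.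
  have -> : x + (2 * n)^-1 - (x - (2 * n)^-1) = n^-1 by field; rewrite gt_eqF.
  by have -> : n ^+ 2 / 4 / n = n / 4 by field; rewrite gt_eqF.
apply: (@le_trans _ _ (\int[mu]_(y in I) (fejer2 n (x - y))%:E)%E).
  apply: ge0_le_integral => //=.
  - exact: measurable_itv.
  - by move=> y _; rewrite lee_fin divr_ge0// sqr_ge0.
  - by apply/measurable_EFinP; apply: measurable_funTS; exact: measurable_fejer2.
  - move=> y; rewrite /I/= in_itv/= => /andP[y1 y2]; rewrite lee_fin.
    by apply: fejer2_lower => //; rewrite ler_norml; apply/andP; split; lra.
apply: ge0_subset_integral => //=.
- exact: measurable_itv.
- by apply/measurable_EFinP; exact: measurable_fejer2.
- by move=> y _; rewrite lee_fin fejer2_ge0.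
Qed.

(** Near [x] continuity gives [eps]. Away from [x] the boundedness of [h] is rewritten with a factor
    (x - y)^2, which [fejer2_sqr_le] cancels against the kernel: that part of the error stays
    bounded as the kernel concentrates. *)
Let oscillation eps : 0 < eps -> exists2 M, 0 <= M &
  forall y, `|h x - h y| <= eps + M * ((x - y) ^+ 2 * kappa (x - y)).
Proof.
move=> e0; have : h @ x --> h x by exact: ch.
move=> /cvgrPdist_le /(_ _ e0).
rewrite near_simpl => /nbhs_normP[d /= d0 hd].
exists (2 * A * (1 + d ^+ 2) / d ^+ 2).
  by rewrite divr_ge0 ?sqr_ge0// !mulr_ge0// addr_ge0// sqr_ge0.
move=> y; have v0 : 0 <= (x - y) ^+ 2 * kappa (x - y) by rewrite mulr_ge0 ?sqr_ge0 ?kappa_ge0.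
have M0 : 0 <= 2 * A * (1 + d ^+ 2) / d ^+ 2.
  by rewrite divr_ge0 ?sqr_ge0// !mulr_ge0// addr_ge0// sqr_ge0.
have [lt|ge] := ltP `|x - y| d.
  by apply: (le_trans (hd y lt)); rewrite lerDl mulr_ge0.
have bA z : `|h z| <= A.
  by apply: (le_trans (hAk z)); rewrite ler_piMr// kappa_le1.
apply: (@le_trans _ _ (2 * A)).
  by apply: (le_trans (ler_normB _ _)); have := bA x; have := bA y; lra.
apply: (@le_trans _ _ (2 * A * (1 + d ^+ 2) / d ^+ 2 * ((x - y) ^+ 2 * kappa (x - y)))); last first.
  by rewrite lerDr ltW.
have dv : d ^+ 2 <= (x - y) ^+ 2.
  by rewrite -[leRHS]real_normK ?num_real// lerXn2r// nnegrE ltW.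
have p : 0 < 1 + (x - y) ^+ 2 by rewrite ltr_pwDl// sqr_ge0.
move: dv p (exprn_gt0 2 d0); rewrite /kappa; set a := d ^+ 2; set b := (x - y) ^+ 2.
move=> ab p a0.
have -> : 2 * A * (1 + a) / a * (b / (1 + b)) = 2 * A * ((1 + a) * b / (a * (1 + b))).
  by field; rewrite (gt_eqF a0) (gt_eqF p).
rewrite ler_peMr ?mulr_ge0// ler_pdivlMr ?mulr_gt0// mul1r; nra.
Qed.

(** Up to errors negligible for large [n], [h x] is the quotient of [Phi n], at most 2 D n, by the
    mass of the kernel, at least n / 4; hence the constant 8. *)
Lemma fourier_inversion_bound1 : `|h x| <= D * 8.
Proof.
apply/ler_addgt0Pl => eps e0; have [M M0 hM] := oscillation e0.
pose C := 2 * M * (2 * (1 + x ^+ 2)) * pi.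
have pi0 : 0 <= pi :> R by exact: pi_ge0.
have C0 : 0 <= C by rewrite /C !mulr_ge0// addr_ge0// sqr_ge0.
have key n : 0 < n -> `|h x| * mass n <= D * 2 * n + (eps * mass n + C).
  move=> n0.
  have m0 : 0 <= mass n by apply: le_trans (mass_lower n0); rewrite divr_ge0// ltW.
  have idiff : mu.-integrable setT (EFin \o (fun y => (h x - h y) * fejer2 n (x - y))).
    have := integrableB measurableT (integrableZl measurableT (h x) (ifejer n)) (i0 n).
    apply: eq_integrable => // y _ /=; congr (_%:E); ring.
  have e : h x * mass n = Phi n + \int[mu]_y ((h x - h y) * fejer2 n (x - y)).
    rewrite -RintegralZl// -RintegralD//.
    by apply: eq_Rintegral => y _; ring.
  rewrite -[X in _ * X](ger0_norm m0) -normrM e.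
  apply: (le_trans (ler_normD _ _)); apply: lerD; first by apply: Phi_le; exact: ltW.
  have ik : mu.-integrable setT (EFin \o (fun y => 2 * M * (2 * (1 + x ^+ 2)) * kappa y)).
    by have := integrableZl measurableT (2 * M * (2 * (1 + x ^+ 2))) integrable_kappa.
  have ief : mu.-integrable setT (EFin \o (fun y => eps * fejer2 n (x - y))).
    by have := integrableZl measurableT eps (ifejer n).
  apply: (le_trans (le_normr_Rintegral _ idiff)) => //.
  apply: (@le_trans _ _ (\int[mu]_y (eps * fejer2 n (x - y) + 2 * M * (2 * (1 + x ^+ 2)) * kappa y))).
    apply: le_Rintegral => //.
    - by have := integrable_norm idiff.
    - by have := integrableD measurableT ief ik.
    - move=> y _; rewrite normrM (ger0_norm (fejer2_ge0 _ _)).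
      apply: (le_trans (ler_wpM2r (fejer2_ge0 _ _) (hM y))).
      rewrite mulrDl lerD2l.
      have -> : M * ((x - y) ^+ 2 * kappa (x - y)) * fejer2 n (x - y) =
        M * kappa (x - y) * (fejer2 n (x - y) * (x - y) ^+ 2) by ring.
      apply: (@le_trans _ _ (M * kappa (x - y) * 2)).
        by rewrite ler_wpM2l ?mulr_ge0 ?kappa_ge0// fejer2_sqr_le.
      have -> : 2 * M * (2 * (1 + x ^+ 2)) * kappa y = M * (2 * (1 + x ^+ 2) * kappa y) * 2 by ring.
      by rewrite ler_wpM2r// ler_wpM2l// kappa_shift.
  rewrite RintegralD// !RintegralZl//; last exact: integrable_kappa.
  by rewrite lerD2l /C [X in _ * X]/Rintegral integral_kappa.
rewrite leNgt; apply/negP => lt.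
set eta := `|h x| - eps - D * 8.
have eta0 : 0 < eta by rewrite /eta; lra.
(* Large enough for [eta * n / 4] to exceed the error [C]. *)
pose n := 4 * C / eta + 1.
have n0 : 0 < n by rewrite /n ltr_wpDl// divr_ge0 ?(ltW eta0)// mulr_ge0.
have k := key n n0; have ml := mass_lower n0.
have nC : eta * n = 4 * C + eta by rewrite /n mulrDr mulrCA divff ?gt_eqF// !mulr1.
have : (D * 8 + eta) * mass n <= D * 2 * n + C by rewrite /eta; lra.
have : (D * 8 + eta) * (n / 4) <= (D * 8 + eta) * mass n.
  by rewrite ler_wpM2l// addr_ge0 ?mulr_ge0// ltW.
lra.
Qed.

End Inversion.
End RealLineIntegrals.

(** * Iterated integrals *)

Section LebesgueIntegration.
Variable R : realType.
Notation RR := (measurableTypeR R).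
Notation mu := (@lebesgue_measure R).

Definition box n (k : R) : set (n.-tuple RR) := [set t | forall i, `|tnth t i| <= k].

Arguments box : clear implicits.

Lemma measurable_box n k : measurable (box n k).
Proof.
have -> : box n k = \bigcap_(i in [set: 'I_n]) ((@tnth n RR) ^~ i @^-1` `[- k, k]%classic).
  apply/seteqP; split => t /= h i; first by move=> _ /=; rewrite in_itv/= -ler_norml.
  by have := h i I; rewrite /= in_itv/= -ler_norml.
apply: fin_bigcap_measurable => // i _; rewrite -[X in measurable X]setTI.
exact: measurable_tnth.
Qed.

Lemma preimage_box n k : (@prepend R n) @^-1` box n.+1 k = box n k `*` `[- k, k]%classic.
Proof.
apply/seteqP; split => -[t x] /=.
  move=> h; split=> [i|]; first by have := h (lift ord0 i); rewrite /prepend/= (tnth_nth 0)/= (tnth_nth 0).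
  by have := h ord0; rewrite /prepend/= (tnth_nth 0)/= in_itv/= -ler_norml.
move=> [h]; rewrite in_itv/= -ler_norml => hx i.
case: (unliftP ord0 i) => [j|] ->; rewrite (tnth_nth 0)//=.
by have := h j; rewrite (tnth_nth 0).
Qed.

Lemma lebesgueN_box n k : (lebesgueN R n (box n k) < +oo)%E.
Proof.
elim: n => [|n IH]; first by rewrite /= diracE ltry.
rewrite [X in (X < _)%E](_ : _ = (lebesgueN R n \x mu)%E (@prepend R n @^-1` box n.+1 k)); last by [].
rewrite preimage_box product_measure1E//=; last by apply: measurable_box.
rewrite lte_mul_pinfty//.
  by rewrite ge0_fin_numE.
by rewrite lebesgue_measure_itv/=; case: ifP; rewrite ?ltry.
Qed.

Lemma lebesgueN_sigma_finite n : sigma_finite setT (lebesgueN R n).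
Proof.
exists (fun k : nat => box n k%:R); last first.
  by move=> k; split; [exact: measurable_box|exact: lebesgueN_box].
apply/seteqP; split => // t _.
pose M := \sum_(i < n) `|tnth t i|.
exists (Num.bound M) => //= i; apply: (@le_trans _ _ M).
  by rewrite /M (bigD1 i)//= lerDl sumr_ge0.
by apply/ltW/archi_boundP; rewrite sumr_ge0.
Qed.

(** A named copy of [lebesgueN R n], to which the sigma-finiteness required by Fubini's theorem is
    attached. *)
Definition lebN n : set (n.-tuple RR) -> \bar R := lebesgueN R n.

HB.instance Definition _ n := Measure.copy (@lebN n) (lebesgueN R n).
HB.instance Definition _ n := Measure_isSigmaFinite.Build _ _ _ (@lebN n) (@lebesgueN_sigma_finite n).

Definition consv n (x0 : R) (x : 'rV[R]_n) : 'rV[R]_n.+1 :=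
  \row_i (if unlift ord0 i is Some j then x 0 j else x0).

Lemma consv0 n x0 (x : 'rV[R]_n) : consv x0 x 0 ord0 = x0.
Proof. by rewrite mxE unlift_none. Qed.

Lemma consv_lift n x0 (x : 'rV[R]_n) j : consv x0 x 0 (lift ord0 j) = x 0 j.
Proof. by rewrite mxE liftK. Qed.

Lemma consv_ext n (x y : 'rV[R]_n.+1) : x 0 ord0 = y 0 ord0 ->
  (forall j, x 0 (lift ord0 j) = y 0 (lift ord0 j)) -> x = y.
Proof.
move=> h0 hj; apply/rowP => i.
by case: (unliftP ord0 i) => [j|] ->.
Qed.

Lemma consvK n (x : 'rV[R]_n.+1) : consv (x 0 ord0) (\row_j x 0 (lift ord0 j)) = x.
Proof. by apply: consv_ext => [|j]; rewrite ?consv0// consv_lift mxE. Qed.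

Lemma row_of_prepend n (t : n.-tuple RR) (x0 : RR) :
  row_of_tuple (prepend (t, x0)) = consv x0 (row_of_tuple t).
Proof.
apply: consv_ext => [|j]; rewrite ?consv0 ?consv_lift !mxE /prepend/=.
  by rewrite (tnth_nth 0).
by rewrite !(tnth_nth 0)/= .
Qed.

Lemma continuous_row (T : topologicalType) n (f : T -> 'rV[R]_n) :
  (forall i, continuous (fun x => f x 0 i)) -> continuous f.
Proof.
move=> h x P [Q hQ QP].
have : \forall y \near x, forall i j, Q i j (f y i j).
  apply: filter_forall => i; apply: filter_forall => j.
  by rewrite !ord1 in hQ *; have := h j x; apply; rewrite -(ord1 i); exact: hQ.
by apply: filterS => y hy; exact: QP.
Qed.

Lemma continuous_coord n i : continuous (fun x : 'rV[R]_n => x 0 i).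
Proof. exact: coord_continuous. Qed.

Lemma continuous_consvr n x0 : continuous (@consv n x0).
Proof.
apply: continuous_row => i; case: (unliftP ord0 i) => [j|] ->.
  under eq_fun do rewrite consv_lift; exact: continuous_coord.
under eq_fun do rewrite consv0; exact: cst_continuous.
Qed.

Lemma continuous_consvl n (x : 'rV[R]_n) : continuous (fun x0 => consv x0 x).
Proof.
apply: continuous_row => i; case: (unliftP ord0 i) => [j|] ->.
  under eq_fun do rewrite consv_lift; exact: cst_continuous.
under eq_fun do rewrite consv0; move=> y; exact: cvg_id.
Qed.

(** Tuples carry a product sigma-algebra and rows a topology, so continuity does not give
    measurability directly. Rounding the coordinates down to multiples of 1 / (k + 1) takes
    countably many values, each on a product of half-open intervals, and converges pointwise. *)
Lemma measurable_row_of_tuple n (g : 'rV[R]_n -> R) : continuous g ->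
  measurable_fun setT (g \o @row_of_tuple R n).
Proof.
move=> cg.
pose G (k : nat) (z : 'I_n -> int) : 'rV[R]_n := \row_i ((z i)%:~R / k.+1%:R).
pose Z (k : nat) (t : n.-tuple RR) : {ffun 'I_n -> int} := [ffun i => Num.floor (tnth t i * k.+1%:R)].
apply: (@measurable_fun_cvg _ _ _ _ (fun k t => g (G k (Z k t)))) => [k|t _].
  move=> _ Y mY; rewrite setTI.
  have -> : (fun t => g (G k (Z k t))) @^-1` Y =
      \bigcup_(z in [set z : {ffun 'I_n -> int} | Y (g (G k z))]) [set t | Z k t = z].
    by apply/seteqP; split => [t /= ht|t [z /= hz zt]]; [exists (Z k t)|rewrite /= zt].
  rewrite bigcup_mkcond; apply: countable_bigcupT_measurable => [|z].
    exact: countableP.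
  case: ifP => _; last exact: measurable0.
  have -> : [set t | Z k t = z] = \bigcap_(i in [set: 'I_n])
      ((@tnth n RR) ^~ i @^-1` `[(z i)%:~R / k.+1%:R, (z i + 1)%:~R / k.+1%:R[%classic).
    apply/seteqP; split => [t /= <- i _|t h] /=.
      rewrite /Z ffunE in_itv/= ler_pdivrMr// ltr_pdivlMr//.
      by rewrite Num.Theory.floor_le ?floorD1_gt.
    apply/ffunP => i; rewrite /Z ffunE; apply/floor_def.
    by have := h i I; rewrite /= in_itv/= ler_pdivrMr// ltr_pdivlMr.
  apply: fin_bigcap_measurable => // i _; rewrite -[X in measurable X]setTI.
  exact: measurable_tnth.
apply: (@cvg_comp _ _ _ (fun k => G k (Z k t)) g); last exact: cg.
move=> P [Q hQ QP].
have : \forall k \near \oo, forall i j, Q i j (G k (Z k t) i j).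
  apply: filter_forall => i; apply: filter_forall => j; rewrite (ord1 i).
  have := hQ i j; rewrite (ord1 i) => /nbhs_normP[e /= e0 he].
  near=> k; apply: he => /=; rewrite !mxE /Z ffunE.
  set a := tnth t j; have k0 : 0 < k.+1%:R :> R by [].
  have /andP[f1 f2] := floor_itv (a * k.+1%:R).
  have -> : a - (Num.floor (a * k.+1%:R))%:~R / k.+1%:R = (a * k.+1%:R - (Num.floor (a * k.+1%:R))%:~R) / k.+1%:R.
    by rewrite mulrBl mulfK// gt_eqF.
  rewrite normrM normfV (gtr0_norm k0) ltr_pdivrMr// ger0_norm ?subr_ge0//.
  apply: (@lt_le_trans _ _ 1); first by rewrite ltrBlDl -intrD1.
  have : e^-1 <= k%:R by near: k; exact: nbhs_infty_ger.
  rewrite -ler_pdivrMl// mulr1 => /le_trans; apply.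
  by rewrite ler_nat.
by apply: filterS => k hk; exact: QP.
Unshelve. all: by end_near. Qed.

Definition Int n (g : 'rV[R]_n -> R) : R := \int[lebesgueN R n]_t g (row_of_tuple t).

(** The product form passes to slices. Of the two powers of [kappa] in each variable, one ensures
    integrability and the other absorbs the factors produced by differentiating under the
    integral. *)
Definition pk n (x : 'rV[R]_n) : R := \prod_i kappa (x 0 i) ^+ 2.

Lemma pk_ge0 n (x : 'rV[R]_n) : 0 <= pk x.
Proof. by apply: prodr_ge0 => i _; exact: sqr_ge0. Qed.

Lemma pk_consv n x0 (x : 'rV[R]_n) : pk (consv x0 x) = kappa x0 ^+ 2 * pk x.
Proof.
rewrite /pk big_ord_recl consv0; congr (_ * _).
by apply: eq_bigr => i _; rewrite consv_lift.
Qed.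

Lemma kappa2_le1 (x : R) : kappa x ^+ 2 <= 1.
Proof. by rewrite exprn_ile1 ?kappa_ge0// kappa_le1. Qed.

Lemma pk_le1 n (x : 'rV[R]_n) : pk x <= 1.
Proof. by apply: prodr_ile1 => i _; rewrite sqr_ge0 kappa2_le1. Qed.

Lemma pk_consv_le n x0 (x : 'rV[R]_n) : pk (consv x0 x) <= pk x.
Proof. by rewrite pk_consv ler_piMl ?pk_ge0// kappa2_le1. Qed.

Lemma continuous_prod (T : topologicalType) (I : Type) (r : seq I) (F : I -> T -> R) :
  (forall i, continuous (F i)) -> continuous (fun x => \prod_(i <- r) F i x).
Proof.
move=> h; elim: r => [|i r IH].
  by under eq_fun do rewrite big_nil; exact: cst_continuous.
under eq_fun do rewrite big_cons.
by move=> x; apply: (@continuousM _ _ (F i)); [exact: h|exact: IH].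
Qed.

Lemma continuous_kappa2 : continuous (fun x : R => kappa x ^+ 2).
Proof.
under eq_fun do rewrite expr2.
by move=> x; apply: cvgM; exact: continuous_kappa.
Qed.

Lemma continuous_pk n : continuous (@pk n).
Proof.
apply: continuous_prod => i x.
apply: (@continuous_comp _ _ _ (fun x : 'rV[R]_n => x 0 i) (fun y => kappa y ^+ 2)).
  exact: continuous_coord.
exact: continuous_kappa2.
Qed.

Lemma integrable_kappa2 : mu.-integrable setT (EFin \o (fun x : R => kappa x ^+ 2)).
Proof.
apply: (@integrable_of_kappa _ _ 1).
  by apply: continuous_measurable_fun; exact: continuous_kappa2.
move=> x; rewrite ger0_norm ?sqr_ge0// mul1r expr2 ler_piMl ?kappa_ge0//.
exact: kappa_le1.
Qed.

Definition ckappa : R := \int[mu]_x (kappa x ^+ 2).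

Lemma ckappa_ge0 : 0 <= ckappa.
Proof. by apply: Rintegral_ge0 => x _; exact: sqr_ge0. Qed.

Lemma ckappaE : (\int[mu]_x (kappa x ^+ 2)%:E = ckappa%:E)%E.
Proof. by rewrite /ckappa /Rintegral fineK// (integrable_fin_num measurableT integrable_kappa2). Qed.

Lemma ge0_integral_step n (f : n.+1.-tuple RR -> \bar R) :
  measurable_fun setT f -> (forall t, (0 <= f t)%E) ->
  (\int[lebesgueN R n.+1]_t f t = \int[@lebN n \x mu]_z f (prepend z))%E.
Proof.
move=> mf f0.
have := @ge0_integral_pushforward _ _ _ _ R (@prepend R n) (@measurable_prepend R n)
  (lebesgueN R n \x mu)%E setT f measurableT mf (fun t _ => f0 t).
by rewrite preimage_setT.
Qed.

Lemma integral_step n (f : n.+1.-tuple RR -> \bar R) :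
  measurable_fun setT f -> (@lebN n \x mu)%E.-integrable setT (f \o @prepend R n) ->
  (\int[lebesgueN R n.+1]_t f t = \int[@lebN n \x mu]_z f (prepend z))%E.
Proof.
move=> mf fi.
have := @integral_pushforward _ _ _ _ R (@prepend R n) (@measurable_prepend R n)
  (lebesgueN R n \x mu)%E setT f mf.
by rewrite preimage_setT => /(_ fi measurableT).
Qed.

Lemma integral_pk n : (\int[lebesgueN R n]_t (pk (row_of_tuple t))%:E = (ckappa ^+ n)%:E)%E.
Proof.
have mpk m : measurable_fun setT (fun t => (pk (@row_of_tuple R m t))%:E).
  by apply/measurable_EFinP; apply: measurable_row_of_tuple; exact: continuous_pk.
elim: n => [|n IH].
  have pk0 (x : 'rV[R]_0) : pk x = 1 by rewrite /pk big_ord0.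
  rewrite /= integral_dirac//= ?diracT ?mul1e; last exact: mpk.
  by rewrite pk0 expr0.
rewrite ge0_integral_step//; last by move=> t; rewrite lee_fin pk_ge0.
rewrite fubini_tonelli1//=; last 2 first.
- exact: (measurableT_comp (mpk n.+1) (@measurable_prepend R n)).
- by move=> z; rewrite lee_fin pk_ge0.
rewrite [LHS](_ : _ = \int[@lebN n]_t (ckappa%:E * (pk (row_of_tuple t))%:E))%E.
  rewrite ge0_integralZl//; last 3 first.
  - exact: mpk.
  - by move=> t _; rewrite lee_fin pk_ge0.
  - by rewrite lee_fin ckappa_ge0.
  by rewrite [X in (_ * X)%E](_ : _ = (ckappa ^+ n)%:E)%E -?EFinM -?exprS.
apply: eq_integral => t _; rewrite /fubini_F -ckappaE muleC -ge0_integralZl//.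
- by apply: eq_integral => y _; rewrite row_of_prepend pk_consv EFinM muleC.
- by apply/measurable_EFinP; apply: continuous_measurable_fun; exact: continuous_kappa2.
- by move=> y _; rewrite lee_fin sqr_ge0.
- by rewrite lee_fin pk_ge0.
Qed.

Definition Dec n (g : 'rV[R]_n -> R) (A : R) :=
  continuous g /\ forall x, `|g x| <= A * pk x.

Lemma integrable_pk n : (lebesgueN R n).-integrable setT (fun t => (pk (@row_of_tuple R n t))%:E).
Proof.
apply/integrableP; split.
  by apply/measurable_EFinP; apply: measurable_row_of_tuple; exact: continuous_pk.
under eq_integral => t _ do rewrite /= ger0_norm ?pk_ge0//.
by rewrite integral_pk ltry.
Qed.

Lemma integrable_Dec n (g : 'rV[R]_n -> R) A : Dec g A ->
  (lebesgueN R n).-integrable setT (EFin \o (fun t => g (row_of_tuple t))).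
Proof.
move=> [cg gA].
have h := integrableZl measurableT A (integrable_pk n).
apply: (le_integrable _ _ _ h) => //.
  by apply/measurable_EFinP; exact: measurable_row_of_tuple.
move=> t _ /=; rewrite lee_fin; apply: (le_trans (gA _)); exact: ler_norm.
Qed.

Lemma Int_bound n (g : 'rV[R]_n -> R) A : Dec g A -> `|Int g| <= A * ckappa ^+ n.
Proof.
move=> dg; have gi := integrable_Dec dg; have [cg gA] := dg.
apply: (le_trans (le_normr_Rintegral measurableT gi)).
have h := integrableZl measurableT A (integrable_pk n).
apply: (@le_trans _ _ (\int[lebesgueN R n]_t (A * pk (row_of_tuple t)))).
  apply: le_Rintegral => //; exact: integrable_norm.
rewrite RintegralZl//; last exact: integrable_pk.
by rewrite /Rintegral integral_pk.
Qed.

Lemma Dec_slice n (g : 'rV[R]_n.+1 -> R) A x0 : Dec g A ->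
  Dec (fun x => g (consv x0 x)) (A * kappa x0 ^+ 2).
Proof.
move=> [cg gA]; split.
  by move=> x; apply: (@continuous_comp _ _ _ (consv x0) g); [exact: continuous_consvr|exact: cg].
by move=> x; rewrite -mulrA -pk_consv.
Qed.

Lemma slice_continuous n (g : 'rV[R]_n.+1 -> R) x : continuous g ->
  continuous (fun x0 => g (consv x0 x)).
Proof.
move=> cg x0; apply: (@continuous_comp _ _ _ (fun x0 => consv x0 x) g); last exact: cg.
exact: continuous_consvl.
Qed.

Lemma integrable_slice n (g : 'rV[R]_n.+1 -> R) A x : Dec g A ->
  mu.-integrable setT (EFin \o (fun x0 => g (consv x0 x))).
Proof.
move=> [cg gA].
have h := integrableZl measurableT (A * pk x) integrable_kappa2.
apply: (le_integrable _ _ _ h) => //.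
  by apply/measurable_EFinP; apply: continuous_measurable_fun; exact: slice_continuous.
move=> x0 _ /=; rewrite lee_fin; apply: (le_trans (gA _)); apply: le_trans (ler_norm _).
by rewrite pk_consv (_ : A * (kappa x0 ^+ 2 * pk x) = A * pk x * kappa x0 ^+ 2)//; ring.
Qed.

Lemma integrable_prod n (g : 'rV[R]_n.+1 -> R) A : Dec g A ->
  (@lebN n \x mu)%E.-integrable setT ((fun t => (g (row_of_tuple t))%:E) \o @prepend R n).
Proof.
move=> dg; have [cg gA] := dg.
have mg : measurable_fun setT (fun t => (g (@row_of_tuple R n.+1 t))%:E).
  by apply/measurable_EFinP; exact: measurable_row_of_tuple.
apply/integrableP; split; first exact: (measurableT_comp mg (@measurable_prepend R n)).
have := integrable_Dec dg => /integrableP[_].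
rewrite ge0_integral_step//=.
apply/measurable_EFinP; apply: measurableT_comp => //.
exact: measurable_row_of_tuple.
Qed.

Lemma Int_step n (g : 'rV[R]_n.+1 -> R) A : Dec g A ->
  Int g = Int (fun x => \int[mu]_x0 g (consv x0 x)).
Proof.
move=> dg; have [cg gA] := dg.
have mg : measurable_fun setT (fun t => (g (@row_of_tuple R n.+1 t))%:E).
  by apply/measurable_EFinP; exact: measurable_row_of_tuple.
rewrite /Int /Rintegral integral_step//; last exact: integrable_prod dg.
rewrite -integral12_prod_meas1; last exact: integrable_prod dg.
congr fine; apply: eq_integral => t _; rewrite /fubini_F fineK; last first.
  exact: (integrable_fin_num measurableT (integrable_slice (row_of_tuple t) dg)).
by apply: eq_integral => y _; rewrite row_of_prepend.
Qed.

Lemma Int_step' n (g : 'rV[R]_n.+1 -> R) A : Dec g A ->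
  Int g = \int[mu]_x0 Int (fun x => g (consv x0 x)).
Proof.
move=> dg; have [cg gA] := dg.
have mg : measurable_fun setT (fun t => (g (@row_of_tuple R n.+1 t))%:E).
  by apply/measurable_EFinP; exact: measurable_row_of_tuple.
rewrite /Int /Rintegral integral_step//; last exact: integrable_prod dg.
rewrite -integral21_prod_meas1; last exact: integrable_prod dg.
congr fine; apply: eq_integral => y _; rewrite /fubini_G fineK; last first.
  exact: (integrable_fin_num measurableT (integrable_Dec (Dec_slice y dg))).
by apply: eq_integral => t _; rewrite row_of_prepend.
Qed.

End LebesgueIntegration.

(** * Fourier inversion in several variables *)

Section PhaseFourier.
Variable R : realType.
Notation mu := (@lebesgue_measure R).

Lemma pk_gt0 n (x : 'rV[R]_n) : 0 < pk x.
Proof. by apply: prodr_gt0 => i _; rewrite exprn_gt0// kappa_gt0. Qed.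

Lemma Dec_ge0 n (g : 'rV[R]_n -> R) A : Dec g A -> 0 <= A.
Proof.
move=> [_ gA]; rewrite -(pmulr_lge0 _ (pk_gt0 (0 : 'rV[R]_n))).
exact: le_trans (gA 0).
Qed.

Lemma le_Dec n (g : 'rV[R]_n -> R) A B : A <= B -> Dec g A -> Dec g B.
Proof.
move=> AB [cg gA]; split => // x; apply: (le_trans (gA x)).
by rewrite ler_wpM2r ?pk_ge0.
Qed.

Lemma DecD n (g g' : 'rV[R]_n -> R) A A' : Dec g A -> Dec g' A' ->
  Dec (fun x => g x + g' x) (A + A').
Proof.
move=> [cg gA] [cg' gA']; split.
  by move=> x; apply: (@continuousD _ R^o _ g); [exact: cg|exact: cg'].
by move=> x; rewrite mulrDl; apply: (le_trans (ler_normD _ _)); apply: lerD.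
Qed.

Lemma DecM n (g b : 'rV[R]_n -> R) A B : Dec g A -> continuous b ->
  (forall x, `|b x| <= B) -> Dec (fun x => g x * b x) (A * B).
Proof.
move=> dg cb bB; have A0 := Dec_ge0 dg; have [cg gA] := dg; split.
  by move=> x; apply: (@continuousM _ _ g); [exact: cg|exact: cb].
by move=> x; rewrite normrM mulrAC ler_pM.
Qed.

Lemma DecZ n (g : 'rV[R]_n -> R) (k A : R) : Dec g A -> Dec (fun x => k * g x) (`|k| * A).
Proof.
move=> dg; have := @DecM _ g (fun=> k) A `|k| dg (@cst_continuous _ _ _) (fun=> lexx _).
by rewrite mulrC; under eq_fun do rewrite mulrC.
Qed.

Lemma IntD n (g g' : 'rV[R]_n -> R) A A' : Dec g A -> Dec g' A' ->
  Int (fun x => g x + g' x) = Int g + Int g'.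
Proof.
by move=> dg dg'; apply: RintegralD => //; [exact: integrable_Dec dg|exact: integrable_Dec dg'].
Qed.

Lemma IntZ n (g : 'rV[R]_n -> R) (k A : R) : Dec g A -> Int (fun x => k * g x) = k * Int g.
Proof. by move=> dg; apply: RintegralZl => //; exact: integrable_Dec dg. Qed.

Lemma eq_Int n (g g' : 'rV[R]_n -> R) : g =1 g' -> Int g = Int g'.
Proof. by move=> e; apply: eq_Rintegral => t _; exact: e. Qed.

Lemma Int_lincomb3 n (g1 g2 g3 : 'rV[R]_n -> R) (k2 k3 A1 A2 A3 : R) :
  Dec g1 A1 -> Dec g2 A2 -> Dec g3 A3 ->
  Int (fun x => g1 x + (k2 * g2 x + k3 * g3 x)) = Int g1 + (k2 * Int g2 + k3 * Int g3).
Proof.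
move=> d1 d2 d3.
by rewrite (IntD d1 (DecD (DecZ k2 d2) (DecZ k3 d3))) (IntD (DecZ k2 d2) (DecZ k3 d3))
  (IntZ k2 d2) (IntZ k3 d3).
Qed.

Lemma dotprodDr n (x y z : 'rV[R]_n) : dotprod x (y + z) = dotprod x y + dotprod x z.
Proof. by rewrite /dotprod -big_split; apply: eq_bigr => i _; rewrite !mxE mulrDr. Qed.

Lemma dotprodC n (x y : 'rV[R]_n) : dotprod x y = dotprod y x.
Proof. by rewrite /dotprod; apply: eq_bigr => i _; rewrite mulrC. Qed.

Lemma dotprodDl n (x y z : 'rV[R]_n) : dotprod (x + y) z = dotprod x z + dotprod y z.
Proof. by rewrite !(dotprodC _ z) dotprodDr. Qed.

Lemma dotprodNr n (x y : 'rV[R]_n) : dotprod x (- y) = - dotprod x y.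
Proof. by rewrite /dotprod -sumrN; apply: eq_bigr => i _; rewrite !mxE mulrN. Qed.

Lemma dotprod_unitv n (x : 'rV[R]_n) i (h : R) : dotprod x (h *: unitv R i) = h * x 0 i.
Proof.
rewrite /dotprod (bigD1 i)//= big1 ?addr0 => [|j ji]; rewrite !mxE eqxx/=.
  by rewrite eqxx mulr1 mulrC.
by rewrite (negbTE ji) mulr0 mulr0.
Qed.

Lemma dotprod_consv n x0 y0 (x y : 'rV[R]_n) :
  dotprod (consv x0 x) (consv y0 y) = x0 * y0 + dotprod x y.
Proof.
rewrite /dotprod big_ord_recl !consv0; congr (_ + _).
by apply: eq_bigr => i _; rewrite !consv_lift.
Qed.

Lemma continuous_dotprod n (xi : 'rV[R]_n) : continuous (fun x => dotprod x xi : R^o).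
Proof.
apply: continuous_sum_seq => i x.
by apply: (@continuousM _ _ (fun x : 'rV[R]_n => x 0 i) (fun=> xi 0 i));
  [exact: continuous_coord|exact: cst_continuous].
Qed.

Lemma continuous_phase n (f : R -> R) (xi : 'rV[R]_n) th : continuous f ->
  continuous (fun x => f (dotprod x xi + th)).
Proof.
move=> cf x; apply: (@continuous_comp _ _ _ (fun x => dotprod x xi + th) f); last exact: cf.
apply: (@continuousD _ R^o _ (fun x => dotprod x xi)); first exact: continuous_dotprod.
exact: cst_continuous.
Qed.

(* The cosine transform with a phase: taking [th] to be multiples of [pi / 2]
   gives the real and imaginary parts of the Fourier transform, and
   differentiation only shifts [th]. *)
Definition CT n (g : 'rV[R]_n -> R) (th : R) (xi : 'rV[R]_n) : R :=
  Int (fun x => g x * cos (dotprod x xi + th)).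

Lemma Dec_phase n (g : 'rV[R]_n -> R) A th xi : Dec g A ->
  Dec (fun x => g x * cos (dotprod x xi + th)) A.
Proof.
move=> dg; rewrite -[A]mulr1; apply: DecM => // x.
  by apply: continuous_phase; exact: continuous_cos.
exact: norm_cos.
Qed.

Lemma CT_bound n (g : 'rV[R]_n -> R) A th xi : Dec g A -> `|CT g th xi| <= A * ckappa R ^+ n.
Proof. by move=> dg; apply: Int_bound; exact: Dec_phase. Qed.

Lemma cos_quad (a s : R) : `|cos (a + s) - cos a - s * cos (a + pi / 2)| <= s ^+ 2.
Proof.
have d2 t : is_derive t (1 : R^o) (fun t => - sin t : R^o) (- cos t) by exact: is_deriveN.
have := @quad_bound1 R _ _ _ a s 1 (@is_derive_cos R) d2.
rewrite mul1r cosDpihalf; apply => t; rewrite normrN; exact: norm_cos.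
Qed.

Lemma ddx_CT n (g : 'rV[R]_n -> R) i A A1 A2 th xi : Dec g A ->
  Dec (fun x => x 0 i * g x) A1 -> Dec (fun x => x 0 i ^+ 2 * g x) A2 ->
  ddx i (CT g th) xi (CT (fun x => x 0 i * g x) (th + pi / 2) xi).
Proof.
move=> dg d1 d2; apply: (@ddx_quad _ _ _ _ _ _ (A2 * ckappa R ^+ n)) => h _.
pose E x := g x * cos (dotprod x (xi + h *: unitv R i) + th) +
  (- 1 * (g x * cos (dotprod x xi + th)) +
   - h * ((x 0 i * g x) * cos (dotprod x xi + (th + pi / 2)))).
have -> : CT g th (xi + h *: unitv R i) - CT g th xi - h * CT (fun x => x 0 i * g x) (th + pi / 2) xi = Int E.
  rewrite /E (Int_lincomb3 _ _ (Dec_phase th (xi + h *: unitv R i) dg) (Dec_phase th xi dg) (Dec_phase (th + pi / 2) xi d1)).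
  by rewrite /CT; ring.
have dE : Dec E (A2 * h ^+ 2).
  split.
    by have [] := DecD (Dec_phase th (xi + h *: unitv R i) dg)
      (DecD (DecZ (-1) (Dec_phase th xi dg)) (DecZ (- h) (Dec_phase (th + pi / 2) xi d1))).
  move=> x; rewrite /E dotprodDr dotprod_unitv.
  set a := dotprod x xi + th.
  have -> : dotprod x xi + h * x 0 i + th = a + h * x 0 i by rewrite /a; ring.
  have -> : dotprod x xi + (th + pi / 2) = a + pi / 2 by rewrite /a; ring.
  have -> : forall p q r : R, g x * p + (- 1 * (g x * q) + - h * (x 0 i * g x * r)) =
    g x * (p - q - (h * x 0 i) * r) by move=> p q r; ring.
  rewrite normrM; apply: (@le_trans _ _ (`|g x| * (h * x 0 i) ^+ 2)).
    by rewrite ler_wpM2l// cos_quad.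
  rewrite exprMn.
  have -> : `|g x| * (h ^+ 2 * x 0 i ^+ 2) = h ^+ 2 * `|x 0 i ^+ 2 * g x|.
    by rewrite normrM (ger0_norm (sqr_ge0 _)); ring.
  have -> : A2 * h ^+ 2 * pk x = h ^+ 2 * (A2 * pk x) by ring.
  by rewrite ler_wpM2l ?sqr_ge0//; case: d2.
by apply: (le_trans (Int_bound dE)); rewrite mulrAC.
Qed.

Lemma consvD_unit0 n (x0 t : R) (x : 'rV[R]_n) :
  consv x0 x + t *: unitv R ord0 = consv (x0 + t) x.
Proof.
apply: consv_ext => [|j]; rewrite !mxE ?eqxx/=.
  by rewrite !unlift_none mulr1.
by rewrite !liftK mulr0 addr0.
Qed.

Lemma consvD_unit n (x0 t : R) (x : 'rV[R]_n) j :
  consv x0 x + t *: unitv R (lift ord0 j) = consv x0 (x + t *: unitv R j).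
Proof.
apply: consv_ext => [|i]; rewrite !mxE ?eqxx/=.
  by rewrite !unlift_none mulr0 addr0.
by rewrite !liftK !mxE eqxx/= (inj_eq (lift_inj)).
Qed.

Lemma ddx_slice0 n (g : 'rV[R]_n.+1 -> R) x0 (x : 'rV[R]_n) l :
  ddx ord0 g (consv x0 x) l -> is_derive x0 (1 : R^o) (fun z => g (consv z x) : R^o) l.
Proof.
have -> : consv x0 x = consv 0 x + x0 *: unitv R ord0 by rewrite consvD_unit0 add0r.
move=> /ddx_slice; congr (is_derive _ _ _ _); apply/funext => z.
by rewrite consvD_unit0 add0r.
Qed.

Lemma ddx_slice_lift n (g : 'rV[R]_n.+1 -> R) x0 (x : 'rV[R]_n) j l :
  ddx (lift ord0 j) g (consv x0 x) l -> ddx j (fun x => g (consv x0 x)) x l.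
Proof.
move=> /ddx0_slice h; apply/ddx0_slice; move: h.
by congr (is_derive _ _ _ _); apply/funext => z; rewrite consvD_unit.
Qed.

(** If [i] is the first coordinate, it is integrated first, on a line, where the primitive vanishes
    at infinity. Otherwise the first coordinate is integrated last and the dimension drops. *)
Lemma Int_partial n i (g dg : 'rV[R]_n -> R) A : (forall x, ddx i g x (dg x)) ->
  Dec g A -> Dec dg A -> Int dg = 0.
Proof.
elim: n i g dg A => [[]//|n IH] i g dg A d hg hdg.
case: (unliftP ord0 i) d => [j|] -> d.
  rewrite (Int_step' hdg) (_ : (fun _ => _) = fun=> 0); first by rewrite /Rintegral integral0.
  apply/funext => y; apply: (IH j (fun x => g (consv y x)) _ (A * kappa y ^+ 2)).
  - by move=> x; apply: ddx_slice_lift.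
  - exact: Dec_slice.
  - exact: Dec_slice.
rewrite (Int_step hdg) (_ : (fun _ => _) = fun=> 0); first by rewrite /Int /Rintegral integral0.
apply/funext => x; apply: (@Rintegral_derive0 R (fun y => g (consv y x)) _ A).
- by move=> y; apply: ddx_slice0.
- by apply: slice_continuous; case: hdg.
- move=> y; have [_ h] := hg; apply: (le_trans (h _)).
  rewrite ler_wpM2l ?(Dec_ge0 hg)// pk_consv expr2 -mulrA ler_piMr ?kappa_ge0//.
  by rewrite -[leRHS]mulr1 ler_pM ?pk_ge0 ?kappa_ge0 ?kappa_le1 ?pk_le1.
- move=> y; have [_ h] := hdg; apply: (le_trans (h _)).
  rewrite ler_wpM2l ?(Dec_ge0 hg)// pk_consv expr2 -mulrA ler_piMr ?kappa_ge0//.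
  by rewrite -[leRHS]mulr1 ler_pM ?pk_ge0 ?kappa_ge0 ?kappa_le1 ?pk_le1.
Qed.

Lemma ddx_phase n i (xi x : 'rV[R]_n) th :
  ddx i (fun x => cos (dotprod x xi + th)) x (- xi 0 i * sin (dotprod x xi + th)).
Proof.
apply/ddx0_slice.
have -> : (fun r => cos (dotprod (x + r *: unitv R i) xi + th) : R^o) =
    (fun r => cos ((dotprod x xi + th) + r * xi 0 i)).
  by apply/funext => r; rewrite dotprodDl [dotprod (_ *: _) _]dotprodC dotprod_unitv addrAC.
set a := dotprod x xi + th.
have h : is_derive (0 : R) (1 : R^o) (fun r => a + r * xi 0 i : R^o) (xi 0 i).
  have := @is_deriveD _ _ _ _ _ _ _ _ _ (is_derive_cst (a : R^o) (0 : R) (1 : R^o))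
    (@is_deriveM R R^o id (cst (xi 0 i)) 0 1 1 0 (is_derive_id _ _) (is_derive_cst _ _ _)).
  by rewrite scale0r add0r add0r [_ *: _]mulr1.
have := @is_derive1_comp R cos (fun r => a + r * xi 0 i) 0 _ _ (is_derive_cos _) h.
by rewrite mul0r addr0 mulNr mulrC -mulNr.
Qed.

(** Integration by parts: the derivative of [g] times the cosine has integral 0, and the phase - pi
    / 2 writes the resulting sine as a cosine. *)
Lemma CT_partial n i (g dg : 'rV[R]_n -> R) A A' th xi : (forall x, ddx i g x (dg x)) ->
  Dec g A -> Dec dg A' -> CT dg th xi = xi 0 i * CT g (th - pi / 2) xi.
Proof.
move=> d hg hdg.
have cs a : cos (a - pi / 2) = sin a by rewrite -sinDpihalf subrK.
have e : Int (fun x => dg x * cos (dotprod x xi + th) + (- xi 0 i) * (g x * cos (dotprod x xi + (th - pi / 2)))) = 0.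
  have d1 := DecD (Dec_phase th xi hdg) (DecZ (- xi 0 i) (Dec_phase (th - pi / 2) xi hg)).
  have d2 := Dec_phase th xi hg.
  set B := A' + _ in d1.
  apply: (@Int_partial _ i (fun x => g x * cos (dotprod x xi + th)) _ (B + A)).
  - move=> x; rewrite addrA cs mulrCA; apply: ddxM; first exact: d.
    exact: ddx_phase.
  - by apply: le_Dec d2; rewrite lerDr (Dec_ge0 d1).
  - by apply: le_Dec d1; rewrite lerDl (Dec_ge0 d2).
move: e; rewrite (IntD (Dec_phase th xi hdg) (DecZ (- xi 0 i) (Dec_phase (th - pi / 2) xi hg))).
rewrite (IntZ _ (Dec_phase (th - pi / 2) xi hg)) -/(CT _ _ _) -/(CT _ _ _).
lra.
Qed.

Lemma lipschitz_continuous (h : R -> R) L : (forall y z, `|h y - h z| <= L * `|y - z|) ->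
  continuous h.
Proof.
move=> hL x; apply/cvgrPdist_le => e e0; near=> y.
apply: (le_trans (hL _ _)); apply: (@le_trans _ _ ((`|L| + 1) * `|x - y|)).
  by rewrite ler_wpM2r// (le_trans (ler_norm L))// lerDl.
have p : 0 < `|L| + 1 by rewrite ltr_wpDl.
rewrite mulrC -ler_pdivlMr//; near: y.
by apply: cvgr_dist_le; [exact: cvg_id|exact: divr_gt0].
Unshelve. all: by end_near. Qed.

Lemma cosM (a b : R) : cos a * cos b = (cos (a + b) + cos (b - a)) / 2.
Proof. by rewrite cosD cosB; field. Qed.

(** Induction on the dimension, one factor 8 per coordinate. For a frozen first coordinate [y], the
    transform [h y] of the slice is the quantity to be bounded, and as a function of [y] it falls
    under the one-dimensional case. The bounds on the partial derivatives make [h] Lipschitz. *)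
Lemma fourier_inversion_bound n (g : 'rV[R]_n -> R) (dg : 'I_n -> 'rV[R]_n -> R) A D :
  (forall i x, ddx i g x (dg i x)) -> (forall i x, `|dg i x| <= A * pk x) -> Dec g A ->
  (forall th xi, `|CT g th xi| <= D * \prod_i kappa (xi 0 i)) ->
  forall x, `|g x| <= D * 8 ^+ n.
Proof.
elim: n g dg A D => [|n IH] g dg A D d b hg hD x.
  have := hD 0 0; rewrite big_ord0 /CT /Int /Rintegral.
  rewrite integral_dirac//=; last first.
    apply/measurable_EFinP; apply: (@measurable_row_of_tuple _ _ (fun x => g x * cos (dotprod x 0 + 0))).
    by have [] := Dec_phase 0 0 hg.
  rewrite /dotprod big_ord0 addr0 cos0 !mulr1 indicE in_setT mul1r.
  by rewrite (_ : row_of_tuple _ = x)//; apply/rowP => -[].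
rewrite -(consvK x); set x0 := x 0 ord0; set x' := \row_j _.
have A0 := Dec_ge0 hg.
rewrite exprS mulrA.
apply: (IH (fun x => g (consv x0 x)) (fun i x => dg (lift ord0 i) (consv x0 x)) A).
- by move=> i y; apply: ddx_slice_lift.
- by move=> i y; apply: (le_trans (b _ _)); rewrite ler_wpM2l// pk_consv_le.
- by apply: le_Dec (Dec_slice x0 hg); rewrite ler_piMr// kappa2_le1.
move=> th xi.
pose h y := CT (fun x => g (consv y x)) th xi.
have P0 : 0 <= \prod_i kappa (xi 0 i) by apply: prodr_ge0 => i _; exact: kappa_ge0.
rewrite -/(h x0) -mulrA [8 * _]mulrC mulrA.
apply: (@fourier_inversion_bound1 _ h (A * ckappa R ^+ n)).
- apply: (@lipschitz_continuous h (A * ckappa R ^+ n)) => y z.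
  have dyz : Dec (fun x => g (consv y x) + -1 * g (consv z x)) (`|y - z| * A).
    split.
      by have [] := DecD (Dec_slice y hg) (DecZ (-1) (Dec_slice z hg)).
    move=> t; have := @mvt_dir _ _ ord0 g (dg ord0) (consv z t) (y - z) (fun r => d _ _).
    move=> [c _ e]; rewrite consvD_unit0 [z + _]addrC subrK in e.
    rewrite mulN1r e normrM -mulrA ler_wpM2l// consvD_unit0.
    by apply: (le_trans (b _ _)); rewrite ler_wpM2l// pk_consv_le.
  have -> : h y - h z = CT (fun x => g (consv y x) + -1 * g (consv z x)) th xi.
    rewrite /h /CT -[- Int _]mulN1r -(IntZ _ (Dec_phase th xi (Dec_slice z hg))).
    rewrite -(IntD (Dec_phase th xi (Dec_slice y hg)) (DecZ (-1) (Dec_phase th xi (Dec_slice z hg)))).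
    by apply: eq_Int => t; ring.
  by apply: (le_trans (CT_bound th xi dyz)); rewrite -mulrA mulrC.
- by move=> y; rewrite mulrAC; exact: CT_bound (Dec_slice y hg).
move=> th' xi0.
(* By [cosM], the one-dimensional transform of [h] is the mean of two full transforms of [g], at the
   frequencies (xi0, xi) and (xi0, - xi). *)
pose G x := 2^-1 * (g x * cos (dotprod x (consv xi0 xi) + (th + th'))) +
            2^-1 * (g x * cos (dotprod x (consv xi0 (- xi)) + (th' - th))).
have d1 := Dec_phase (th + th') (consv xi0 xi) hg.
have d2 := Dec_phase (th' - th) (consv xi0 (- xi)) hg.
have -> : \int[mu]_y (h y * cos (y * xi0 + th')) = Int G.
  rewrite (Int_step' (DecD (DecZ 2^-1 d1) (DecZ 2^-1 d2))); apply: eq_Rintegral => y _.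
  rewrite mulrC /h /CT -(IntZ _ (Dec_phase th xi (Dec_slice y hg))); apply: eq_Int => t.
  rewrite !dotprod_consv dotprodNr mulrCA [cos _ * cos _]mulrC cosM.
  have -> : dotprod t xi + th + (y * xi0 + th') = y * xi0 + dotprod t xi + (th + th') by ring.
  have -> : y * xi0 + th' - (dotprod t xi + th) = y * xi0 - dotprod t xi + (th' - th) by ring.
  by ring.
rewrite /G (IntD (DecZ 2^-1 d1) (DecZ 2^-1 d2)) (IntZ _ d1) (IntZ _ d2).
have h1 := hD (th + th') (consv xi0 xi); have h2 := hD (th' - th) (consv xi0 (- xi)).
rewrite big_ord_recl consv0 in h1; rewrite big_ord_recl consv0 in h2.
have e1 : \prod_(i < n) kappa (consv xi0 xi 0 (lift ord0 i)) = \prod_i kappa (xi 0 i).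
  by apply: eq_bigr => i _; rewrite consv_lift.
have e2 : \prod_(i < n) kappa (consv xi0 (- xi) 0 (lift ord0 i)) = \prod_i kappa (xi 0 i).
  by apply: eq_bigr => i _; rewrite consv_lift mxE kappaN.
rewrite e1 in h1; rewrite e2 in h2.
rewrite -mulrDr normrM (ger0_norm (_ : 0 <= 2^-1))// -!/(CT _ _ _).
have := ler_normD (CT g (th + th') (consv xi0 xi)) (CT g (th' - th) (consv xi0 (- xi))).
have -> : D * \prod_i kappa (xi 0 i) * kappa xi0 = D * (kappa xi0 * \prod_i kappa (xi 0 i)) by ring.
lra.
Qed.

End PhaseFourier.

(** * Weighted classes of functions *)

Section EuclideanNorm.
Variables (R : realType) (N : nat).
Implicit Types x y : 'rV[R]_N.

Lemma enorm_ge0 x : 0 <= enorm x. Proof. exact: sqrtr_ge0. Qed.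

Lemma enormN x : enorm (- x) = enorm x.
Proof. by rewrite /enorm; congr Num.sqrt; apply: eq_bigr => i _; rewrite mxE sqrrN. Qed.

Lemma coord_le_enorm x i : `|x 0 i| <= enorm x.
Proof.
rewrite -sqrtr_sqr /enorm ler_wsqrtr// (bigD1 i)//= lerDl sumr_ge0// => j _.
exact: sqr_ge0.
Qed.

Lemma enorm_le_sum x : enorm x <= \sum_i `|x 0 i|.
Proof.
have S0 : 0 <= \sum_i `|x 0 i| by rewrite sumr_ge0.
rewrite /enorm -(ger0_norm S0) -sqrtr_sqr ler_wsqrtr// expr2 mulr_suml.
apply: ler_sum => i _; rewrite -(real_normK (num_real (x 0 i))) expr2 ler_wpM2l//.
by rewrite (bigD1 i)//= lerDl sumr_ge0.
Qed.

(** The factor [N] is harmless, as [w_scale] absorbs dilations of the argument of the weight. *)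
Lemma enormD_weak x y : enorm (x + y) <= N%:R * (enorm x + enorm y).
Proof.
apply: (le_trans (enorm_le_sum _)).
apply: (@le_trans _ _ (\sum_(i < N) (enorm x + enorm y))).
  apply: ler_sum => i _; rewrite mxE; apply: (le_trans (ler_normD _ _)).
  by rewrite lerD ?coord_le_enorm.
by rewrite sumr_const card_ord mulr_natl.
Qed.

Lemma enorm_unitv i (t : R) : enorm (t *: unitv R i : 'rV[R]_N) <= `|t|.
Proof.
apply: (le_trans (enorm_le_sum _)); rewrite (bigD1 i)//= big1 ?addr0 => [|j ji].
  by rewrite !mxE !eqxx mulr1.
by rewrite !mxE (negbTE ji) mulr0 normr0.
Qed.

Lemma enorm_le_coord x : (0 < N)%N -> exists i, enorm x <= N%:R * `|x 0 i|.
Proof.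
move=> N0; pose i := [arg max_(j > Ordinal N0) `|x 0 j|]%O.
exists i; apply: (le_trans (enorm_le_sum _)).
apply: (@le_trans _ _ (\sum_(j < N) `|x 0 i|)).
  apply: ler_sum => j _; rewrite /i.
  by case: Order.TotalTheory.arg_maxP => // k _; apply.
by rewrite sumr_const card_ord mulr_natl.
Qed.

End EuclideanNorm.

Section WeightedClasses.
Variables (R : realType) (N : nat) (w : R -> R).
Hypotheses (hN : (0 < N)%N) (hw : nqa_weight w).
Implicit Types (u v : 'rV[R]_N -> R) (x y : 'rV[R]_N) (s : seq 'I_N).

Lemma w_enorm_ge0 x : 0 <= w (enorm x).
Proof. by apply: (w_ge0 hw); exact: enorm_ge0. Qed.

Lemma w_enorm_add : exists2 K, 1 <= K & forall x y,
  w (enorm (x + y)) <= K * (1 + w (enorm x) + w (enorm y)).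
Proof.
have [K K1 hK] := w_add hw.
have N1 : 1 <= N%:R :> R by rewrite ler1n.
have [L L1 hL] := w_scale hw N1.
exists (L * (1 + K)); first by rewrite -[leLHS]mulr1 ler_pM//; lra.
move=> x y; have ex := enorm_ge0 x; have ey := enorm_ge0 y.
apply: (@le_trans _ _ (w (N%:R * (enorm x + enorm y)))).
  by apply: (nqa_nondecreasing hw); [exact: enorm_ge0|exact: enormD_weak].
apply: (le_trans (hL _ _)); first exact: addr_ge0.
rewrite -mulrA ler_pM2l; last lra.
have := hK _ _ ex ey; have := w_enorm_ge0 x; have := w_enorm_ge0 y; nra.
Qed.

(** Each [kappa (x 0 i)] is at least (1 + |x|)^-2, and condition (gamma) turns the resulting power
    of 1 + |x| into an exponential of the weight. *)
Lemma prod_kappa_lower k : exists m0 C, [/\ 0 <= m0, 0 < C &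
  forall x, 1 <= C * expR (m0 * w (enorm x)) * \prod_i kappa (x 0 i) ^+ k].
Proof.
have [m0 [C [m00 C0 hC]]] := w_poly hw (2 * k * N).
exists m0, C; split => // x.
have e0 := enorm_ge0 x.
have low : ((1 + enorm x) ^+ (2 * k * N))^-1 <= \prod_i kappa (x 0 i) ^+ k.
  have -> : ((1 + enorm x) ^+ (2 * k * N))^-1 = \prod_(i < N) ((1 + enorm x) ^- 2) ^+ k.
    by rewrite prodr_const card_ord !exprM !exprVn.
  apply: ler_prod => i _; rewrite exprn_ge0 ?invr_ge0 ?exprn_ge0 ?addr_ge0//=.
  rewrite lerXn2r ?nnegrE ?kappa_ge0 ?invr_ge0 ?exprn_ge0 ?addr_ge0//.
  rewrite /kappa lef_pV2 ?posrE ?exprn_gt0 ?ltr_wpDr ?ltr_pwDl ?sqr_ge0//.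
  have := coord_le_enorm x i; rewrite -[X in 1 + X](real_normK (num_real _)).
  by have := normr_ge0 (x 0 i); nra.
have p : 0 < (1 + enorm x) ^+ (2 * k * N) by rewrite exprn_gt0// ltr_wpDr.
apply: (@le_trans _ _ ((1 + enorm x) ^+ (2 * k * N) * ((1 + enorm x) ^+ (2 * k * N))^-1)).
  by rewrite divff// gt_eqF.
apply: ler_pM => //; rewrite ?invr_ge0 ?(ltW p)//.
exact: hC.
Qed.

Lemma decay_pk : exists m0 C, [/\ 0 <= m0, 0 < C &
  forall (c : R) x a, 0 <= a -> a * expR (m0 * w (enorm x)) <= c -> a <= C * c * pk x].
Proof.
have [m0 [C [m00 C0 hC]]] := prod_kappa_lower 2.
exists m0, C; split => // c x a a0 ac.
apply: (@le_trans _ _ (a * (C * expR (m0 * w (enorm x)) * pk x))).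
  by rewrite ler_peMr// hC.
have -> : a * (C * expR (m0 * w (enorm x)) * pk x) = C * (a * expR (m0 * w (enorm x))) * pk x by ring.
by rewrite ler_wpM2r ?pk_ge0// ler_wpM2l// ltW.
Qed.

(* The case [a = m] is the norm q_(m,m) and the case [a = - n] the norm r_(m,n), up
   to a factor 2 when passing to complex-valued functions. *)
Definition wbr (m a c : R) u := forall s x,
  `|iter_partial s u x| * expR (a * w (enorm x)) * J w m (size s) <= c.

Definition SBr u := smooth_real u /\ forall m, 0 <= m -> exists c, wbr m m c u.

(** The decay demanded in the definition of the space: the constant may depend on [s] in any way,
    whereas [SBr] prescribes its growth through [J]. *)
Definition RD u := smooth_real u /\ forall lam s, 0 <= lam ->
  exists c, forall x, `|iter_partial s u x| * expR (lam * w (enorm x)) <= c.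

Lemma wbr_ge0 m a c u : wbr m a c u -> 0 <= c.
Proof. by move=> /(_ [::] 0); apply: le_trans; rewrite !mulr_ge0 ?expR_ge0 ?J_ge0. Qed.

Lemma wbr_mono m m' a a' c u : m <= m' -> a <= a' -> wbr m' a' c u -> wbr m a c u.
Proof.
move=> mm aa h s x; apply: le_trans (h s x).
apply: ler_pM; rewrite ?mulr_ge0 ?expR_ge0 ?J_ge0 ?le_J_m//.
by rewrite ler_wpM2l// ler_expR ler_wpM2r// w_enorm_ge0.
Qed.

Lemma le_wbr m a c c' u : c <= c' -> wbr m a c u -> wbr m a c' u.
Proof. by move=> cc h s x; apply: le_trans cc. Qed.

Lemma SBr_wbr u m a : SBr u -> 0 <= m -> exists2 c, 0 <= c & wbr m a c u.
Proof.
move=> [_ h] m0; have [|c hc] := h (Num.max m a); first by rewrite le_max m0.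
exists c; first exact: wbr_ge0 hc.
by apply: wbr_mono hc; rewrite le_max lexx ?orbT.
Qed.

Lemma SBr_RD u : SBr u -> RD u.
Proof.
move=> su; have [smu _] := su; split => // lam s lam0.
have [m0 m00 hJ] := J_pos hw (size s).
have [c c0 hc] := SBr_wbr lam su m00.
exists (c / J w m0 (size s)) => x; by rewrite ler_pdivlMr ?hJ//.
Qed.

Lemma RD_iter u s : RD u -> RD (iter_partial s u).
Proof.
move=> [su h]; split; first exact: smooth_iter.
by move=> lam s' lam0; rewrite -iter_partial_cat; exact: h.
Qed.

Lemma RD_Dec u : RD u -> exists A, Dec u A.
Proof.
move=> [su h]; have [m0 [C [m00 C0 hC]]] := decay_pk.
have [c hc] := h m0 [::] m00.
exists (C * c); split; first exact: smooth_continuous.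
by move=> x; apply: hC (normr_ge0 _) (hc x).
Qed.

Lemma SBr_iter u s : SBr u -> SBr (iter_partial s u).
Proof.
move=> su; have [smu h] := su; split; first exact: smooth_iter.
move=> m m0; have [M M0 hJ] := J_pos hw (size s).
have [c c0 hc] := SBr_wbr m su (addr_ge0 m0 M0).
exists (c / J w M (size s)) => s' x; rewrite -iter_partial_cat.
rewrite ler_pdivlMr ?hJ//; apply: le_trans (hc (s' ++ s) x).
rewrite -[leLHS]mulrA ler_wpM2l ?mulr_ge0 ?expR_ge0// size_cat.
exact: J_split.
Qed.

Lemma wbrD m a c c' u v : smooth_real u -> smooth_real v ->
  wbr m a c u -> wbr m a c' v -> wbr m a (c + c') (u \+ v).
Proof.
move=> su sv hu hv s x; rewrite iterD//=.
apply: le_trans (lerD (hu s x) (hv s x)).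
by rewrite -!mulrDl ler_wpM2r ?J_ge0// ler_wpM2r ?expR_ge0// ler_normD.
Qed.

Lemma wbrZ m a c (k : R) u : smooth_real u -> wbr m a c u ->
  wbr m a (`|k| * c) (fun x => k * u x).
Proof.
move=> su hu s x; rewrite iterZ// normrM -!mulrA ler_wpM2l// mulrA.
exact: hu.
Qed.

Lemma SBrD u v : SBr u -> SBr v -> SBr (u \+ v).
Proof.
move=> [su hu] [sv hv]; split; first exact: smoothD.
move=> m m0; have [c hc] := hu m m0; have [c' hc'] := hv m m0.
by exists (c + c'); apply: wbrD.
Qed.

Lemma SBrZ u (k : R) : SBr u -> SBr (fun x => k * u x).
Proof.
move=> [su hu]; split; first exact: smoothZ.
by move=> m m0; have [c hc] := hu m m0; exists (`|k| * c); exact: wbrZ.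
Qed.

(** [L] is the constant of [J_scale] for base 2: it absorbs the number of terms in Leibniz's rule,
    while [J_superadd] shares the order between the factors. The exponents of the weight add, so
    that decay of one factor can outweigh growth of the other. *)
Lemma wbrM m : 0 <= m -> exists m' C, [/\ 0 <= m', 0 <= C & forall u v a a' c c',
  smooth_real u -> smooth_real v -> wbr m' a c u -> wbr m' a' c' v ->
  wbr m (a + a') (C * (c * c')) (fun x => u x * v x)].
Proof.
move=> m0; have two : 1 <= 2 :> R by rewrite ler1n.
have [L L1 hL] := J_scale hw two.
exists (m * L), (expR (m * L)); split; rewrite ?expR_ge0 ?mulr_ge0//; first lra.
move=> u v a a' c c' su sv hu hv s x.
have c0 := wbr_ge0 hu; have c'0 := wbr_ge0 hv.
set n := size s; have hLn := hL m n m0.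
have mL0 : 0 <= m * L by rewrite mulr_ge0//; lra.
(* Where [J] vanishes the estimate is trivial; otherwise it may be divided by. The same distinction
   recurs below. *)
have [J0|J0] := eqVneq (J w (m * L) n) 0.
  have -> : J w m n = 0.
    apply/eqP; rewrite eq_le J_ge0 andbT.
    by move: hLn; rewrite J0 mulr0 pmulr_rle0// exprn_gt0.
  by rewrite mulr0 !mulr_ge0 ?expR_ge0.
have {}J0 : 0 < J w (m * L) n by rewrite lt_neqAle eq_sym J0 J_ge0.
set E := expR ((a + a') * w (enorm x)); have E0 : 0 < E := expR_gt0 _.
have hB p q : (size p + size q = size s)%N ->
    `|iter_partial p u x| * `|iter_partial q v x| <= c * c' / (E * J w (m * L) n).
  move=> pq; rewrite ler_pdivlMr ?mulr_gt0//.
  apply: le_trans (ler_pM _ _ (hu p x) (hv q x)); rewrite ?mulr_ge0 ?expR_ge0 ?J_ge0//.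
  rewrite /E mulrDl expRD.
  have := J_superadd hw (size p) (size q) mL0; rewrite pq -/n.
  set X := `|_|; set Y := `|_|; set e1 := expR _; set e2 := expR _.
  have -> : X * e1 * J w (m * L) (size p) * (Y * e2 * J w (m * L) (size q)) =
    X * Y * (e1 * e2 * (J w (m * L) (size p) * J w (m * L) (size q))) by ring.
  rewrite /X /Y /e1 /e2 => h; apply: ler_wpM2l; first by rewrite mulr_ge0.
  by apply: ler_wpM2l => //; rewrite mulr_ge0 ?expR_ge0.
apply: (@le_trans _ _ (2 ^+ n * (c * c' / (E * J w (m * L) n)) * E * J w m n)).
  rewrite ler_wpM2r ?J_ge0// ler_wpM2r ?expR_ge0//.
  exact: iterM_bound.
have -> : 2 ^+ n * (c * c' / (E * J w (m * L) n)) * E * J w m n =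
  c * c' / J w (m * L) n * (2 ^+ n * J w m n).
  by field; rewrite (gt_eqF J0) (gt_eqF E0).
apply: (@le_trans _ _ (c * c' / J w (m * L) n * (expR (m * L) * J w (m * L) n))).
  by rewrite ler_wpM2l// divr_ge0 ?mulr_ge0// ltW.
rewrite le_eqVlt; apply/orP; left; apply/eqP; field.
by rewrite (gt_eqF J0).
Qed.

Definition coord_jet i s x : R :=
  match s with [::] => x 0 i | [:: j] => (i == j)%:R | _ => 0 end.

Lemma jet_coord i : jet (coord_jet i).
Proof.
move=> [|j [|k s]] l x /=; last exact: ddx_cst.
  apply/ddx0_slice.
  have -> : (fun r => (x + r *: unitv R l) 0 i : R^o) = (fun r => x 0 i + (i == l)%:R * r).
    by apply/funext => r; rewrite !mxE eqxx/= mulrC.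
  have := @is_deriveD _ _ _ _ _ _ _ _ _ (is_derive_cst (x 0 i : R^o) (0 : R) (1 : R^o))
    (@is_deriveZ R _ R^o id (i == l)%:R 0 1 1 (is_derive_id _ _)).
  by rewrite add0r [_ *: _]mulr1.
exact: ddx_cst.
Qed.

Lemma smooth_coord i : smooth_real (fun x : 'rV[R]_N => x 0 i).
Proof.
apply: (jet_smooth (@jet_coord i)) => -[|j [|k s]].
- exact: continuous_coord.
- exact: cst_continuous.
- exact: cst_continuous.
Qed.

Lemma wbr_coord i : exists m0 C, 0 <= m0 /\ forall m, 0 <= m ->
  wbr m (- m0) C (fun x : 'rV[R]_N => x 0 i).
Proof.
have [m0 [C [m00 C0 hC]]] := w_poly hw 1.
exists m0, C; split => // m mge0 s x.
rewrite (jet_iter s (@jet_coord i)).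
have e0 := enorm_ge0 x.
apply: (@le_trans _ _ ((1 + enorm x) ^+ 1 * expR (- m0 * w (enorm x)) * 1)).
  apply: ler_pM; rewrite ?mulr_ge0 ?expR_ge0 ?J_ge0 ?J_le1//.
  rewrite ler_wpM2r ?expR_ge0// expr1.
  have := coord_le_enorm x i.
  case: s => [|j [|k s]] /=; rewrite ?normr0; try lra.
  by case: (i == j); rewrite ?normr1 ?normr0; lra.
rewrite mulr1 mulNr expRN ler_pdivrMr ?expR_gt0//.
exact: hC.
Qed.

Lemma SBrM u v : SBr u -> SBr v -> SBr (fun x => u x * v x).
Proof.
move=> su sv; split; first by apply: smoothM; [case: su|case: sv].
move=> m m0; have [m' [C [m'0 C0 hC]]] := wbrM m0.
have [c _ hc] := SBr_wbr m su m'0; have [c' _ hc'] := SBr_wbr 0 sv m'0.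
exists (C * (c * c')); rewrite -[X in wbr _ X]addr0.
by apply: hC => //; [case: su|case: sv].
Qed.

Lemma SBr_mulcoord u i : SBr u -> SBr (fun x => x 0 i * u x).
Proof.
move=> su; split; first by apply: smoothM; [exact: smooth_coord|case: su].
move=> m m0; have [m' [C [m'0 C0 hC]]] := wbrM m0.
have [k [c [k0 hc]]] := wbr_coord i; have [c' _ hc'] := SBr_wbr (m + k) su m'0.
exists (C * (c * c')); rewrite [X in wbr _ X](_ : m = - k + (m + k)); last by ring.
by apply: hC => //; [exact: smooth_coord|case: su|exact: hc].
Qed.

End WeightedClasses.

(** * Fourier transform of weighted classes *)

Section FourierDecay.
Variables (R : realType) (N : nat) (w : R -> R).
Hypotheses (hN : (0 < N)%N) (hw : nqa_weight w).
Implicit Types (u v : 'rV[R]_N -> R) (x y xi : 'rV[R]_N) (s : seq 'I_N).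

Definition mul_coords s u : 'rV[R]_N -> R := foldr (fun i v x => x 0 i * v x) u s.

Lemma SBr_mul_coords s u : SBr w u -> SBr w (mul_coords s u).
Proof. by move=> su; elim: s => [//|i s IH] /=; exact: SBr_mulcoord. Qed.

Lemma SBr_Dec u : SBr w u -> exists A, Dec u A.
Proof. by move=> /(SBr_RD hw)/(RD_Dec hw). Qed.

Lemma jet_CT u th : SBr w u ->
  jet (fun s xi => CT (mul_coords s u) (th + (size s)%:R * (pi / 2)) xi).
Proof.
move=> su s i xi.
have [A hA] := SBr_Dec (SBr_mul_coords s su).
have [A1 hA1] := SBr_Dec (SBr_mul_coords (i :: s) su).
have [A2 hA2] := SBr_Dec (SBr_mul_coords (i :: i :: s) su).
have -> : th + (size (i :: s))%:R * (pi / 2) = th + (size s)%:R * (pi / 2) + pi / 2.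
  by rewrite /= -natr1; ring.
apply: (ddx_CT _ _ hA hA1 (A2 := A2)).
have -> : (fun x => x 0 i ^+ 2 * mul_coords s u x) = mul_coords (i :: i :: s) u; last exact: hA2.
by apply/funext => x /=; rewrite expr2 mulrA.
Qed.

Lemma smooth_CT u th : SBr w u -> smooth_real (CT u th).
Proof.
move=> su.
have -> : CT u th = CT (mul_coords [::] u) (th + (size (Nil 'I_N))%:R * (pi / 2)).
  by rewrite mul0r addr0.
apply: (smooth_of_bounded (jet_CT th su)) => s.
have [A hA] := SBr_Dec (SBr_mul_coords s su).
by exists (A * ckappa R ^+ N) => xi; exact: CT_bound.
Qed.

Lemma iter_CT u th s : SBr w u ->
  iter_partial s (CT u th) = CT (mul_coords s u) (th + (size s)%:R * (pi / 2)).
Proof.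
by move=> su; have := jet_iter s (jet_CT th su); rewrite /= mul0r addr0.
Qed.

Lemma CT_iter u s th xi : RD w u ->
  CT (iter_partial s u) (th + (size s)%:R * (pi / 2)) xi = (\prod_(i <- s) xi 0 i) * CT u th xi.
Proof.
move=> ru; elim: s => [|i s IH]; first by rewrite big_nil mul1r mul0r addr0.
have rs := RD_iter s ru; have rs' := RD_iter (i :: s) ru.
have [A hA] := RD_Dec hw rs; have [A' hA'] := RD_Dec hw rs'.
have [ss _] := rs.
rewrite (CT_partial _ _ (fun x => smooth_ddx i x ss) hA hA') big_cons -mulrA -IH.
congr (_ * CT _ _ _); rewrite /= -natr1; ring.
Qed.

(** The number [k] of derivatives depends on the frequency: all are taken along a coordinate with
    |xi| <= N |xi_i|, and [k] comes from [J_young] at [r = N |xi_i|]. [J_scale] absorbs [N ^+ k];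
    the surplus [m0] of [m] over [lam] pays for the factor [r] through [w_poly]. *)
Lemma CT_decay u lam : SBr w u -> 0 <= lam ->
  exists C, forall th xi, `|CT u th xi| * expR (lam * w (enorm xi)) <= C.
Proof.
move=> su lam0.
have [m0 [C1 [m00 C10 hC1]]] := w_poly hw 1.
have N1 : 1 <= N%:R :> R by rewrite ler1n.
have [L L1 hL] := J_scale hw N1.
pose m := lam + m0; have mge0 : 0 <= m by rewrite addr_ge0.
have [A hA] := SBr_Dec su.
have ru := SBr_RD hw su.
have [md [Cd [md0 Cd0 hCd]]] := decay_pk N hw.
have mL0 : 0 <= m * L by rewrite mulr_ge0//; lra.
have [c c0 hc] := SBr_wbr hw md su mL0.
have A0 := Dec_ge0 hA.
have ck0 : 0 <= ckappa R ^+ N.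
  have := CT_bound 0 0 (le_Dec _ hA : Dec u (A + 1)); rewrite lerDl => /(_ ler01).
  move=> /(le_trans (normr_ge0 _)); rewrite pmulr_rge0//; lra.
exists (A * ckappa R ^+ N + C1 * expR (m * L) * (Cd * c * ckappa R ^+ N)) => th xi.
have bA : `|CT u th xi| <= A * ckappa R ^+ N by exact: CT_bound.
have p0 : 0 <= C1 * expR (m * L) * (Cd * c * ckappa R ^+ N).
  by rewrite !mulr_ge0 ?expR_ge0// ltW.
have [i hi] := enorm_le_coord xi hN.
set r := N%:R * `|xi 0 i| in hi.
have e0 := enorm_ge0 xi.
(* For [r <= 1] the weight vanishes at [xi], and the plain bound on the transform suffices. *)
have [r1|r1] := leP r 1.
  rewrite (nqa_vanish hw e0); last exact: le_trans r1.
  by rewrite mulr0 expR0 mulr1; lra.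
have r0 : 0 < r by lra.
have [k hk] := J_young hw mge0 (ltW r1).
set X := `|CT u th xi| in bA *; have X0 : 0 <= X by exact: normr_ge0.
apply: (@le_trans _ _ (C1 * (X * r ^+ k * J w m k))).
  apply: (@le_trans _ _ (X * expR (lam * w r))).
    by rewrite ler_wpM2l// ler_expR ler_wpM2l// (nqa_nondecreasing hw).
  have : expR (lam * w r) <= C1 * (r ^+ k * J w m k).
    rewrite -(ler_pM2l r0).
    have -> : r * (C1 * (r ^+ k * J w m k)) = C1 * (r * (r ^+ k * J w m k)) by ring.
    apply: le_trans (ler_wpM2l (ltW C10) hk).
    rewrite /m mulrDl expRD.
    have := hC1 r (ltW r0); rewrite expr1 => hr.
    have -> : C1 * (expR (lam * w r) * expR (m0 * w r)) = (C1 * expR (m0 * w r)) * expR (lam * w r) by ring.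
    by rewrite ler_wpM2r ?expR_ge0//; lra.
  move=> /(ler_wpM2l X0); congr (_ <= _); ring.
have key : X * r ^+ k * J w m k <= expR (m * L) * (Cd * c * ckappa R ^+ N).
  have -> : X * r ^+ k * J w m k = X * `|xi 0 i| ^+ k * (N%:R ^+ k * J w m k) by rewrite /r exprMn; ring.
  apply: (@le_trans _ _ (X * `|xi 0 i| ^+ k * (expR (m * L) * J w (m * L) k))).
    by rewrite ler_wpM2l ?hL// mulr_ge0// exprn_ge0.
  have -> : X * `|xi 0 i| ^+ k * (expR (m * L) * J w (m * L) k) =
    expR (m * L) * (X * `|xi 0 i| ^+ k * J w (m * L) k) by ring.
  rewrite ler_wpM2l ?expR_ge0//.
  have -> : X * `|xi 0 i| ^+ k = `|CT (iter_partial (nseq k i) u) (th + (size (nseq k i))%:R * (pi / 2)) xi|.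
    rewrite CT_iter// normrM mulrC; congr (_ * _).
    by rewrite big_nseq iter_mulr_1 normrX.
  have [J0|J0] := eqVneq (J w (m * L) k) 0.
    by rewrite J0 mulr0 !mulr_ge0// ltW.
  have {}J0 : 0 < J w (m * L) k by rewrite lt_neqAle eq_sym J0 J_ge0.
  rewrite -ler_pdivlMr//.
  have -> : Cd * c * ckappa R ^+ N / J w (m * L) k = (Cd * (c / J w (m * L) k)) * ckappa R ^+ N by ring.
  apply: CT_bound; split.
    by apply: smooth_continuous; apply: smooth_iter; case: su.
  move=> x; apply: hCd (normr_ge0 _) _.
  by rewrite ler_pdivlMr//; have := hc (nseq k i) x; rewrite size_nseq.
apply: (@le_trans _ _ (C1 * (expR (m * L) * (Cd * c * ckappa R ^+ N)))).
  by rewrite ler_wpM2l// ltW.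
by rewrite [leLHS]mulrA lerDr mulr_ge0.
Qed.

(** Differentiation along [s] multiplies the transform by coordinates of [xi], a product of size at
    most |xi|^|s|, which [J_exp_le] trades for exp (m w). The surplus exponent [mk] provides the
    factors [kappa] required by [fourier_inversion_bound]. *)
Lemma global_bound u : RD w u ->
  (forall lam, 0 <= lam -> exists C, forall th xi, `|CT u th xi| * expR (lam * w (enorm xi)) <= C) ->
  forall m, 0 <= m -> exists2 C, 0 <= C & forall s x, `|iter_partial s u x| * J w m (size s) <= C.
Proof.
move=> ru hd m m0.
have [mk [Ck [mk0 Ck0 hCk]]] := prod_kappa_lower N hw 1.
have [|C hC] := hd (m + mk); first exact: addr_ge0.
have C0 : 0 <= C by apply: le_trans (hC 0 0); rewrite mulr_ge0 ?expR_ge0.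
exists (C * Ck * 8 ^+ N); first by rewrite !mulr_ge0 ?exprn_ge0// ltW.
move=> s x; set Js := J w m (size s).
have [J0|J0] := eqVneq Js 0; first by rewrite J0 mulr0 !mulr_ge0 ?exprn_ge0// ltW.
have {}J0 : 0 < Js by rewrite lt_neqAle eq_sym J0 J_ge0.
rewrite -ler_pdivlMr//.
have -> : C * Ck * 8 ^+ N / Js = (C * Ck / Js) * 8 ^+ N by ring.
have rs := RD_iter s ru; have [ss _] := rs.
have [A hA] := RD_Dec hw rs.
have /choice[A' hA'] : forall i : 'I_N, exists A', Dec (partial i (iter_partial s u)) A'.
  by move=> i; exact: (RD_Dec hw (RD_iter (i :: s) ru)).
have A'0 j : 0 <= A' j := Dec_ge0 (hA' j).
have sA' : 0 <= \sum_i A' i by exact: sumr_ge0.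
have A0 := Dec_ge0 hA.
apply: (@fourier_inversion_bound _ _ _ (fun i => partial i (iter_partial s u)) (\sum_i A' i + A)) => {x} [i x|i x||th xi].
- exact: smooth_ddx.
- have [_ /(_ x)] := hA' i; move=> /le_trans; apply; rewrite ler_wpM2r ?pk_ge0//.
  by rewrite (bigD1 i)//= -addrA lerDl addr_ge0// sumr_ge0.
- by apply: le_Dec hA; rewrite lerDr.
have := CT_iter s (th - (size s)%:R * (pi / 2)) xi ru; rewrite subrK => ->.
rewrite normrM normr_prod.
set X := `|CT _ _ _|; have X0 : 0 <= X by exact: normr_ge0.
have e0 := enorm_ge0 xi.
have pE : \prod_(i <- s) `|xi 0 i| <= enorm xi ^+ size s.
  rewrite (_ : enorm xi ^+ size s = \prod_(i <- s) enorm xi).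
    by apply: ler_prod => i _; rewrite normr_ge0 coord_le_enorm.
  by rewrite big_const_seq count_predT iter_mulr_1.
have jE := J_exp_le hw m (size s) e0; rewrite -/Js in jE.
have hX : X * expR ((m + mk) * w (enorm xi)) <= C by exact: hC.
rewrite -[leRHS]mulrA (mulrC _^-1) mulrA ler_pdivlMr//.
have P0 : 0 <= \prod_i kappa (xi 0 i) by apply: prodr_ge0 => i _; exact: kappa_ge0.
apply: (@le_trans _ _ (X * expR (m * w (enorm xi)))).
  rewrite mulrAC mulrC ler_wpM2l//; apply: le_trans jE.
  by rewrite ler_wpM2r// ltW.
have h1 : 1 <= Ck * expR (mk * w (enorm xi)) * \prod_i kappa (xi 0 i) := hCk xi.
apply: (@le_trans _ _ (X * expR (m * w (enorm xi)) * (Ck * expR (mk * w (enorm xi)) * \prod_i kappa (xi 0 i)))).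
  by rewrite ler_peMr// mulr_ge0 ?expR_ge0.
have -> : X * expR (m * w (enorm xi)) * (Ck * expR (mk * w (enorm xi)) * \prod_i kappa (xi 0 i)) =
  X * expR ((m + mk) * w (enorm xi)) * (Ck * \prod_i kappa (xi 0 i)).
  by rewrite mulrDl expRD; ring.
by rewrite -[leRHS]mulrA ler_wpM2r// mulr_ge0// ltW.
Qed.

Lemma enorm_outward x i (sg t : R) : 0 <= sg * x 0 i -> 0 <= t ->
  enorm x <= enorm (x + (sg * t) *: unitv R i).
Proof.
move=> sx t0; rewrite /enorm ler_wsqrtr//; apply: ler_sum => j _; rewrite !mxE eqxx/=.
have [->|_] := eqVneq j i; last by rewrite mulr0 addr0.
rewrite mulr1; nra.
Qed.

(* The half-line from [x] in the direction [sg * e_i], [sg] being the sign of [x 0 i],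
   only meets points of larger norm. *)
Lemma gorny_slice v i k x (A B : R) : smooth_real v -> 0 < A -> 0 < B ->
  (forall y, enorm x <= enorm y -> `|v y| <= A) ->
  (forall y, `|iter_partial (nseq (k + k) i) v y| <= B) ->
  `|iter_partial (nseq k i) v x| ^+ 2 <= (2 ^+ 20) ^+ k * (A * B).
Proof.
move=> sv A0 B0 hA hB.
pose sg : R := if 0 <= x 0 i then 1 else -1.
have sgx : 0 <= sg * x 0 i.
  by rewrite /sg; case: ifPn => [|]; rewrite ?mul1r// -ltNge => /ltW; rewrite mulN1r oppr_ge0.
have nsg : `|sg| = 1 by rewrite /sg; case: ifP; rewrite ?normrN normr1.
pose h j (t : R) := sg ^+ j * iter_partial (nseq j i) v (x + (sg * t) *: unitv R i).
have dh j t : is_derive t (1 : R^o) (h j : R -> R^o) (h j.+1 t).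
  have sj := smooth_iter (nseq j i) sv.
  have := smooth_ddx i (x + (sg * t) *: unitv R i) sj.
  move=> /ddx_slice d1.
  have d0 : is_derive t (1 : R^o) (fun t => sg * t : R^o) sg.
    have := @is_deriveZ R _ R^o id sg t 1 1 (is_derive_id _ _).
    by rewrite [_ *: _]mulr1.
  have := @is_derive1_comp R (fun r => iter_partial (nseq j i) v (x + r *: unitv R i)) (fun t => sg * t) t _ _ d1 d0.
  move=> /(@is_deriveZ R _ R^o _ (sg ^+ j)).
  set P := partial _ _ _ => d2.
  rewrite (_ : h j.+1 t = sg ^+ j *: (P * sg : R^o)); first exact: d2.
  have -> : h j.+1 t = sg ^+ j.+1 * P by [].
  by rewrite exprSr -mulrA (mulrC sg).
have := @gorny R k h A B A0 B0 dh _ _.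
rewrite {3}/h mulr0 scale0r addr0 exprMn.
have -> : sg ^+ k ^+ 2 = 1 by rewrite exprAC -[sg ^+ 2](real_normK (num_real _)) nsg !expr1n.
rewrite mul1r -[X in X <= _](real_normK (num_real _)); apply.
  by move=> t t0; rewrite /h expr0 mul1r; apply: hA; exact: enorm_outward.
by move=> t t0; rewrite /h normrM normrX nsg expr1n mul1r.
Qed.

Lemma le_of_sqr_le (a b : R) : 0 <= b -> a ^+ 2 <= b -> a <= 1 + b.
Proof. by move=> b0 ab; nra. Qed.

(** The coordinates of [l] are treated one at a time. [gorny_slice] bounds the square of the k-th
    derivative in the new direction by the weighted bound without that direction times the
    unweighted bound of order 2k. Because of the square, the former is needed with at least twice
    the weight. *)
Lemma gorny_weight (l : seq 'I_N) u : RD w u ->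
  (forall m, 0 <= m -> exists2 C, 0 <= C & forall s x, `|iter_partial s u x| * J w m (size s) <= C) ->
  forall m, 0 <= m -> exists2 C, 0 <= C & forall (al : multi_index N) x,
   let s := flatten [seq nseq (al i) i | i <- l] in
   `|iter_partial s u x| * expR (m * w (enorm x)) * J w m (size s) <= C.
Proof.
move=> ru hg; elim: l => [|i l IH] m m0.
  have [_ h] := ru; have [C hC] := h m [::] m0.
  exists C; first by apply: le_trans (hC 0); rewrite mulr_ge0 ?expR_ge0.
  move=> al x /=; apply: le_trans (hC x).
  by rewrite ler_piMr ?mulr_ge0 ?expR_ge0// J_le1.
have B1 : 1 <= 2 ^+ 20 :> R by apply: exprn_ege1; lra.
have [L L1 hL] := J_scale hw B1.
(* Three factors [J w m] merge by [J_split] into one of index [3 * m], and [L] absorbs the constant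
   [(2 ^+ 20) ^+ k] of [gorny]. *)
pose M := 3 * m * L.
have M0 : 0 <= M by rewrite /M !mulr_ge0//; lra.
have mM : m <= M by rewrite /M; nra.
have m2M : m + m <= M by rewrite /M; nra.
have [C1 C10 h1] := IH M M0.
have [C2 C20 h2] := hg M M0.
pose D := (C1 + 1) * (C2 + 1) * expR (3 * m * L).
have D0 : 0 <= D by rewrite /D !mulr_ge0 ?expR_ge0//; lra.
exists (1 + D); first lra.
move=> al x /=.
set s := flatten _; set k := al i; have -> : size (nseq k i ++ s) = (k + size s)%N by rewrite size_cat size_nseq.
set n := size s; rewrite iter_partial_cat.
set v := iter_partial s u; have sv : smooth_real v by apply: smooth_iter; case: ru.
set E := expR (m * w (enorm x)); have E0 : 0 < E := expR_gt0 _.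
set Jkn := J w m (k + n).
have [J0|J0] := eqVneq Jkn 0; first by rewrite J0 mulr0; lra.
have {}J0 : 0 < Jkn by rewrite lt_neqAle eq_sym J0 J_ge0.
have hJ : (2 ^+ 20) ^+ k * (Jkn * Jkn) <= J w M n * (expR (3 * m * L) * J w M (k + k + n)).
  have a1 : Jkn <= J w m k * J w m n by exact: J_superadd.
  have a2 : J w m k * J w m k * J w m n <= J w (m + m + m) (k + k + n).
    apply: le_trans (@J_split _ w _ _ _ _); apply: ler_wpM2r; rewrite ?J_ge0//.
    exact: J_split.
  have a3 : J w m k <= 1 by exact: J_le1.
  have a4 : J w m n <= J w M n by exact: le_J_m.
  have a5 : (2 ^+ 20) ^+ k * J w (m + m + m) (k + k + n) <= expR (3 * m * L) * J w M (k + k + n).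
    have -> : m + m + m = 3 * m by ring.
    apply: le_trans (hL (3 * m) (k + k + n)%N _); last by rewrite mulr_ge0.
    by rewrite ler_wpM2r ?J_ge0// ler_weXn2l// -addnA leq_addr.
  have b1 := J_ge0 w m k; have b2 := J_ge0 w m n; have b3 := J_ge0 w M n.
  apply: (@le_trans _ _ (J w M n * ((2 ^+ 20) ^+ k * J w (m + m + m) (k + k + n)))); last exact: ler_wpM2l.
  rewrite (mulrCA (J w M n)) ler_wpM2l ?exprn_ge0//.
  apply: (@le_trans _ _ (J w m n * (J w m k * J w m k * J w m n))).
    by rewrite [leRHS](_ : _ = J w m k * J w m n * (J w m k * J w m n)); [rewrite ler_pM// ltW|ring].
  by rewrite ler_pM// !mulr_ge0.
set c0 := (2 ^+ 20) ^+ k in hJ *; have c00 : 0 < c0 by rewrite !exprn_gt0.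
have JJ : 0 < J w M n * J w M (k + k + n).
  have : 0 < J w M n * (expR (3 * m * L) * J w M (k + k + n)).
    by apply: lt_le_trans hJ; rewrite !mulr_gt0.
  by rewrite mulrCA pmulr_rgt0 ?expR_gt0.
have Jn : 0 < J w M n by rewrite lt_neqAle J_ge0 eq_sym andbT; apply: contraTneq JJ => ->; rewrite mul0r ltxx.
have Jk : 0 < J w M (k + k + n) by rewrite -(pmulr_rgt0 _ Jn).
apply: le_of_sqr_le => //.
have hx : `|iter_partial (nseq k i) v x| ^+ 2 <=
    c0 * ((C1 + 1) / (expR (M * w (enorm x)) * J w M n) * ((C2 + 1) / J w M (k + k + n))).
  apply: gorny_slice => //.
  - by rewrite divr_gt0 ?mulr_gt0 ?expR_gt0//; lra.
  - by rewrite divr_gt0//; lra.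
  - move=> y xy; rewrite ler_pdivlMr ?mulr_gt0 ?expR_gt0//.
    apply: (@le_trans _ _ C1); last lra.
    apply: le_trans (h1 al y); rewrite -/s -/n -/v mulrA ler_wpM2r ?J_ge0// ler_wpM2l//.
    rewrite ler_expR ler_wpM2l//; apply: (nqa_nondecreasing hw) => //; exact: enorm_ge0.
  - move=> y; rewrite ler_pdivlMr//; apply: (@le_trans _ _ C2); last lra.
    have := h2 (nseq (k + k) i ++ s) y.
    by rewrite iter_partial_cat size_cat size_nseq.
set X := iter_partial _ v x in hx *.
rewrite !exprMn.
apply: (@le_trans _ _ (c0 * ((C1 + 1) / (expR (M * w (enorm x)) * J w M n) * ((C2 + 1) / J w M (k + k + n))) * E ^+ 2 * Jkn ^+ 2)).
  by rewrite ler_wpM2r ?exprn_ge0 ?(ltW J0)// ler_wpM2r ?exprn_ge0 ?(ltW E0).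
have EM : E ^+ 2 <= expR (M * w (enorm x)).
  by rewrite expr2 -expRD -mulrDl ler_expR ler_wpM2r// w_enorm_ge0.
set F := expR (M * w (enorm x)) in EM *; have F0 : 0 < F := expR_gt0 _.
have -> : c0 * ((C1 + 1) / (F * J w M n) * ((C2 + 1) / J w M (k + k + n))) * E ^+ 2 * Jkn ^+ 2 =
  (C1 + 1) * (C2 + 1) * ((E ^+ 2 / F) * ((c0 * (Jkn * Jkn)) / (J w M n * J w M (k + k + n)))).
  by field; rewrite !gt_eqF.
rewrite /D ler_wpM2l ?mulr_ge0//; try lra.
rewrite -[leRHS]mul1r; apply: ler_pM.
- by rewrite divr_ge0 ?exprn_ge0 ?ltW.
- by rewrite divr_ge0 ?mulr_ge0 ?J_ge0// ltW.
- by rewrite ler_pdivrMr// mul1r.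
- by rewrite ler_pdivrMr//; apply: le_trans hJ _; rewrite mulrCA.
Qed.

Lemma SBr_of_fourier_decay u : RD w u ->
  (forall lam, 0 <= lam -> exists C, forall th xi, `|CT u th xi| * expR (lam * w (enorm xi)) <= C) ->
  SBr w u.
Proof.
move=> ru hd; split; first by case: ru.
move=> m m0; have [C _ hC] := gorny_weight (enum 'I_N) ru (global_bound ru hd) m0.
exists C => s x; have [al pe] := perm_mseq s.
rewrite (iter_partial_perm (proj1 ru) pe) (perm_size pe).
exact: hC.
Qed.

End FourierDecay.

(** * Characterization of the space S *)

Section ComplexModulus.
Variable R : realType.
Implicit Types z : R[i].

Lemma cmodE z : cmod z = Num.sqrt (complex.Re z ^+ 2 + complex.Im z ^+ 2).
Proof. by case: z. Qed.

Lemma cmod_ge0 z : 0 <= cmod z. Proof. by rewrite cmodE sqrtr_ge0. Qed.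

Lemma Re_le_cmod z : `|complex.Re z| <= cmod z.
Proof. by rewrite cmodE -sqrtr_sqr ler_wsqrtr// lerDl sqr_ge0. Qed.

Lemma Im_le_cmod z : `|complex.Im z| <= cmod z.
Proof. by rewrite cmodE -sqrtr_sqr ler_wsqrtr// lerDr sqr_ge0. Qed.

Lemma cmod_le z : cmod z <= `|complex.Re z| + `|complex.Im z|.
Proof.
have p : 0 <= `|complex.Re z| + `|complex.Im z| by rewrite addr_ge0.
rewrite cmodE -(ger0_norm p) -sqrtr_sqr ler_wsqrtr//.
rewrite -(real_normK (num_real (complex.Re z))) -(real_normK (num_real (complex.Im z))).
by rewrite sqrrD lerD2r lerDl mulrn_wge0// mulr_ge0.
Qed.

Lemma cmodM (z z' : R[i]) : cmod (z * z') = cmod z * cmod z'.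
Proof. exact: ComplexField.Normc.normcM. Qed.

Lemma cmodD (z z' : R[i]) : cmod (z + z') <= cmod z + cmod z'.
Proof. exact: le_normcD. Qed.

Lemma cmodN z : cmod (- z) = cmod z.
Proof. exact: normcN. Qed.

Lemma cmod0 : cmod (0 : R[i]) = 0.
Proof. exact: ComplexField.Normc.normc0. Qed.

Lemma cmod_real (t : R) : cmod (Complex t 0) = `|t|.
Proof. by rewrite cmodE /= expr0n addr0 sqrtr_sqr. Qed.

Lemma cmodB (z z' : R[i]) : cmod (z - z') = cmod (z' - z).
Proof. by rewrite -cmodN opprB. Qed.

Lemma ltnormC z (e : R) : (`|z| < Complex e 0) = (cmod z < e).
Proof. by rewrite normc_def ltcE/= eqxx/= cmodE. Qed.

Lemma nbhs_complex (z : (R[i])^o) (A : set (R[i])^o) :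
  nbhs z A <-> exists2 e : R, 0 < e & forall y, cmod (z - y) < e -> A y.
Proof.
rewrite nbhs_ballP; split => [[[e e'] /= e0 h]|[e e0 h]].
  have := e0; rewrite ltcE/= => /andP[/eqP e'0 ep]; exists e => // y zy.
  by apply: h; rewrite -ball_normE/= e'0 ltnormC.
exists (Complex e 0) => /=; first by rewrite ltcE/= eqxx e0.
by move=> y; rewrite -ball_normE/= ltnormC; exact: h.
Qed.

End ComplexModulus.

Section SpaceCharacterization.
Variables (R : realType) (N : nat) (w : R -> R).
Hypotheses (hN : (0 < N)%N) (hw : nqa_weight w).
Implicit Types (f g : cfun R N) (u v : 'rV[R]_N -> R) (x y xi : 'rV[R]_N).

Definition SB f := SBr w (re_part f) /\ SBr w (im_part f).

Lemma CT_phase u A th xi : Dec u A ->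
  CT u th xi = cos th * CT u 0 xi - sin th * CT u (- (pi / 2)) xi.
Proof.
move=> hu; rewrite -mulNr /CT -(IntZ _ (Dec_phase 0 xi hu)).
rewrite -(IntZ _ (Dec_phase (- (pi / 2)) xi hu)).
rewrite -(IntD (DecZ _ (Dec_phase 0 xi hu)) (DecZ _ (Dec_phase (- (pi / 2)) xi hu))).
apply: eq_Int => x; rewrite cosD addr0.
have -> : cos (dotprod x xi - pi / 2) = sin (dotprod x xi) by rewrite -sinDpihalf subrK.
ring.
Qed.

Lemma CT_opp0 u xi : CT u 0 (- xi) = CT u 0 xi.
Proof. by apply: eq_Int => x; rewrite dotprodNr !addr0 cosN. Qed.

Lemma CT_opp_pihalf u A xi : Dec u A -> CT u (- (pi / 2)) (- xi) = - CT u (- (pi / 2)) xi.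
Proof.
move=> hu; rewrite -[RHS]mulN1r /CT -(IntZ _ (Dec_phase (- (pi / 2)) xi hu)).
apply: eq_Int => x; rewrite dotprodNr.
have cs t : cos (t - pi / 2) = sin t by rewrite -sinDpihalf subrK.
rewrite !cs sinN; ring.
Qed.

Lemma re_fourier f A B : Dec (re_part f) A -> Dec (im_part f) B ->
  re_part (fourier f) = (fun xi => CT (re_part f) 0 xi + CT (im_part f) (- (pi / 2)) xi).
Proof.
move=> ha hb; apply/funext => xi.
rewrite /CT -(IntD (Dec_phase 0 xi ha) (Dec_phase (- (pi / 2)) xi hb)).
apply: (@eq_Int _ _ (fun x => complex.Re (f x * cis (- dotprod x xi)))) => x; rewrite /re_part /im_part.
have -> : cos (dotprod x xi - pi / 2) = sin (dotprod x xi) by rewrite -sinDpihalf subrK.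
by case: (f x) => a b /=; rewrite cosN sinN addr0 mulrN opprK.
Qed.

Lemma im_fourier f A B : Dec (re_part f) A -> Dec (im_part f) B ->
  im_part (fourier f) = (fun xi => CT (im_part f) 0 xi + (-1) * CT (re_part f) (- (pi / 2)) xi).
Proof.
move=> ha hb; apply/funext => xi.
rewrite /CT -(IntZ _ (Dec_phase (- (pi / 2)) xi ha)).
rewrite -(IntD (Dec_phase 0 xi hb) (DecZ _ (Dec_phase (- (pi / 2)) xi ha))).
apply: (@eq_Int _ _ (fun x => complex.Im (f x * cis (- dotprod x xi)))) => x; rewrite /re_part /im_part.
have -> : cos (dotprod x xi - pi / 2) = sin (dotprod x xi) by rewrite -sinDpihalf subrK.
by case: (f x) => a b /=; rewrite cosN sinN addr0 mulrN addrC mulN1r.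
Qed.

Lemma weighted_supP lam (al : multi_index N) f : (weighted_sup w lam al f < +oo)%E <->
  exists C : R, forall x, expR (lam * w (enorm x)) * cmod (mderiv al f x) <= C.
Proof.
split=> [h|[C hC]].
  exists (fine (weighted_sup w lam al f)) => x.
  have le : ((expR (lam * w (enorm x)) * cmod (mderiv al f x))%:E <= weighted_sup w lam al f)%E.
    by apply: ereal_sup_ubound; exists x.
  rewrite -lee_fin fineK// fin_real// h andbT.
  by apply: lt_le_trans le; rewrite ltNyr.
apply: (@le_lt_trans _ _ C%:E); last exact: ltry.
by apply: ge_ereal_sup => _ [x _ <-]; rewrite lee_fin.
Qed.

Lemma RD_weighted_sup lam al f : 0 <= lam -> RD w (re_part f) -> RD w (im_part f) ->
  (weighted_sup w lam al f < +oo)%E.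
Proof.
move=> lam0 [_ ha] [_ hb]; apply/weighted_supP.
have [C hC] := ha lam (mseq al) lam0; have [D hD] := hb lam (mseq al) lam0.
exists (C + D) => x; apply: le_trans (lerD (hC x) (hD x)).
by rewrite -mulrDl mulrC ler_wpM2r ?expR_ge0//; exact: cmod_le.
Qed.

Lemma weighted_sup_RD f : smooth f ->
  (forall lam al, 0 < lam -> (weighted_sup w lam al f < +oo)%E) ->
  RD w (re_part f) /\ RD w (im_part f).
Proof.
move=> [sa sb] h.
have hh lam s : 0 <= lam -> exists C : R, forall x,
    expR (lam * w (enorm x)) * cmod (Complex (iter_partial s (re_part f) x) (iter_partial s (im_part f) x)) <= C.
  move=> lam0; have [al pe] := perm_mseq s.
  have /(h _ al)/weighted_supP[C hC] : 0 < lam + 1 by lra.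
  exists C => x; apply: le_trans (hC x).
  rewrite (iter_partial_perm sa pe) (iter_partial_perm sb pe).
  rewrite ler_wpM2r ?cmod_ge0// ler_expR ler_wpM2r ?w_enorm_ge0//; lra.
split; split => // lam s lam0; have [C hC] := hh lam s lam0; exists C => x;
  apply: le_trans (hC x); rewrite mulrC ler_wpM2l ?expR_ge0//.
- exact: Re_le_cmod (Complex _ _).
- exact: Im_le_cmod (Complex _ _).
Qed.

Lemma RD_CT u th : SBr w u -> RD w (CT u th).
Proof.
move=> su; split; first exact: (smooth_CT hw th su).
move=> lam s lam0; have [C hC] := CT_decay hN hw (SBr_mul_coords hw s su) lam0.
by exists C => xi; rewrite (iter_CT hw)//.
Qed.

Lemma RDD u v : RD w u -> RD w v -> RD w (u \+ v).
Proof.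
move=> [su hu] [sv hv]; split; first exact: smoothD.
move=> lam s lam0; have [C hC] := hu lam s lam0; have [D hD] := hv lam s lam0.
exists (C + D) => x; rewrite iterD//=; apply: le_trans (lerD (hC x) (hD x)).
by rewrite -mulrDl ler_wpM2r ?expR_ge0// ler_normD.
Qed.

Lemma RDZ u (k : R) : RD w u -> RD w (fun x => k * u x).
Proof.
move=> [su hu]; split; first exact: smoothZ.
move=> lam s lam0; have [C hC] := hu lam s lam0.
by exists (`|k| * C) => x; rewrite iterZ// normrM -mulrA ler_wpM2l.
Qed.

Lemma SB_S_space f : SB f -> S_space w f.
Proof.
move=> [ha hb]; have ra := SBr_RD hw ha; have rb := SBr_RD hw hb.
have [A hA] := RD_Dec hw ra; have [B hB] := RD_Dec hw rb.
have rF : RD w (re_part (fourier f)).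
  by rewrite (re_fourier hA hB); apply: RDD; exact: RD_CT.
have iF : RD w (im_part (fourier f)).
  by rewrite (im_fourier hA hB); apply: RDD; [|apply: RDZ]; exact: RD_CT.
split.
- by split; [exact: integrable_Dec hA|exact: integrable_Dec hB].
- by split; [case: ra|case: rb].
- by split; [case: rF|case: iF].
- by move=> lam al lam0; split; apply: RD_weighted_sup => //; exact: ltW.
Qed.

(** The transforms of the real and imaginary parts of [f] are mixed in [fourier f]. Those with phase
    0 are even in [xi] and those with phase - pi / 2 are odd, so the values at [xi] and [- xi]
    separate them; [CT_phase] then yields every phase. *)
Lemma S_space_SB f : S_space w f -> SB f.
Proof.
move=> [_ sf sF h].
have [ra rb] := weighted_sup_RD sf (fun lam al lam0 => proj1 (h lam al lam0)).
have [rF iF] := weighted_sup_RD sF (fun lam al lam0 => proj2 (h lam al lam0)).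
have [A hA] := RD_Dec hw ra; have [B hB] := RD_Dec hw rb.
suff : forall lam, 0 <= lam -> exists C, forall xi,
    [/\ `|CT (re_part f) 0 xi| * expR (lam * w (enorm xi)) <= C,
        `|CT (re_part f) (- (pi / 2)) xi| * expR (lam * w (enorm xi)) <= C,
        `|CT (im_part f) 0 xi| * expR (lam * w (enorm xi)) <= C &
        `|CT (im_part f) (- (pi / 2)) xi| * expR (lam * w (enorm xi)) <= C].
  move=> dec.
  have phase u D lam C (hu : Dec u D) : (forall xi,
      `|CT u 0 xi| * expR (lam * w (enorm xi)) <= C /\
      `|CT u (- (pi / 2)) xi| * expR (lam * w (enorm xi)) <= C) ->
      forall th xi, `|CT u th xi| * expR (lam * w (enorm xi)) <= C + C.
    move=> hC th xi; have [h1 h2] := hC xi.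
    apply: le_trans (lerD h1 h2); rewrite -mulrDl ler_wpM2r ?expR_ge0//.
    rewrite (CT_phase _ _ hu) (le_trans (ler_normB _ _))// !normrM.
    by rewrite lerD// ler_piMl// ?norm_cos ?norm_sin.
  split; apply: (SBr_of_fourier_decay hw) => // lam /dec[C hC]; exists (C + C).
    by apply: phase hA _ => xi; have [] := hC xi.
  by apply: phase hB _ => xi; have [] := hC xi.
move=> lam lam0.
have [C hC] := (proj2 rF) lam [::] lam0; have [D hD] := (proj2 iF) lam [::] lam0.
exists (C + D) => xi.
move: (hC xi) (hC (- xi)) (hD xi) (hD (- xi)); rewrite /= enormN.
rewrite (re_fourier hA hB) (im_fourier hA hB).
rewrite !CT_opp0 (CT_opp_pihalf _ hA) (CT_opp_pihalf _ hB).
set E := expR _; have E0 : 0 < E := expR_gt0 _.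
set a := CT _ 0 _; set b' := CT _ _ xi; set b := CT _ 0 xi; set a' := CT _ _ xi.
rewrite -!ler_pdivlMr//.
have DE : (C + D) / E = C / E + D / E by rewrite mulrDl.
rewrite DE; set c := C / E; set d := D / E.
rewrite !ler_norml => /andP[h1 h2] /andP[h3 h4] /andP[h5 h6] /andP[h7 h8].
by split; apply/andP; split; lra.
Qed.

End SpaceCharacterization.

(** * Translations *)

Section Translations.
Variables (R : realType) (N : nat) (w : R -> R).
Hypotheses (hN : (0 < N)%N) (hw : nqa_weight w).
Implicit Types (u v : 'rV[R]_N -> R) (x y : 'rV[R]_N) (s : seq 'I_N).

Lemma smooth_refl u x : smooth_real u -> smooth_real (fun y => u (x - y)).
Proof.
move=> su; have := smooth_affine x (-1) su.
by rewrite (_ : (fun y => u (x + -1 *: y)) = (fun y => u (x - y)))//; apply/funext => y; rewrite scaleN1r.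
Qed.

Lemma iter_refl s u x : smooth_real u ->
  iter_partial s (fun y => u (x - y)) = (fun y => (-1) ^+ size s * iter_partial s u (x - y)).
Proof.
move=> su; have := iter_affine s x (-1) su.
rewrite (_ : (fun y => u (x + -1 *: y)) = (fun y => u (x - y))); last first.
  by apply/funext => y; rewrite scaleN1r.
by move=> ->; apply/funext => y; rewrite scaleN1r.
Qed.

Lemma smooth_shift u x : smooth_real u -> smooth_real (fun y => u (y + x)).
Proof.
move=> su; have := smooth_affine x 1 su.
by rewrite (_ : (fun y => u (x + 1 *: y)) = (fun y => u (y + x)))//; apply/funext => y; rewrite scale1r addrC.
Qed.

Lemma iter_shift s u x : smooth_real u ->
  iter_partial s (fun y => u (y + x)) = (fun y => iter_partial s u (y + x)).
Proof.
move=> su; have := iter_affine s x 1 su.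
rewrite (_ : (fun y => u (x + 1 *: y)) = (fun y => u (y + x))); last first.
  by apply/funext => y; rewrite scale1r addrC.
by move=> ->; apply/funext => y; rewrite scale1r addrC expr1n mul1r.
Qed.

Lemma expR_w_add : exists2 K, 1 <= K & forall a x y, 0 <= a ->
  expR (a * w (enorm (x + y : 'rV[R]_N))) <=
  expR (a * K * (1 + w (enorm x))) * expR (a * K * w (enorm y)).
Proof.
have [K K1 hK] := w_enorm_add hN hw; exists K => // a x y a0.
by rewrite -expRD -mulrDr ler_expR -mulrA ler_wpM2l.
Qed.

Lemma wbr_refl : exists2 K, 1 <= K & forall m a c u x, 0 <= a -> smooth_real u ->
  wbr w m (a * K) c u ->
  wbr w m a (expR (a * K * (1 + w (enorm x))) * c) (fun y => u (x - y)).
Proof.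
have [K K1 hK] := expR_w_add; exists K => // m a c u x a0 su h s y.
rewrite iter_refl// normrM normrX normrN1 expr1n mul1r.
have := hK a x (y - x) a0; rewrite addrC subrK -(enormN (y - x)) opprB => he.
have := h s (x - y); set X := `|_|; set Js := J _ _ _; set e1 := expR _; set e2 := expR (_ * (1 + _)).
move=> hc; apply: (@le_trans _ _ (e2 * (X * e1 * Js))); last by rewrite ler_wpM2l ?expR_ge0.
have -> : e2 * (X * e1 * Js) = X * (e2 * e1) * Js by ring.
by rewrite ler_wpM2r ?J_ge0// ler_wpM2l// /X.
Qed.

(** Differentiation commutes with taking the Taylor remainder of a translation, so [quad_bound]
    applies to each derivative. A functional continuous for these norms therefore sees a remainder
    of order [h ^+ 2]. *)
Lemma wbr_quad_remainder u i m a : SBr w u -> 0 <= m -> 0 <= a ->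
  exists2 C, 0 <= C & forall h, `|h| <= 1 -> wbr w m a (C * h ^+ 2)
    ((fun z => u (z + h *: unitv R i)) \+
     ((fun z => -1 * u z) \+ (fun z => (- h) * partial i u z))).
Proof.
move=> su m0 a0; have [smu _] := su.
have [K K1 hK] := expR_w_add.
have aK0 : 0 <= a * K by rewrite mulr_ge0//; lra.
have [c c0 hc] := SBr_wbr hw (a * K) (SBr_iter hw [:: i; i] su) m0.
exists (expR (a * K) * c); first by rewrite mulr_ge0 ?expR_ge0.
move=> h h1 s z.
have spu : smooth_real (partial i u) by exact: (smooth_iter [:: i] smu).
rewrite !iterD; [|exact: smoothZ|exact: smoothZ|exact: smooth_shift|by apply: smoothD; exact: smoothZ].
rewrite iter_shift// iterZ// iterZ//=.
rewrite -[partial i u]/(iter_partial [:: i] u) -iter_partial_cat.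
have -> : iter_partial (s ++ [:: i]) u = iter_partial (i :: s) u.
  by apply: iter_partial_perm => //; rewrite perm_catC.
rewrite mulN1r mulNr addrA.
set Js := J w m (size s).
have [J0|J0] := eqVneq Js 0; first by rewrite J0 mulr0 mulr_ge0 ?sqr_ge0// mulr_ge0 ?expR_ge0.
have {}J0 : 0 < Js by rewrite lt_neqAle eq_sym J0 J_ge0.
set E := expR (a * w (enorm z)); have E0 : 0 < E := expR_gt0 _.
rewrite -!ler_pdivlMr//.
have -> : expR (a * K) * c * h ^+ 2 / Js / E = expR (a * K) * c / Js / E * h ^+ 2 by ring.
have ss := smooth_iter s smu; have ss' := smooth_iter (i :: s) smu.
apply: (@quad_bound _ _ i _ (partial i (iter_partial s u)) (partial i (iter_partial (i :: s) u))) => [y|y|t ht].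
- exact: smooth_ddx.
- exact: smooth_ddx.
rewrite !ler_pdivlMr//.
have := hc s (z + t *: unitv R i); rewrite -iter_partial_cat.
have -> : iter_partial (s ++ [:: i; i]) u = partial i (iter_partial (i :: s) u).
  by apply: (@iter_partial_perm _ _ (s ++ [:: i; i]) [:: i, i & s]) => //; rewrite perm_catC.
rewrite -/Js; set X := `|_| => hX.
have := hK a (- (t *: unitv R i)) (z + t *: unitv R i) a0.
(* The displacement has norm at most 1, where the weight vanishes; the constant is thus independent
   of [h]. *)
have v0 : w (enorm (t *: unitv R i)) = 0.
  apply: (nqa_vanish hw (enorm_ge0 _)).
  by apply: (le_trans (enorm_unitv i t)); exact: le_trans h1.
rewrite addrC addrK enormN v0 addr0 mulr1 -/E => hE.
apply: (@le_trans _ _ (expR (a * K) * (X * expR (a * K * w (enorm (z + t *: unitv R i))) * Js))); last first.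
  by rewrite ler_wpM2l ?expR_ge0.
rewrite (_ : expR (a * K) * _ = X * (expR (a * K) * expR (a * K * w (enorm (z + t *: unitv R i)))) * Js); last by ring.
by rewrite ler_wpM2r ?(ltW J0)// ler_wpM2l// /X.
Qed.

End Translations.

(** * Complex-valued classes and the norms of the two spaces *)

Section ComplexClasses.
Variables (R : realType) (N : nat) (w : R -> R).
Hypotheses (hN : (0 < N)%N) (hw : nqa_weight w).
Implicit Types (f g : cfun R N) (x y : 'rV[R]_N) (s : seq 'I_N) (z : R[i]).

Definition wb (m a c : R) f := wbr w m a c (re_part f) /\ wbr w m a c (im_part f).

Definition cder s f : cfun R N :=
  fun x => Complex (iter_partial s (re_part f) x) (iter_partial s (im_part f) x).

Definition refl x f : cfun R N := fun y => f (x - y).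

Lemma re_lin z f g : re_part (z *: f + g) =
  ((fun x => complex.Re z * re_part f x) \+ (fun x => - complex.Im z * im_part f x)) \+ re_part g.
Proof.
apply/funext => x; rewrite /re_part /im_part /=.
have -> : (z *: f + g) x = z * f x + g x by [].
by case: z (f x) (g x) => a b [c d] [k l] /=; rewrite mulNr.
Qed.

Lemma im_lin z f g : im_part (z *: f + g) =
  ((fun x => complex.Re z * im_part f x) \+ (fun x => complex.Im z * re_part f x)) \+ im_part g.
Proof.
apply/funext => x; rewrite /re_part /im_part /=.
have -> : (z *: f + g) x = z * f x + g x by [].
by case: z (f x) (g x) => a b [c d] [k l] /=.
Qed.

Lemma smooth_lin z f g : smooth f -> smooth g -> smooth (z *: f + g).
Proof.
move=> [a b] [c d]; split; rewrite ?re_lin ?im_lin; apply: smoothD => //; apply: smoothD; exact: smoothZ.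
Qed.

Lemma wb_lin m a c c' z f g : smooth f -> smooth g -> wb m a c f -> wb m a c' g ->
  wb m a ((`|complex.Re z| + `|complex.Im z|) * c + c') (z *: f + g).
Proof.
move=> [sa sb] [sc sd] [ha hb] [hc hd]; rewrite mulrDl; split; rewrite ?re_lin ?im_lin.
  apply: wbrD => //; first by apply: smoothD; exact: smoothZ.
  by apply: wbrD; rewrite -1?[`|complex.Im z|]normrN; [exact: smoothZ|exact: smoothZ|exact: wbrZ|exact: wbrZ].
apply: wbrD => //; first by apply: smoothD; exact: smoothZ.
by apply: wbrD; [exact: smoothZ|exact: smoothZ|exact: wbrZ|exact: wbrZ].
Qed.

Lemma SB_lin z f g : SB w f -> SB w g -> SB w (z *: f + g).
Proof.
by move=> [a b] [c d]; split; rewrite ?re_lin ?im_lin; apply: SBrD => //; apply: SBrD; exact: SBrZ.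
Qed.

Lemma SB_smooth f : SB w f -> smooth f.
Proof. by move=> [[a _] [b _]]. Qed.

Lemma SB_wb f m a : SB w f -> 0 <= m -> exists2 c, 0 <= c & wb m a c f.
Proof.
move=> [ha hb] m0; have [c c0 hc] := SBr_wbr hw a ha m0; have [d d0 hd] := SBr_wbr hw a hb m0.
exists (c + d); first exact: addr_ge0.
by split; [apply: le_wbr hc; rewrite lerDl|apply: le_wbr hd; rewrite lerDr].
Qed.

Lemma wb_ge0 m a c f : wb m a c f -> 0 <= c.
Proof. by move=> [/wbr_ge0]. Qed.

Lemma wb_mono m m' a a' c f : m <= m' -> a <= a' -> wb m' a' c f -> wb m a c f.
Proof. by move=> mm aa [h h']; split; apply: wbr_mono mm aa _. Qed.

Lemma le_wb m a c c' f : c <= c' -> wb m a c f -> wb m a c' f.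
Proof. by move=> cc [h h']; split; apply: le_wbr cc _. Qed.

Lemma SBr0 : SBr w (fun _ : 'rV[R]_N => 0).
Proof.
have j0 : jet (fun (_ : seq 'I_N) (_ : 'rV[R]_N) => 0 : R) by move=> s i x; exact: ddx_cst.
split; first by apply: (jet_smooth j0) => s; exact: cst_continuous.
by move=> m m0; exists 0 => s x; rewrite (jet_iter s j0) normr0 !mul0r.
Qed.

Lemma SB0 : SB w (0 : cfun R N). Proof. by split; exact: SBr0. Qed.

Lemma wb0 m a : wb m a 0 (0 : cfun R N).
Proof.
have j0 : jet (fun (_ : seq 'I_N) (_ : 'rV[R]_N) => 0 : R) by move=> s i x; exact: ddx_cst.
suff aux : wbr w m a 0 (fun _ : 'rV[R]_N => 0 : R) by split.
by move=> s x; rewrite (jet_iter s j0) normr0 !mul0r.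
Qed.

Lemma SB_cder s f : SB w f -> SB w (cder s f).
Proof. by move=> [a b]; split; exact: SBr_iter. Qed.

Lemma SB_of_smooth f : smooth f ->
  (forall m, 0 <= m -> exists c, wb m m c f) -> SB w f.
Proof. by move=> [a b] h; split; split => // m m0; have [c [h1 h2]] := h m m0; exists c. Qed.

Lemma wb_cder s f m m' a c : 0 < J w m' (size s) -> smooth f ->
  wb (m + m') a c f -> wb m a (c / J w m' (size s)) (cder s f).
Proof.
move=> Jp sf [ha hb].
suff aux u : smooth_real u -> wbr w (m + m') a c u -> wbr w m a (c / J w m' (size s)) (iter_partial s u).
  by split; apply: aux => //; case: sf.
move=> su hu s' x; rewrite -iter_partial_cat ler_pdivlMr//; apply: le_trans (hu (s' ++ s) x).
rewrite -[leLHS]mulrA ler_wpM2l ?mulr_ge0 ?expR_ge0// size_cat.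
exact: J_split.
Qed.

Lemma wb_refl : exists2 K, 1 <= K & forall m a c f x, 0 <= a -> smooth f ->
  wb m (a * K) c f -> wb m a (expR (a * K * (1 + w (enorm x))) * c) (refl x f).
Proof.
have [K K1 hK] := wbr_refl hN hw; exists K => // m a c f x a0 [sa sb] [ha hb].
by split; [exact: (hK m a c (re_part f) x a0 sa ha)|exact: (hK m a c (im_part f) x a0 sb hb)].
Qed.

Lemma smooth_refl_cfun f x : smooth f -> smooth (refl x f).
Proof. by move=> [sa sb]; split; [exact: (smooth_refl x sa)|exact: (smooth_refl x sb)]. Qed.

Lemma SB_refl x f : SB w f -> SB w (refl x f).
Proof.
move=> sf; apply: SB_of_smooth; first by apply: smooth_refl_cfun; exact: SB_smooth.
move=> m m0; have [K K1 hK] := wb_refl; have [c _ hc] := SB_wb (m * K) sf m0.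
by eexists; apply: hK m0 (SB_smooth sf) hc.
Qed.

(** A common form of [q_norm], with [a = m], and [r_norm], with [a = - n], so that both comparisons
    with [wb] are proved once. *)
Definition gnorm (a : R) (m : nat) f : \bar R :=
  ereal_sup (range (fun al : multi_index N =>
    ereal_sup (range (fun x : 'rV[R]_N =>
      ((cmod (mderiv al f x))%:E *
       expeR ((a * w (enorm x))%:E - m%:R%:E * young_conj w ((mlen al)%:R / m%:R)))%E)))).

Lemma r_normE m (n : nat) f : r_norm w m n%:Z f = gnorm (- n%:R) m f. Proof. by []. Qed.

Lemma gnorm_le a m c f : (0 < m)%N -> wb m%:R a c f -> (gnorm a m f <= (c + c)%:E)%E.
Proof.
move=> m0 [ha hb]; have mR : 0 < m%:R :> R by rewrite ltr0n.
apply: ge_ereal_sup => _ [al _ <-]; apply: ge_ereal_sup => _ [x _ <-].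
rewrite young_conjE// -EFinM lee_fin mulrA.
have h1 := ha (mseq al) x; have h2 := hb (mseq al) x; rewrite size_mseq in h1 h2.
apply: le_trans (lerD h1 h2); rewrite -!mulrDl ler_wpM2r ?J_ge0// ler_wpM2r ?expR_ge0//.
exact: cmod_le.
Qed.

Lemma gnorm_ge a m c f : (0 < m)%N -> smooth f -> (gnorm a m f <= c%:E)%E -> wb m%:R a c f.
Proof.
move=> m0 [sa sb] h; have mR : 0 < m%:R :> R by rewrite ltr0n.
have key s x : cmod (cder s f x) * expR (a * w (enorm x)) * J w m%:R (size s) <= c.
  have [al pe] := perm_mseq s.
  rewrite /cder (iter_partial_perm sa pe) (iter_partial_perm sb pe) (perm_size pe) size_mseq.
  rewrite -lee_fin; apply: le_trans h; rewrite -mulrA EFinM -young_conjE//.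
  apply: ereal_sup_ge; exists (ereal_sup (range (fun x : 'rV[R]_N =>
      ((cmod (mderiv al f x))%:E *
       expeR ((a * w (enorm x))%:E - m%:R%:E * young_conj w ((mlen al)%:R / m%:R)))%E))).
    by exists al.
  by apply: ereal_sup_ubound; exists x.
split=> s x; apply: le_trans (key s x).
  by rewrite ler_wpM2r ?J_ge0// ler_wpM2r ?expR_ge0//; exact: Re_le_cmod (cder s f x).
by rewrite ler_wpM2r ?J_ge0// ler_wpM2r ?expR_ge0//; exact: Im_le_cmod (cder s f x).
Qed.

Lemma O_spaceP m (n : nat) f : (0 < m)%N -> O_space w m n%:Z f <->
  smooth f /\ exists c, wb m%:R (- n%:R) c f.
Proof.
move=> m0; split=> -[sf h]; split => //.
  rewrite r_normE in h; exists (fine (gnorm (- n%:R) m f)); apply: gnorm_ge => //.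
  rewrite fineK// ge0_fin_numE//; apply: ereal_sup_ge.
  exists (ereal_sup (range (fun x : 'rV[R]_N =>
      ((cmod (mderiv [ffun=> 0%N] f x))%:E *
       expeR ((- n%:R * w (enorm x))%:E - m%:R%:E * young_conj w ((mlen ([ffun=> 0%N] : multi_index N))%:R / m%:R)))%E))).
    by exists [ffun=> 0%N].
  apply: ereal_sup_ge; eexists; first by exists 0.
  by rewrite mule_ge0 ?expeR_ge0// lee_fin cmod_ge0.
by have [c hc] := h; apply: (le_lt_trans (gnorm_le m0 hc)); exact: ltry.
Qed.

Lemma O_projP (n : nat) f : O_proj w n%:Z f <->
  smooth f /\ forall m, 0 <= m -> exists c, wb m (- n%:R) c f.
Proof.
split=> [h|[sf h] m m0].
  split; first by have [] := h 1%N isT.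
  move=> m m0; have [k hk] : exists k : nat, m <= k%:R.
    by exists (Num.trunc m).+1; apply/ltW/Num.Theory.truncnS_gt.
  have /(O_spaceP n f (ltn0Sn k))[_ [c hc]] := h k.+1 isT.
  by exists c; apply: wb_mono hc => //; apply: le_trans hk _; rewrite ler_nat.
by apply/O_spaceP => //; split => //; apply: h.
Qed.

End ComplexClasses.

(** * Convolution *)

Section LinearFunctionals.
Variables (R : realType) (N : nat) (w : R -> R).
Hypotheses (hN : (0 < N)%N) (hw : nqa_weight w).
Implicit Types (f g : cfun R N) (E : set (cfun R N)) (T : cfun R N -> (R[i])^o).
Implicit Types (x y : 'rV[R]_N) (s : seq 'I_N).

Lemma linear_on0 E T : linear_on E T -> E 0 -> T 0 = 0.
Proof.
move=> lT E0; have := lT 1 0 0 E0 E0; rewrite scaler0 add0r scale1r.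
by rewrite -{1}[T 0]addr0 => /addrI <-.
Qed.

Lemma linear_onZ E T (z : R[i]) f : linear_on E T -> E 0 -> E f -> T (z *: f) = z * T f.
Proof.
move=> lT E0 Ef; have := lT z f 0 Ef E0.
by rewrite addr0 (linear_on0 lT E0) addr0.
Qed.

Lemma wb_scale m a c (z : R[i]) f : smooth f -> wb w m a c f ->
  wb w m a ((`|complex.Re z| + `|complex.Im z|) * c) (z *: f).
Proof.
move=> sf h; rewrite -[z *: f]addr0 -[_ * c]addr0; apply: wb_lin => //.
  by apply: (@SB_smooth R N w); exact: SB0.
exact: wb0.
Qed.

(** Continuity at 0 as one seminorm inequality. The exponent [al m] is [m] for the space S and
    constantly [- n] for a step of the inductive limit. *)
Lemma norms_bound E (al : nat -> R) T :
  (forall m m', (m <= m')%N -> al m <= al m') -> (forall f, E f -> smooth f) ->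
  (forall (t : R) f, E f -> E (Complex t 0 *: f)) ->
  (forall (t : R) f, E f -> T (Complex t 0 *: f) = Complex t 0 * T f) ->
  norms_nbhs E (fun m => gnorm w (al m) m) 0 [set f | cmod (T f) < 1] ->
  exists M, (0 < M)%N /\ exists2 C, 0 <= C &
    forall f c, E f -> wb w M%:R (al M) c f -> cmod (T f) <= C * c.
Proof.
move=> al_mono Es EZ TZ [F [e [e0 hF]]].
pose M := (\max_(m <- F) m).+1; exists M; split => //.
exists (4 / e); first by rewrite divr_ge0// ltW.
move=> f c Ef hf; have c0 := wb_ge0 hf.
apply/ler_addgt0Pr => d d0.
(* [c] may be 0, so [f] is normalized by a slightly larger [c'], whose excess contributes exactly
   [d] to the final bound. The target [e / 4] leaves room for the factor 2 lost in [gnorm_le] and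
   for the strict inequality. *)
pose c' := c + d * e / 4; have c'0 : 0 < c' by rewrite ltr_wpDl// divr_gt0// mulr_gt0.
pose t := e / (4 * c'); have t0 : 0 < t by rewrite divr_gt0// mulr_gt0.
have : cmod (T (Complex t 0 *: f)) < 1.
  apply: hF; first exact: EZ.
  move=> m mF m0; rewrite subr0.
  have mM : (m <= M)%N by apply: leqW; exact: leq_bigmax_seq.
  have h : wb w m%:R (al m) (e / 4) (Complex t 0 *: f).
    apply: (@wb_mono _ _ _ hw _ M%:R _ (al M)); rewrite ?ler_nat ?al_mono//.
    apply: (@le_wb _ _ _ _ _ ((`|t| + `|0|) * c)); last by apply: wb_scale hf; exact: Es.
    rewrite normr0 addr0 gtr0_norm// /t.
    have -> : e / 4 = e / (4 * c') * c' by field; rewrite gt_eqF.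
    apply: ler_wpM2l; first exact: (ltW t0).
    by rewrite lerDl divr_ge0// mulr_ge0// ltW.
  apply: (le_lt_trans (gnorm_le m0 h)); rewrite lte_fin; lra.
rewrite TZ// cmodM cmod_real gtr0_norm// -ltr_pdivlMl// mulr1 => /ltW/le_trans; apply.
by rewrite /t invf_div /c' le_eqVlt; apply/orP; left; apply/eqP; field; rewrite gt_eqF.
Qed.

Lemma S_spaceP f : S_space w f <-> SB w f.
Proof. by split; [exact: S_space_SB|exact: SB_S_space]. Qed.

Lemma S_space0 : S_space w (0 : cfun R N). Proof. by apply/S_spaceP; exact: SB0. Qed.

Lemma near_cmod_lt1 (z : (R[i])^o) : z = 0 -> nbhs z [set y | cmod y < 1].
Proof. by move=> ->; apply/nbhs_complex; exists 1 => // y; rewrite sub0r cmodN. Qed.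

Lemma S_dual_bound T : S_dual w T -> exists M : nat, (0 < M)%N /\ exists2 C, 0 <= C &
  forall f c, SB w f -> wb w M%:R M%:R c f -> cmod (T f) <= C * c.
Proof.
move=> [lT cT].
have T0 := linear_on0 lT S_space0.
have := @norms_bound (S_space w) (fun m => m%:R) T _ _ _ _ _.
case.
- by move=> m m'; rewrite ler_nat.
- by move=> f /S_spaceP/SB_smooth.
- move=> t f Sf; rewrite -[_ *: _]addr0; apply/S_spaceP/SB_lin; [exact/S_spaceP|exact: SB0].
- by move=> t f Sf; apply: linear_onZ lT S_space0 Sf.
- exact: (cT _ S_space0 _ (near_cmod_lt1 T0)).
move=> M [M0 [C C0 h]]; exists M; split => //; exists C => // f c /S_spaceP; exact: h.
Qed.

Lemma SB_linear_on T : linear_on (S_space w) T ->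
  forall (z : R[i]) f g, SB w f -> SB w g -> T (z *: f + g) = z *: T f + T g.
Proof. by move=> lT z f g /S_spaceP Sf /S_spaceP Sg; exact: lT. Qed.

Lemma cder0 f : cder [::] f = f.
Proof. by apply/funext => x; rewrite /cder /= /re_part /im_part; case: (f x). Qed.

Definition remainder i (h : R) (u : 'rV[R]_N -> R) : 'rV[R]_N -> R :=
  (fun z => u (z + h *: unitv R i)) \+ ((fun z => -1 * u z) \+ (fun z => (- h) * partial i u z)).

Lemma smooth_remainder i h u : smooth_real u -> smooth_real (remainder i h u).
Proof.
move=> su; apply: smoothD; first exact: smooth_shift.
by apply: smoothD; apply: smoothZ => //; exact: (smooth_iter [:: i] su).
Qed.

Lemma refl_remainder f i x h :
  refl x (fun z => Complex (remainder i h (re_part f) z) (remainder i h (im_part f) z)) =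
  Complex (-1) 0 *: refl x f + (Complex (- h) 0 *: refl x (cder [:: i] f) +
    refl (x + h *: unitv R i) f).
Proof.
apply/funext => y.
rewrite [RHS](_ : _ = Complex (-1) 0 * f (x - y) +
  (Complex (- h) 0 * cder [:: i] f (x - y) + f (x + h *: unitv R i - y)))//.
have -> : x + h *: unitv R i - y = x - y + h *: unitv R i by rewrite addrAC.
rewrite /refl /remainder /cder /re_part /im_part /=.
set p := f (x - y); set q := f (x - y + _).
by case: p q => a b [c d] /=; congr Complex; ring.
Qed.

Lemma convol_remainder T f i x h : S_dual w T -> SB w f ->
  T (refl x (fun z => Complex (remainder i h (re_part f) z) (remainder i h (im_part f) z))) =
  Complex (-1) 0 * convol T f x + (Complex (- h) 0 * convol T (cder [:: i] f) x +
    convol T f (x + h *: unitv R i)).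
Proof.
move=> [lT _] sf; have lin := SB_linear_on lT.
have sd := SB_cder hw [:: i] sf.
rewrite -[_ * convol T (cder _ _) x + _]/(Complex (- h) 0 *: T (refl x (cder [:: i] f)) + T (refl (x + h *: unitv R i) f)).
rewrite -lin; [|exact: SB_refl|exact: SB_refl].
rewrite -[Complex (-1) 0 * _]/(Complex (-1) 0 *: T (refl x f)).
rewrite -lin; [|exact: SB_refl|by apply: SB_lin; exact: SB_refl].
by rewrite refl_remainder.
Qed.

(** By linearity the remainder of the convolution is [T] applied to the reflected Taylor remainder
    of [f], which [wbr_quad_remainder] and the seminorm bound on [T] control. *)
Lemma ddx_convol T f i x : S_dual w T -> SB w f ->
  ddx i (re_part (convol T f)) x (re_part (convol T (cder [:: i] f)) x) /\
  ddx i (im_part (convol T f)) x (im_part (convol T (cder [:: i] f)) x).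
Proof.
move=> hT sf; have [M [M0 [C C0 hC]]] := S_dual_bound hT.
have [K K1 hK] := wb_refl hN hw.
have MR0 : 0 <= M%:R :> R by [].
have MK0 : 0 <= M%:R * K by rewrite mulr_ge0//; lra.
have [c1 c10 h1] := wbr_quad_remainder hN hw i (proj1 sf) MR0 MK0.
have [c2 c20 h2] := wbr_quad_remainder hN hw i (proj2 sf) MR0 MK0.
pose D := C * (expR (M%:R * K * (1 + w (enorm x))) * (c1 + c2)).
have key h : `|h| <= 1 -> cmod (T (refl x (fun z => Complex (remainder i h (re_part f) z)
    (remainder i h (im_part f) z)))) <= D * h ^+ 2.
  move=> hh; set G := (fun z => _).
  have sG : smooth (G : cfun R N).
    by split; apply: smooth_remainder; case: sf => -[? _] [? _].
  have wG : wb w M%:R (M%:R * K) ((c1 + c2) * h ^+ 2) G.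
    split; [apply: le_wbr (h1 h hh)|apply: le_wbr (h2 h hh)]; rewrite ler_wpM2r ?sqr_ge0//.
      by rewrite lerDl.
    by rewrite lerDr.
  have -> : D * h ^+ 2 = C * (expR (M%:R * K * (1 + w (enorm x))) * ((c1 + c2) * h ^+ 2)) by rewrite /D; ring.
  apply: hC; last exact: hK.
  have -> : refl x G = Complex (-1) 0 *: refl x f + (Complex (- h) 0 *: refl x (cder [:: i] f) +
      refl (x + h *: unitv R i) f).
    exact: refl_remainder.
  by apply: SB_lin; [exact: SB_refl|apply: SB_lin; apply: SB_refl => //; exact: SB_cder].
split; apply: (@ddx_quad _ _ _ _ _ _ D) => h /andP[_ hh]; apply: le_trans (key h hh);
  rewrite convol_remainder//.
- apply: le_trans (Re_le_cmod _); rewrite /re_part.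
  case: (convol T f x) => a b; case: (convol T _ x) => c d; case: (convol T f _) => k l /=.
  by rewrite le_eqVlt; apply/orP; left; apply/eqP; congr `|_|; ring.
apply: le_trans (Im_le_cmod _); rewrite /im_part.
case: (convol T f x) => a b; case: (convol T _ x) => c d; case: (convol T f _) => k l /=.
by rewrite le_eqVlt; apply/orP; left; apply/eqP; congr `|_|; ring.
Qed.

Lemma jet_convol T f : S_dual w T -> SB w f ->
  jet (fun s => re_part (convol T (cder s f))) /\ jet (fun s => im_part (convol T (cder s f))).
Proof.
by move=> hT sf; split=> s i x; have [] := ddx_convol i x hT (SB_cder hw s sf).
Qed.

(** From w(x) <= K (1 + w(y) + w(x - y)), the factor exp (a w(x)) splits into a part in [y], allowed
    by growth of order [n], and a part in [x - y], paid by the decay of [f]. Growth in [y] is thus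
    exchanged for decay in [x]. *)
Lemma wb_refl_neg : exists2 K, 1 <= K & forall m a n c f x, 0 <= a -> a * K <= n -> smooth f ->
  wb w m (a * K) c f -> wb w m (- n) (expR (a * K) * c / expR (a * w (enorm x))) (refl x f).
Proof.
have [K K1 hK] := expR_w_add hN hw; exists K => // m a n c f x a0 an sf.
suff aux u : smooth_real u -> wbr w m (a * K) c u ->
    wbr w m (- n) (expR (a * K) * c / expR (a * w (enorm x))) (fun y => u (x - y)).
    by move: sf => [sa sb] [ha hb]; split; [exact: (aux (re_part f) sa ha)|exact: (aux (im_part f) sb hb)].
move=> su h s y; rewrite (iter_refl _ _ su) normrM normrX normrN1 expr1n mul1r.
rewrite ler_pdivlMr ?expR_gt0//.
have := hK a y (x - y) a0; rewrite addrC subrK.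
have := h s (x - y); set X := `|_|; set Js := J _ _ _; set e1 := expR _; set e2 := expR (a * w _).
move=> hc he.
have hn : expR (- n * w (enorm y)) * expR (a * K * (1 + w (enorm y))) <= expR (a * K).
  rewrite -expRD ler_expR; have := w_enorm_ge0 hw y; nra.
apply: (@le_trans _ _ (expR (a * K) * (X * e1 * Js))); last by rewrite ler_wpM2l ?expR_ge0.
have XJ : 0 <= X * Js by rewrite mulr_ge0 ?J_ge0// /X.
have -> : X * expR (- n * w (enorm y)) * Js * e2 = X * Js * (expR (- n * w (enorm y)) * e2) by ring.
have -> : expR (a * K) * (X * e1 * Js) = X * Js * (expR (a * K) * e1) by ring.
apply: ler_wpM2l => //.
apply: (@le_trans _ _ (expR (- n * w (enorm y)) * (expR (a * K * (1 + w (enorm y))) * e1))).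
  by rewrite ler_wpM2l ?expR_ge0.
by rewrite mulrA ler_wpM2r ?expR_ge0.
Qed.

End LinearFunctionals.

(** * Convolution with an element of the dual of [OC_space] *)

Section ConvolutionOperator.
Variables (R : realType) (N : nat) (w : R -> R).
Hypotheses (hN : (0 < N)%N) (hw : nqa_weight w).
Variable T : cfun R N -> (R[i])^o.
Hypothesis hT : S_dual w T.
Implicit Types (f g : cfun R N) (x y : 'rV[R]_N) (s : seq 'I_N).

Lemma OC_dual_bound T' (n : nat) : (0 < n)%N -> continuous_functional (OC_space w) (OC_nbhs w) T' ->
  exists M : nat, (0 < M)%N /\ exists2 C, 0 <= C &
  forall f c, O_proj w n%:Z f -> wb w M%:R (- n%:R) c f -> cmod (T' f : R[i]) <= C * c.
Proof.
move=> n0 [lT cT].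
have O0 : O_proj w n%:Z (0 : cfun R N).
  apply/(O_projP hw); split; first by apply: (@SB_smooth R N w); exact: SB0.
  move=> m m0; have [c _ hc] := SB_wb hw (- n%:R) (SB0 N w) m0; by exists c.
have OO f : O_proj w n%:Z f -> OC_space w f by move=> h; exists n.
have T0 := linear_on0 lT (OO _ O0).
have [V [_ VO hV hU]] := cT _ (OO _ O0) _ (near_cmod_lt1 T0).
apply: (@norms_bound R N w hw (O_proj w n%:Z) (fun=> - n%:R) T').
- by move=> m m' _; exact: lexx.
- by move=> f /(O_projP hw)[].
- move=> t f /(O_projP hw)[sf h]; apply/(O_projP hw).
  split; first by rewrite -[_ *: _]addr0; apply: smooth_lin => //; apply: (@SB_smooth R N w); exact: SB0.
  by move=> m m0; have [c hc] := h m m0; eexists; apply: wb_scale hc.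
- by move=> t f Of; apply: linear_onZ lT (OO _ O0) (OO _ Of).
have [F [e [e0 h]]] := hV n n0; exists F, e; split => // g Og hg.
by have := hU g (h g Og hg); rewrite /= add0r.
Qed.

Lemma SB_O_proj (n : nat) f : SB w f -> O_proj w n%:Z f.
Proof.
move=> sf; apply/(O_projP hw); split; first exact: SB_smooth sf.
by move=> m m0; have [c _ hc] := SB_wb hw (- n%:R) sf m0; exists c.
Qed.

Lemma convol_estimate m lam : in_OC_dual w T -> 0 <= m -> 0 <= lam ->
  exists M a C, [/\ 0 <= M, 0 <= C & forall f c s x, SB w f -> wb w M a c f ->
    cmod (convol T (cder s f) x) * expR (lam * w (enorm x)) * J w m (size s) <= C * c].
Proof.
move=> [T' [cT' eT]] m0 lam0.
have [K K1 hK] := wb_refl_neg hN hw.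
(* [T'] is bounded on every step of the inductive limit, so [n] can be as large as [lam] demands. *)
pose n := (Num.trunc (lam * K)).+1.
have lK : lam * K <= n%:R by apply/ltW/Num.Theory.truncnS_gt.
have [M [M0 [C C0 hC]]] := OC_dual_bound (ltn0Sn _ : (0 < n)%N) cT'.
(* The summand [m] pays for the derivatives along [s] in [wb_cder]; [M] is left for the
   functional. *)
exists (M%:R + m), (lam * K), (C * expR (lam * K)); split; rewrite ?addr_ge0 ?mulr_ge0 ?expR_ge0//.
move=> f c s x sf hf; have c0 := wb_ge0 hf.
have [J0|J0] := eqVneq (J w m (size s)) 0; first by rewrite J0 mulr0 !mulr_ge0 ?expR_ge0.
have {}J0 : 0 < J w m (size s) by rewrite lt_neqAle eq_sym J0 J_ge0.
have sd := SB_cder hw s sf.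
have h1 := wb_cder J0 (SB_smooth sf) hf.
have h2 := hK _ _ _ _ _ x lam0 lK (SB_smooth sd) h1.
have sr := SB_refl hN hw x sd.
have := hC _ _ (SB_O_proj n sr) h2.
rewrite eT; last exact/S_spaceP.
move=> h; rewrite -!ler_pdivlMr ?expR_gt0//; apply: le_trans h _.
by rewrite le_eqVlt; apply/orP; left; apply/eqP; field; rewrite !gt_eqF ?expR_gt0.
Qed.

Lemma SB_convol f : in_OC_dual w T -> SB w f -> SB w (convol T f).
Proof.
move=> hO sf; have [j1 j2] := jet_convol hN hw hT sf.
have bd s : exists B : R, forall x, cmod (convol T (cder s f) x) <= B.
  have [m m0 hJ] := J_pos hw (size s).
  have [M [a [C [M0 C0 h]]]] := convol_estimate hO m0 (lexx 0).
  have [c c0 hc] := SB_wb hw a sf M0.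
  exists (C * c / J w m (size s)) => x; rewrite ler_pdivlMr ?hJ//.
  by have := h f c s x sf hc; rewrite mul0r expR0 mulr1.
have sm : smooth (convol T f).
  have s1 := smooth_of_bounded j1 _; have s2 := smooth_of_bounded j2 _.
  rewrite /= cder0 in s1 s2; split; [apply: s1|apply: s2] => s; have [B hB] := bd s; exists B => x;
    apply: le_trans (hB x); [exact: Re_le_cmod|exact: Im_le_cmod].
apply: SB_of_smooth => // m m0.
have [M [a [C [M0 C0 h]]]] := convol_estimate hO m0 m0.
have [c c0 hc] := SB_wb hw a sf M0.
exists (C * c); have e1 s := jet_iter s j1; have e2 s := jet_iter s j2.
rewrite cder0 in e1 e2.
split=> s x; rewrite ?e1 ?e2; apply: le_trans (h f c s x sf hc);
  rewrite ler_wpM2r ?J_ge0// ler_wpM2r ?expR_ge0//; [exact: Re_le_cmod|exact: Im_le_cmod].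
Qed.

Lemma wb_convol m : in_OC_dual w T -> 0 <= m -> exists M C, [/\ 0 <= M, 0 <= C &
  forall f c, SB w f -> wb w M M c f -> wb w m m (C * c) (convol T f)].
Proof.
move=> hO m0; have [M [a [C [M0 C0 h]]]] := convol_estimate hO m0 m0.
exists (Num.max M a), C; split => //; first by rewrite le_max M0.
move=> f c sf hc.
have {}hc : wb w M a c f by apply: wb_mono hc => //; rewrite le_max lexx ?orbT.
have [j1 j2] := jet_convol hN hw hT sf.
have e1 s := jet_iter s j1; have e2 s := jet_iter s j2.
rewrite cder0 in e1 e2.
split=> s x; rewrite ?e1 ?e2; apply: le_trans (h f c s x sf hc);
  rewrite ler_wpM2r ?J_ge0// ler_wpM2r ?expR_ge0//; [exact: Re_le_cmod|exact: Im_le_cmod].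
Qed.

Lemma convol_linear : linear_on (S_space w) (convol T).
Proof.
move=> z f g /(S_spaceP hN hw) Sf /(S_spaceP hN hw) Sg; apply/funext => x.
have [lT _] := hT.
by apply: (SB_linear_on hN hw lT); exact: SB_refl.
Qed.

Lemma convol_continuous f : in_OC_dual w T -> S_space w f ->
  convol T @ S_nbhs w f `=>` S_nbhs w (convol T f).
Proof.
move=> hO Sf U [F [e [e0 hF]]].
pose n := \max_(m <- F) m.
have [M [C [M0 C0 h]]] := wb_convol hO (ler0n R n).
pose k := (Num.trunc M).+1.
have Mk : M <= k%:R by apply/ltW/Num.Theory.truncnS_gt.
pose d := e / (4 * (C + 1)); have C1 : 0 < C + 1 by lra.
have d0 : 0 < d by rewrite divr_gt0// mulr_gt0.
exists [:: k], d; split => // g Sg hg.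
have sf : SB w f by exact/(S_spaceP hN hw).
have sg : SB w g by exact/(S_spaceP hN hw).
have gf : g - f = Complex (-1) 0 *: f + g.
  apply/funext => x; rewrite addrC; congr (_ + _).
  rewrite [RHS](_ : _ = Complex (-1) 0 * f x)//.
  rewrite [LHS](_ : _ = - f x)//; case: (f x) => a b /=.
  by congr Complex; ring.
have sgf : SB w (g - f) by rewrite gf; exact: SB_lin.
have hq := gnorm_ge (ltn0Sn _ : (0 < k)%N) (SB_smooth sgf) (ltW (hg k (mem_head _ _) isT)).
have {}hq : wb w M M d (g - f) by apply: wb_mono hq.
have hc := h _ _ sgf hq.
apply: hF; first by apply/(S_spaceP hN hw); exact: SB_convol.
move=> m mF m0.
have -> : convol T g - convol T f = convol T (g - f).
  rewrite gf convol_linear//; apply/funext => x.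
  rewrite [LHS](_ : _ = convol T g x - convol T f x)//.
  rewrite [RHS](_ : _ = Complex (-1) 0 * convol T f x + convol T g x)//.
  case: (convol T f x) (convol T g x) => a b [k' l] /=; congr Complex; ring.
have mn : (m <= n)%N by exact: leq_bigmax_seq.
have hm : wb w m%:R m%:R (C * d) (convol T (g - f)) by apply: wb_mono hc => //; rewrite ler_nat.
apply: (le_lt_trans (gnorm_le m0 hm)); rewrite lte_fin.
have -> : e = 4 * (C + 1) * d by rewrite /d; field; rewrite gt_eqF.
nra.
Qed.

End ConvolutionOperator.

(** * Completeness and uniform boundedness *)

Section TelescopingLimits.
Variable R : realType.

(* Convergence rates are measured by the telescoping series
   [inv_succ n - inv_succ n.+1 = 1 / ((n + 1) (n + 2))]: the partial sums over lattice
   cubes below converge only polynomially fast. *)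
Definition inv_succ (n : nat) : R := n.+1%:R^-1.

Lemma inv_succ_gt0 n : 0 < inv_succ n. Proof. by rewrite invr_gt0 ltr0n. Qed.

Lemma inv_succ_le1 n : inv_succ n <= 1.
Proof. by rewrite invf_le1 ?ler1n ?ltr0n. Qed.

Lemma le_inv_succ m n : (m <= n)%N -> inv_succ n <= inv_succ m.
Proof. by move=> mn; rewrite lef_pV2 ?posrE ?ltr0n// ler_nat. Qed.

Lemma inv_succ_diff n : inv_succ n - inv_succ n.+1 = (n.+1%:R * n.+2%:R)^-1.
Proof.
have key (a : R) : 0 < a -> a^-1 - (a + 1)^-1 = (a * (a + 1))^-1.
  by move=> a0; field; rewrite !gt_eqF//; lra.
by rewrite /inv_succ -[n.+2%:R]natr1 key.
Qed.

Lemma inv_succ_diff_gt0 n : 0 < inv_succ n - inv_succ n.+1.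
Proof. by rewrite inv_succ_diff invr_gt0 mulr_gt0 ?ltr0n. Qed.

Lemma inv_succ_diff_le m n : (m <= n)%N -> inv_succ n - inv_succ n.+1 <= inv_succ m - inv_succ m.+1.
Proof.
move=> mn; rewrite !inv_succ_diff lef_pV2 ?posrE ?mulr_gt0 ?ltr0n//.
by rewrite ler_pM ?ler_nat// ltnS.
Qed.

Lemma le_of_le_inv_succ n0 (a b c : R) : (forall n, (n0 <= n)%N -> a <= b + c * inv_succ n) -> a <= b.
Proof.
move=> h; apply/ler_addgt0Pr => e e0.
pose k := (Num.trunc (`|c| / e)).+1.
have hk : `|c| / e <= k%:R by apply/ltW/Num.Theory.truncnS_gt.
apply: le_trans (h (n0 + k)%N (leq_addr _ _)) _; rewrite lerD2l.
apply: (@le_trans _ _ (`|c| * inv_succ k)).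
  apply: (@le_trans _ _ (`|c| * inv_succ (n0 + k))).
    by rewrite ler_wpM2r ?(ltW (inv_succ_gt0 _))// ler_norm.
  by rewrite ler_wpM2l// le_inv_succ// leq_addl.
rewrite /inv_succ ler_pdivrMr ?ltr0n// mulrC -ler_pdivrMr//.
by apply: le_trans hk _; rewrite ler_nat.
Qed.

Lemma tail_le n0 (a : nat -> R) c : 
  (forall n, (n0 <= n)%N -> `|a n.+1 - a n| <= c * (inv_succ n - inv_succ n.+1)) ->
  forall n k, (n0 <= n)%N -> `|a (n + k)%N - a n| <= c * (inv_succ n - inv_succ (n + k)).
Proof.
move=> h n k n0n; elim: k => [|k IH]; first by rewrite addn0 !subrr normr0 mulr0.
rewrite addnS -[a (n + k).+1](subrK (a (n + k)%N)) -addrA.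
apply: (le_trans (ler_normD _ _)).
apply: (le_trans (lerD (h (n + k)%N _) IH)); first exact: leq_trans (leq_addr _ _).
by rewrite le_eqVlt; apply/orP; left; apply/eqP; ring.
Qed.

(** The limit is the supremum of the lower bounds [a n - c * inv_succ R n], each of which stays
    below every upper bound [a m + c * inv_succ R m]. *)
Lemma tail_lim n0 (a : nat -> R) c : 0 <= c ->
  (forall n, (n0 <= n)%N -> `|a n.+1 - a n| <= c * (inv_succ n - inv_succ n.+1)) ->
  exists l, forall n, (n0 <= n)%N -> `|l - a n| <= c * inv_succ n.
Proof.
move=> c0 h; have ht := tail_le h.
have bt n m : (n0 <= n)%N -> (n0 <= m)%N -> a n - c * inv_succ n <= a m + c * inv_succ m.
  move=> hn hm; wlog nm : n m hn hm / (n <= m)%N => [wl|].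
    case: (leqP n m) => [/wl|/ltnW mn]; first exact.
    have := ht m (n - m)%N hm; rewrite subnKC// ler_norml => /andP[_].
    have := mulr_ge0 c0 (ltW (inv_succ_gt0 n)); have := mulr_ge0 c0 (ltW (inv_succ_gt0 m)); lra.
  have := ht n (m - n)%N hn; rewrite subnKC// ler_norml => /andP[h1 _].
  have := mulr_ge0 c0 (ltW (inv_succ_gt0 n)); have := mulr_ge0 c0 (ltW (inv_succ_gt0 m)); lra.
pose B := [set a n - c * inv_succ n | n in [set n | (n0 <= n)%N]].
have B0 : B !=set0 by exists (a n0 - c * inv_succ n0); exists n0 => //=.
have ub n : (n0 <= n)%N -> ubound B (a n + c * inv_succ n) by move=> hn _ [m hm <-]; exact: bt.
exists (sup B) => n hn; rewrite ler_distl; apply/andP; split.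
  by apply: ub_le_sup; [exists (a n0 + c * inv_succ n0); exact: ub|exists n].
by apply: ge_sup => //; exact: ub.
Qed.

End TelescopingLimits.

Section Completeness.
Variables (R : realType) (N : nat) (w : R -> R).
Hypotheses (hN : (0 < N)%N) (hw : nqa_weight w).
Implicit Types (u : nat -> 'rV[R]_N -> R) (g : nat -> cfun R N) (x : 'rV[R]_N) (s : seq 'I_N).

(** The second conclusion holds in every norm in which the increments telescope, not only for
    [a = m], and with an explicit rate from any starting index. The hump construction and the
    identification of the extension both use this rate. *)
Lemma SBr_complete u : (forall n, SBr w (u n)) ->
  (forall m, 0 <= m -> exists n0 c, forall n, (n0 <= n)%N ->
    wbr w m m (c * (inv_succ R n - inv_succ R n.+1)) (u n.+1 \+ (fun x => -1 * u n x))) ->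
  exists v, SBr w v /\ forall m a c n0,
    (forall n, (n0 <= n)%N -> wbr w m a (c * (inv_succ R n - inv_succ R n.+1)) (u n.+1 \+ (fun x => -1 * u n x))) ->
    wbr w m a (c * inv_succ R n0) (v \+ (fun x => -1 * u n0 x)).
Proof.
move=> su hc.
have smu n : smooth_real (u n) by case: (su n).
have iterB s n n' x : iter_partial s (u n \+ (fun x => -1 * u n' x)) x = iter_partial s (u n) x - iter_partial s (u n') x.
  by rewrite iterD ?iterZ//=; [rewrite mulN1r|exact: smoothZ].
have /choice[cs hcs] : forall s, exists p : nat * R, 0 <= p.2 /\ forall n x, (p.1 <= n)%N ->
    `|iter_partial s (u n.+1) x - iter_partial s (u n) x| <= p.2 * (inv_succ R n - inv_succ R n.+1).
  move=> s; have [m m0 hJ] := J_pos hw (size s).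
  have [n0 [c h]] := hc m m0; have c0 : 0 <= c.
    by have := wbr_ge0 (h n0 (leqnn _)); rewrite pmulr_lge0// inv_succ_diff_gt0.
  have J0 := hJ _ (lexx m).
  exists (n0, c / J w m (size s)); split => /=; first by rewrite divr_ge0// ltW.
  move=> n x hn; rewrite [leRHS]mulrAC ler_pdivlMr//.
  have := h n hn s x; rewrite iterB; apply: le_trans; rewrite ler_wpM2r ?(ltW J0)// ler_peMr//.
  by rewrite -expR0 ler_expR mulr_ge0// w_enorm_ge0.
have /choice[D hD] : forall s, exists d : 'rV[R]_N -> R, forall x n, ((cs s).1 <= n)%N ->
    `|d x - iter_partial s (u n) x| <= (cs s).2 * inv_succ R n.
  move=> s; have [c0 h] := hcs s.
  have /choice[d hd] : forall x, exists l, forall n, ((cs s).1 <= n)%N -> `|l - iter_partial s (u n) x| <= (cs s).2 * inv_succ R n.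
    by move=> x; apply: (@tail_lim R _ (fun n => iter_partial s (u n) x) _ c0) => n; exact: h.
  by exists d.
have bD s : exists B : R, forall x n, ((cs s).1 <= n)%N -> `|iter_partial s (u n) x| <= B.
  have [_ rd] := SBr_RD hw (su (cs s).1); have [B hB] := rd 0 s (lexx 0).
  have [c0 h] := hcs s.
  exists (B + (cs s).2) => x n hn.
  have := hB x; rewrite mul0r expR0 mulr1 => hb.
  have := @tail_le R _ (fun n => iter_partial s (u n) x) _ (fun n => h n x) (cs s).1 (n - (cs s).1)%N (leqnn _).
  rewrite subnKC// => ht.
  rewrite -[iter_partial s (u n) x](subrK (iter_partial s (u (cs s).1) x)).
  apply: (le_trans (ler_normD _ _)); rewrite addrC lerD//; apply: le_trans ht _.
  rewrite -[leRHS]mulr1 ler_wpM2l//; have := inv_succ_gt0 R n; have := inv_succ_le1 R (cs s).1; lra.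
have jD : jet D.
  move=> s i x; have [B hB] := bD (i :: i :: s).
  apply: (@ddx_quad _ _ _ _ _ _ B) => h _.
  pose n0 := maxn (cs (i :: i :: s)).1 (maxn (cs s).1 (cs (i :: s)).1).
  have [cs0 _] := hcs s; have [ci0 _] := hcs (i :: s).
  (* The quadratic estimate holds for [u n] with [B] independent of [n]; replacing [u n] by the
     limits costs a multiple of [inv_succ R n]. *)
  apply: (@le_of_le_inv_succ R n0 _ _ ((cs s).2 + (cs s).2 + `|h| * (cs (i :: s)).2)) => n.
  rewrite !geq_max => /and3P[n1 n2 n3].
  have q : `|iter_partial s (u n) (x + h *: unitv R i) - iter_partial s (u n) x -
      h * iter_partial (i :: s) (u n) x| <= B * h ^+ 2.
    apply: (@quad_bound _ _ i _ _ (iter_partial (i :: i :: s) (u n))) => [y|y|t _].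
    - exact: smooth_jet.
    - exact: smooth_jet.
    - exact: hB.
  have a1 := hD s (x + h *: unitv R i) n n2; have a2 := hD s x n n2; have a3 := hD (i :: s) x n n3.
  move: q a1 a2 a3; set a := iter_partial _ _ _; set b := iter_partial _ _ _; set c := iter_partial _ _ _.
  set a' := D s _; set b' := D s _; set c' := D _ x => q a1 a2 a3.
  have -> : a' - b' - h * c' = (a - b - h * c) + ((a' - a) - (b' - b) - h * (c' - c)) by ring.
  apply: (le_trans (ler_normD _ _)); rewrite lerD//.
  apply: (le_trans (ler_normB _ _)); rewrite normrM mulrDl lerD//.
    by apply: (le_trans (ler_normB _ _)); rewrite mulrDl lerD.
  by rewrite -mulrA ler_wpM2l.
have smD : smooth_real (D [::]).
  apply: (smooth_of_bounded jD) => s; have [B hB] := bD s; exists (B + (cs s).2) => x.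
  have h1 := hB x _ (leqnn _); have h2 := hD s x _ (leqnn _); have [c0 _] := hcs s.
  rewrite -[D s x](subrK (iter_partial s (u (cs s).1) x)).
  apply: (le_trans (ler_normD _ _)); rewrite addrC lerD//; apply: le_trans h2 _.
  by rewrite -[leRHS]mulr1 ler_wpM2l// inv_succ_le1.
have iD s : iter_partial s (D [::]) = D s by exact: jet_iter.
have lim m a c n0 : (forall n, (n0 <= n)%N -> wbr w m a (c * (inv_succ R n - inv_succ R n.+1)) (u n.+1 \+ (fun x => -1 * u n x))) ->
    wbr w m a (c * inv_succ R n0) (D [::] \+ (fun x => -1 * u n0 x)).
  move=> h s x; rewrite iterD//; last exact: smoothZ.
  rewrite iterZ// iD /= mulN1r.
  have c0 : 0 <= c by have := wbr_ge0 (h n0 (leqnn _)); rewrite pmulr_lge0// inv_succ_diff_gt0.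
  set E := expR _; set Js := J _ _ _; have [cs0 _] := hcs s.
  have E0 : 0 <= E := expR_ge0 _; have J0 : 0 <= Js := J_ge0 _ _ _.
  apply: (@le_of_le_inv_succ R (maxn n0 (cs s).1) _ _ ((cs s).2 * E * Js)) => n.
  rewrite geq_max => /andP[n1 n2].
  have hd := hD s x n n2.
  have := @tail_le R n0 (fun n => iter_partial s (u n) x * E * Js) c _ n0 (n - n0)%N (leqnn _).
  rewrite subnKC// => ht.
  have {}ht : `|iter_partial s (u n) x - iter_partial s (u n0) x| * E * Js <= c * inv_succ R n0.
    apply: (@le_trans _ _ (c * (inv_succ R n0 - inv_succ R n))); last first.
      by rewrite ler_wpM2l// lerBlDr lerDl ltW// inv_succ_gt0.
    apply: le_trans (ht _); first by rewrite -!mulrBl !normrM (ger0_norm E0) (ger0_norm J0).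
    move=> k hk; have := h k hk s x; rewrite iterB.
    by rewrite -!mulrBl !normrM (ger0_norm E0) (ger0_norm J0).
  apply: (@le_trans _ _ ((`|D s x - iter_partial s (u n) x| + `|iter_partial s (u n) x - iter_partial s (u n0) x|) * E * Js)).
    by rewrite ler_wpM2r// ler_wpM2r// -[X in `|X| <= _](subrKA (iter_partial s (u n) x)) ler_normD.
  rewrite !mulrDl addrC lerD//.
  have -> : (cs s).2 * E * Js * inv_succ R n = (cs s).2 * inv_succ R n * E * Js by ring.
  by rewrite ler_wpM2r// ler_wpM2r.
exists (D [::]); split => //; split => // m m0.
have [n0 [c h]] := hc m m0; have hl := lim _ _ _ _ h.
have [_ /(_ m m0)[c' hc']] := su n0.
exists (c' + c * inv_succ R n0).
have := wbrD (smu n0) _ hc' hl.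
have -> : u n0 \+ (D [::] \+ (fun x => -1 * u n0 x)) = D [::].
  by apply/funext => x /=; ring.
by apply; apply: smoothD => //; exact: smoothZ.
Qed.

Lemma re_sub (f h : cfun R N) : re_part (f - h) = re_part f \+ (fun x => -1 * re_part h x).
Proof.
apply/funext => x; rewrite /re_part [(f - h) x](_ : _ = f x - h x)//=.
by case: (f x) (h x) => a b [c d] /=; rewrite mulN1r.
Qed.

Lemma im_sub (f h : cfun R N) : im_part (f - h) = im_part f \+ (fun x => -1 * im_part h x).
Proof.
apply/funext => x; rewrite /im_part [(f - h) x](_ : _ = f x - h x)//=.
by case: (f x) (h x) => a b [c d] /=; rewrite mulN1r.
Qed.

Lemma S_complete g : (forall n, SB w (g n)) ->
  (forall m, 0 <= m -> exists n0 c, forall n, (n0 <= n)%N ->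
    wb w m m (c * (inv_succ R n - inv_succ R n.+1)) (g n.+1 - g n)) ->
  exists f : cfun R N, SB w f /\ forall m a c n0,
    (forall n, (n0 <= n)%N -> wb w m a (c * (inv_succ R n - inv_succ R n.+1)) (g n.+1 - g n)) ->
    wb w m a (c * inv_succ R n0) (f - g n0).
Proof.
move=> sg hc.
have [|m m0|a [sa ha]] := @SBr_complete (fun n => re_part (g n)).
- by move=> n; case: (sg n).
- have [n0 [c h]] := hc m m0; exists n0, c => n hn; have [h1 _] := h n hn.
  by rewrite re_sub in h1.
have [|m m0|b [sb hb]] := @SBr_complete (fun n => im_part (g n)).
- by move=> n; case: (sg n).
- have [n0 [c h]] := hc m m0; exists n0, c => n hn; have [_ h1] := h n hn.
  by rewrite im_sub in h1.
exists (fun x => Complex (a x) (b x)); split => // m al c n0 h; split.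
  by rewrite re_sub; apply: ha => n hn; have [h1 _] := h n hn; rewrite re_sub in h1.
by rewrite im_sub; apply: hb => n hn; have [_ h1] := h n hn; rewrite im_sub in h1.
Qed.

Lemma SB_sub (f h : cfun R N) : SB w f -> SB w h -> SB w (f - h).
Proof. by move=> [a b] [c d]; split; rewrite ?re_sub ?im_sub; apply: SBrD => //; exact: SBrZ. Qed.

End Completeness.

(** * Uniform boundedness by a gliding hump *)

Section UniformBoundedness.
Variables (R : realType) (N : nat) (w : R -> R).
Hypotheses (hN : (0 < N)%N) (hw : nqa_weight w).
Variables (X : Type) (L : X -> cfun R N -> R[i]).
Hypothesis L_linear : forall x (z : R[i]) f g, SB w f -> SB w g -> L x (z *: f + g) = z * L x f + L x g.
Hypothesis L_bounded : forall x, exists (M : nat) (C : R), 0 <= C /\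
  forall f c, SB w f -> wb w M%:R M%:R c f -> cmod (L x f) <= C * c.
Hypothesis L_pointwise : forall f, SB w f -> exists B : R, forall x, cmod (L x f) <= B.

Let state := (cfun R N * nat * R)%type.

(* A state [(F, M, d)] is a partial sum [F] together with the seminorm of index [M] in
   which all the remaining terms must stay below [d]; [hump p q] adds a term making
   [L x] larger than the old index at some [x], robustly under what follows. *)
Let hump (p q : state) : Prop :=
  [/\ SB w q.1.1, 0 < q.2, (p.1.2 < q.1.2)%N, q.2 <= p.2 &
     wb w p.1.2%:R p.1.2%:R (p.2 * (inv_succ R p.1.2 - inv_succ R p.1.2.+1)) (q.1.1 - p.1.1) /\
     exists x, forall G, SB w G -> wb w q.1.2%:R q.1.2%:R q.2 (G - q.1.1) ->
       p.1.2%:R < cmod (L x G)].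

Let L_sub x f g : SB w f -> SB w g -> L x (f - g) = L x f - L x g.
Proof.
move=> sf sg; have -> : f - g = Complex (-1) 0 *: g + f.
  apply/funext => y; rewrite addrC; congr (_ + _).
  rewrite [RHS](_ : _ = Complex (-1) 0 * g y)//.
  rewrite [LHS](_ : _ = - g y)//; case: (g y) => a b /=.
  by congr Complex; ring.
rewrite L_linear// addrC; congr (_ + _).
by case: (L x g) => a b /=; congr Complex; ring.
Qed.

Let next_hump (hno : ~ exists (M : nat) (C : R), forall x f c, SB w f -> wb w M%:R M%:R c f ->
    cmod (L x f) <= C * c) (p : state) :
  SB w p.1.1 -> 0 < p.2 -> exists q, hump p q.
Proof.
case: p => [[F M] d] /= sF d0.
have [B hB] := L_pointwise sF.
set rho := inv_succ R M - inv_succ R M.+1; have rho0 : 0 < rho := inv_succ_diff_gt0 R M.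
(* The new term must beat the value at the partial sum, at most [B], and the effect of all later
   terms, at most 1, and still leave more than [M]. *)
pose A := `|B| + M%:R + 2; have A0 : 0 < A.
  by have := normr_ge0 B; have := ler0n R M; rewrite /A; lra.
pose C := A / (d * rho); have C0 : 0 < C by rewrite divr_gt0// mulr_gt0.
have [x [f [c [sf hf hC]]]] : exists x f c, [/\ SB w f, wb w M%:R M%:R c f & C * c < cmod (L x f)].
  apply: contrapT => hn; apply: hno; exists M, C => x f c sf hf.
  by rewrite leNgt; apply/negP => hlt; apply: hn; exists x, f, c.
have c0 := wb_ge0 hf.
(* Since [c] may be 0, the normalization uses a number strictly above it for which the bound is
   still violated. *)
pose c' := (c + cmod (L x f) / C) / 2.
have cc : c < cmod (L x f) / C by rewrite ltr_pdivlMr// mulrC.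
have c'c : c <= c' by rewrite /c'; lra.
have c'0 : 0 < c' by rewrite /c'; lra.
have c'L : C * c' < cmod (L x f) by rewrite -ltr_pdivlMl// mulrC /c'; lra.
pose r := d * rho / c'; have r0 : 0 < r by rewrite divr_gt0// mulr_gt0.
pose f' : cfun R N := Complex r 0 *: f.
have sf' : SB w f' by rewrite /f' -[_ *: f]addr0; apply: SB_lin => //; exact: SB0.
have wf' : wb w M%:R M%:R (d * rho) f'.
  apply: (@le_wb _ _ _ _ _ ((`|r| + `|0|) * c)); last by apply: wb_scale hf; exact: SB_smooth sf.
  rewrite normr0 addr0 gtr0_norm// /r.
  by rewrite mulrAC ler_pdivrMr// ler_wpM2l// mulr_ge0// ltW.
have Lf' : A < cmod (L x f').
  have -> : L x f' = Complex r 0 * L x f.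
    have L0 : L x 0 = 0.
      by rewrite -(subrr f) L_sub// subrr.
    by rewrite /f' -[_ *: f]addr0 L_linear//; [rewrite L0 addr0|exact: SB0].
  rewrite cmodM cmod_real gtr0_norm//.
  have -> : A = r * (C * c') by rewrite /r /C; field; rewrite !gt_eqF.
  by rewrite ltr_pM2l.
pose F' : cfun R N := Complex 1 0 *: F + f'.
have sF' : SB w F' by exact: SB_lin.
have F'F : F' - F = f'.
  apply/funext => y; rewrite [LHS](_ : _ = Complex 1 0 * F y + f' y - F y)//.
  by case: (F y) (f' y) => a b [k l] /=; congr Complex; ring.
have [M' [C' [C'0 hL]]] := L_bounded x.
pose M'' := (maxn M M').+1.
(* Later corrections, of size at most [d'] in the seminorm controlling [L x], change its value by at
   most 1. *)
pose d' := Num.min d (C' + 1)^-1.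
have C1 : 0 < C' + 1 by lra.
have d'0 : 0 < d' by rewrite lt_min d0 invr_gt0.
exists (F', M'', d'); split => //=.
- by rewrite ltnS leq_maxl.
- by rewrite ge_min lexx.
split; first by rewrite F'F.
exists x => G sG hG.
have sGF : SB w (G - F') by exact: SB_sub.
have hG' : wb w M'%:R M'%:R d' (G - F').
  by apply: wb_mono hG => //; rewrite ler_nat leqW// leq_maxr.
have h1 := hL _ _ sGF hG'.
have h2 : C' * d' <= 1.
  apply: (@le_trans _ _ (C' * (C' + 1)^-1)); first by rewrite ler_wpM2l// ge_min lexx orbT.
  by rewrite ler_pdivrMr//; lra.
have e1 : L x f' = L x F' - L x F by rewrite -F'F L_sub.
have e2 : L x F' = L x G - L x (G - F') by rewrite L_sub// opprB addrC subrK.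
have h3 := cmodD (L x F') (- L x F); rewrite -e1 cmodN in h3.
have h4 := cmodD (L x G) (- L x (G - F')); rewrite -e2 cmodN in h4.
have h5 := hB x; have := ler_norm B; rewrite /A in Lf'; lra.
Qed.

(** If no seminorm works, iterating [next_hump] from the zero function gives partial sums converging
    to some [G]. The decreasing budgets and the telescoping factors keep [G] admissible at each
    stage, so the values [L x G] exceed every index, against pointwise boundedness. *)
Lemma uniform_bound : exists (M : nat) (C : R), forall x f c, SB w f -> wb w M%:R M%:R c f ->
  cmod (L x f) <= C * c.
Proof.
apply: contrapT => hno.
have /choice[nx hnx] : forall p : state, exists q, SB w p.1.1 -> 0 < p.2 -> hump p q.
  move=> p; have [[sp p0]|np] := pselect (SB w p.1.1 /\ 0 < p.2).
    by have [q hq] := next_hump hno sp p0; exists q.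
  by exists p => sp p0; case: np.
pose st n := iter n nx ((0 : cfun R N), 0%N, 1 : R).
have good n : SB w (st n).1.1 /\ 0 < (st n).2.
  elim: n => [|n [s1 s2]] /=; first by split => //; exact: SB0.
  by have [] := hnx _ s1 s2.
have hst n : hump (st n) (st n.+1) by have [s1 s2] := good n; exact: hnx.
have Mn n : (n <= (st n).1.2)%N.
  by elim: n => // n IH; have [_ _ h _ _] := hst n; exact: leq_ltn_trans h.
have Mmono n k : ((st n).1.2 <= (st (n + k)%N).1.2)%N.
  elim: k => [|k IH]; first by rewrite addn0.
  by rewrite addnS; have [_ _ h _ _] := hst (n + k)%N; apply: leq_trans IH (ltnW h).
have dmono n k : (st (n + k)%N).2 <= (st n).2.
  elim: k => [|k IH]; first by rewrite addn0.
  by rewrite addnS; have [_ _ _ h _] := hst (n + k)%N; apply: le_trans h IH.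
have inc n k : (n <= k)%N -> wb w (st n).1.2%:R (st n).1.2%:R ((st n).2 * (inv_succ R k - inv_succ R k.+1))
    ((st k.+1).1.1 - (st k).1.1).
  move=> nk; have [_ _ _ _ [h _]] := hst k.
  apply: (@wb_mono _ _ _ hw _ (st k).1.2%:R _ (st k).1.2%:R).
  - by rewrite ler_nat -(subnKC nk).
  - by rewrite ler_nat -(subnKC nk).
  apply: le_wb h; apply: ler_pM.
  - by apply/ltW; case: (good k).
  - by apply/ltW; exact: inv_succ_diff_gt0.
  - by rewrite -(subnKC nk).
  - exact: inv_succ_diff_le.
have [n|m m0|G [sG hG]] := @S_complete R N w hw (fun n => (st n).1.1).
- by case: (good n).
- pose n0 := (Num.trunc m).+1.
  have hm : m <= n0%:R by apply/ltW/Num.Theory.truncnS_gt.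
  have hm' : m <= (st n0).1.2%:R by apply: le_trans hm _; rewrite ler_nat.
  exists n0, (st n0).2 => n hn; apply: wb_mono (inc n0 n hn) => //.
have [B hB] := L_pointwise sG.
pose n := (Num.trunc B).+1.
have hn : B <= n%:R by apply/ltW/Num.Theory.truncnS_gt.
have [_ _ _ _ [_ [x hx]]] := hst n.
have := hx G sG.
have h1 : wb w (st n.+1).1.2%:R (st n.+1).1.2%:R (st n.+1).2 (G - (st n.+1).1.1).
  have := hG _ _ _ n.+1 (inc n.+1); apply: le_wb.
  by rewrite -[leRHS]mulr1 ler_wpM2l ?inv_succ_le1//; apply/ltW; case: (good n.+1).
move=> /(_ h1); rewrite ltNge => /negP; apply.
apply: (le_trans (hB x)); apply: (le_trans hn); rewrite ler_nat; exact: Mn.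
Qed.

End UniformBoundedness.

(** * A partition of unity in S *)

Section Primitive.
Variable R : realType.
Notation mu := (@lebesgue_measure R).
Implicit Types (u W : R -> R).

Lemma exists_primitive u A : continuous u -> (forall x, `|u x| <= A * kappa x) ->
  exists W, forall t, is_derive t (1 : R^o) (W : R -> R^o) (u t).
Proof.
move=> cu hu; have mu_ : measurable_fun setT u by exact: continuous_measurable_fun.
have iu := integrable_of_kappa mu_ hu.
exists (fun t => \int[mu]_(x in `]-oo, t]) u x) => t.
have t1 : t < t + 1 by rewrite ltrDl.
have [|||d e] := @continuous_FTC1 R u (BInfty _ true) t (t + 1) t1.
- by apply: integrableS iu => //; exact: measurable_itv.
- by rewrite ltNyr.
- exact: cu.
rewrite -e; rewrite derive1E; exact: (@derivableP R R^o R^o _ t 1).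
Qed.

Lemma primitive_bounded u W A : (forall t, is_derive t (1 : R^o) (W : R -> R^o) (u t)) ->
  (forall x, `|u x| <= A * kappa x) -> forall t, `|W t - W 0| <= A * pi.
Proof.
move=> dW hu t.
have A0 : 0 <= A by have := le_trans (normr_ge0 _) (hu 0); rewrite pmulr_lge0// kappa_gt0.
have dA (sg : R) s : is_derive s (1 : R^o) ((fun s => A * atan s + sg * W s) : R -> R^o) (A * kappa s + sg * u s).
  exact: is_deriveD.
have at0 : `|atan t| <= pi.
  have := atan_gtNpi2 t; have := atan_ltpi2 t; have := pi_gt0 R; rewrite ler_norml => *.
  by apply/andP; split; lra.
have mono (sg a b : R) : `|sg| = 1 -> a <= b -> A * atan a + sg * W a <= A * atan b + sg * W b.
  move=> sg1 ab; have [c _ e] := mvt_real (dA sg) ab.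
  rewrite -subr_ge0 e mulr_ge0 ?subr_ge0//.
  have : `|sg * u c| <= A * kappa c by rewrite normrM sg1 mul1r.
  by rewrite ler_norml => /andP[]; lra.
have m1 := mono 1 _ _ (normr1 _); have mN := mono (-1) _ _ (normrN1 _).
have at1 : A * atan t <= A * pi by rewrite ler_wpM2l//; apply: le_trans at0; exact: ler_norm.
have at2 : A * (- atan t) <= A * pi by rewrite ler_wpM2l//; apply: le_trans at0; rewrite -normrN ler_norm.
rewrite mulrN in at2.
case: (leP 0 t) => [t0|/ltW t0].
  have := m1 _ _ t0; have := mN _ _ t0; rewrite atan0 mulr0 ler_norml !mul1r !mulN1r => *.
  by apply/andP; split; lra.
have := m1 _ _ t0; have := mN _ _ t0; rewrite atan0 mulr0 ler_norml !mul1r !mulN1r => *.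
by apply/andP; split; lra.
Qed.

(** The total mass of [u] is the oscillation of its monotone primitive, sup minus inf; it is
    positive because a constant [W] would force [u 0 = 0]. *)
Lemma primitive_mass u W A : (forall t, is_derive t (1 : R^o) (W : R -> R^o) (u t)) ->
  (forall x, `|u x| <= A * kappa x) -> (forall t, 0 <= u t) -> 0 < u 0 ->
  exists2 c, 0 < c & forall t e, 0 < e -> exists n0, forall n, (n0 <= n)%N ->
    `|W (t + n%:R) - W (t - n%:R) - c| <= e.
Proof.
move=> dW hu u0 u00.
have bW := primitive_bounded dW hu.
have mW a b : a <= b -> W a <= W b.
  move=> ab; have [c _ e] := mvt_real dW ab.
  by rewrite -subr_ge0 e mulr_ge0 ?subr_ge0.
pose S := range W.
have S0 : S !=set0 by exists (W 0), 0.
have Sub : has_ubound S.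
  by exists (W 0 + A * pi) => _ [t _ <-]; have := bW t; rewrite ler_norml => /andP[_]; lra.
have Slb : has_lbound S.
  by exists (W 0 - A * pi) => _ [t _ <-]; have := bW t; rewrite ler_norml => /andP[]; lra.
have hsup t : W t <= sup S by apply: ub_le_sup => //; exists t.
have hinf t : inf S <= W t by apply: ge_inf => //; exists t.
exists (sup S - inf S).
  rewrite lt_neqAle subr_ge0 (le_trans (hinf 0) (hsup 0)) andbT eq_sym subr_eq0.
  apply/eqP => e; have cW : W = cst (W 0).
    apply/funext => t; apply/eqP; rewrite eq_le /cst.
    by rewrite (le_trans (hsup t)) ?e// (le_trans _ (hinf t))// -e.
  have d1 := dW 0; rewrite cW in d1.
  have := @derive_val _ _ _ _ _ _ _ d1; rewrite derive_cst => h.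
  by rewrite -h ltxx in u00.
move=> t e e0.
have e2 : 0 < e / 2 by rewrite divr_gt0.
have [_ [t1 _ <-] h1] := sup_adherent e2 (conj S0 Sub).
have [_ [t2 _ <-] h2] := inf_adherent e2 (conj S0 Slb).
pose n0 := (Num.trunc (`|t| + `|t1| + `|t2|)).+1.
have hn0 : `|t| + `|t1| + `|t2| <= n0%:R by apply/ltW/Num.Theory.truncnS_gt.
exists n0 => n nn0.
have {hn0} hn : `|t| + `|t1| + `|t2| <= n%:R by apply: le_trans hn0 _; rewrite ler_nat.
have a1 : W t1 <= W (t + n%:R).
  apply: mW; have := ler_norm t1; have := ler_norm (- t); rewrite normrN.
  have := normr_ge0 t2; lra.
have a2 : W (t - n%:R) <= W t2.
  apply: mW; have := ler_norm (- t2); have := ler_norm t; rewrite normrN.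
  have := normr_ge0 t1; lra.
have := hsup (t + n%:R); have := hinf (t - n%:R).
by rewrite ler_norml => *; apply/andP; split; lra.
Qed.

(* The integers in the order 0, -1, 1, -2, 2, ...: the first [2 n] of them are
   [-n, ..., n - 1]. *)
Definition lattice_pt (j : nat) : R := if odd j then - (j./2.+1)%:R else (j./2)%:R.

Lemma lattice_pt_abs j n : (n.*2 <= j)%N -> n%:R <= `|lattice_pt j|.
Proof.
move=> nj; have nj2 : (n <= j./2)%N by rewrite -(doubleK n) half_leq.
rewrite /lattice_pt; case: odd; rewrite ?normrN ger0_norm// ler_nat//.
exact: leqW.
Qed.

Lemma sum_lattice_pt W c (t : R) n :
  \sum_(j < n.*2) ((W (t - lattice_pt j) - W (t - lattice_pt j - 1)) / c) = (W (t + n%:R) - W (t - n%:R)) / c.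
Proof.
elim: n => [|n IH]; first by rewrite big_ord0 addr0 subr0 subrr mul0r.
rewrite doubleS !big_ord_recr /= IH -!mulrDl; congr (_ / c).
rewrite /lattice_pt /= odd_double /= uphalf_double doubleK opprK.
have -> : t - n%:R - 1 = t - n.+1%:R by rewrite -natr1; ring.
have -> : t + n.+1%:R - 1 = t + n%:R by rewrite -natr1; ring.
ring.
Qed.

End Primitive.

Section TensorProducts.
Variables (R : realType) (N : nat) (w : R -> R).
Hypotheses (hN : (0 < N)%N) (hw : nqa_weight w).
Implicit Types (y : 'rV[R]_N) (s : seq 'I_N).

Variable psi : nat -> R -> R.
Hypothesis dpsi : forall k t, is_derive t (1 : R^o) (psi k : R -> R^o) (psi k.+1 t).
Hypothesis psi_bound : forall m a : R, 0 <= m -> 0 <= a -> exists C : R, forall k t,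
  `|psi k t| * expR (a * w `|t|) * J w m k <= C.

(** Counting the occurrences of each direction in [s] gives the order of differentiation in each
    variable; this is the jet of the product of the [psi 0]. *)
Definition tensor s y : R := \prod_i psi (count_mem i s) (y 0 i).

Lemma jet_tensor : jet tensor.
Proof.
move=> s i y; apply/ddx0_slice.
pose P := \prod_(j < N | j != i) psi (count_mem j s) (y 0 j).
have -> : (fun r => tensor s (y + r *: unitv R i) : R^o) =
    (fun r => P * psi (count_mem i s) (y 0 i + r) : R^o).
  apply/funext => r; rewrite /tensor (bigD1 i)//= mulrC; congr (_ * psi _ _).
    by apply: eq_bigr => j ji; rewrite !mxE eqxx/= (negbTE ji) mulr0 addr0.
  by rewrite !mxE !eqxx mulr1.
have -> : tensor (i :: s) y = P * psi (count_mem i s).+1 (y 0 i).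
  rewrite /tensor (bigD1 i)//= eqxx add1n mulrC; congr (_ * _).
  by apply: eq_bigr => j ji; rewrite eq_sym (negbTE ji) add0n.
have d1 : is_derive (y 0 i + 0) (1 : R^o) (psi (count_mem i s) : R -> R^o) (psi (count_mem i s).+1 (y 0 i)).
  by rewrite addr0; exact: dpsi.
have d0 : is_derive 0 (1 : R^o) (fun r => y 0 i + r : R^o) 1.
  have := @is_deriveD _ _ _ _ _ _ _ _ _ (is_derive_cst (y 0 i : R^o) (0 : R) (1 : R^o)) (is_derive_id (0 : R) (1 : R^o)).
  by rewrite add0r.
have := @is_derive1_comp R (psi (count_mem i s)) (fun r => y 0 i + r) 0 _ _ d1 d0.
rewrite mulr1 => /(@is_deriveZ R _ R^o _ P).
exact.
Qed.

Lemma J_sum m (k : 'I_N -> nat) : 0 <= m -> J w m (\sum_i k i) <= \prod_i J w m (k i).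
Proof.
move=> m0; apply: (@big_ind2 _ _ (fun n j => J w m n <= j)) => [|n1 j1 n2 j2 h1 h2|//].
  by rewrite J_le1.
by apply: le_trans (J_superadd hw _ _ m0) _; rewrite ler_pM ?J_ge0.
Qed.

Lemma w_enorm_le_sum : exists2 L, 1 <= L & forall y, w (enorm y) <= L * (1 + \sum_i w `|y 0 i|).
Proof.
have N1 : 1 <= N%:R :> R by rewrite ler1n.
have [L L1 hL] := w_scale hw N1; exists L => // y.
have [i hi] := enorm_le_coord y hN.
apply: (le_trans (nqa_nondecreasing hw (enorm_ge0 y) hi)).
apply: (le_trans (hL _ (normr_ge0 _))); rewrite ler_wpM2l//; first lra.
by rewrite lerD2l (bigD1 i)//= lerDl sumr_ge0// => j _; exact: w_ge0.
Qed.

Lemma SBr_tensor : SBr w (tensor [::]).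
Proof.
have [L L1 hL] := w_enorm_le_sum.
have bd m : 0 <= m -> exists c, forall s y, `|tensor s y| * expR (m * w (enorm y)) * J w m (size s) <= c.
  move=> m0; have mL : 0 <= m * L by rewrite mulr_ge0//; lra.
  have [C hC] := psi_bound m0 mL.
  exists (expR (m * L) * C ^+ N) => s y.
  have -> : size s = (\sum_i count_mem i s)%N.
    elim: s => [|j s IH] /=; first by rewrite big1.
    rewrite big_split /= -IH (bigD1 j)//= eqxx big1 ?addn0 ?add1n// => i ij.
    by rewrite eq_sym (negbTE ij).
  apply: (@le_trans _ _ (`|tensor s y| * (expR (m * L) * \prod_i expR (m * L * w `|y 0 i|)) *
      \prod_i J w m (count_mem i s))).
    apply: ler_pM; rewrite ?mulr_ge0 ?expR_ge0 ?J_ge0 ?J_sum//.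
    rewrite ler_wpM2l// -expR_sum -expRD ler_expR -mulr_sumr.
    have -> : m * L + m * L * (\sum_i w `|y 0 i|) = m * (L * (1 + \sum_i w `|y 0 i|)) by ring.
    exact: ler_wpM2l.
  rewrite /tensor normr_prod.
  have -> : \prod_i `|psi (count_mem i s) (y 0 i)| * (expR (m * L) * \prod_i expR (m * L * w `|y 0 i|)) *
      \prod_i J w m (count_mem i s) = expR (m * L) *
      \prod_i (`|psi (count_mem i s) (y 0 i)| * expR (m * L * w `|y 0 i|) * J w m (count_mem i s)).
    by rewrite !big_split /=; ring.
  rewrite ler_wpM2l ?expR_ge0//.
  rewrite (_ : C ^+ N = \prod_(i < N) C); last by rewrite prodr_const card_ord.
  by apply: ler_prod => i _; rewrite hC !mulr_ge0 ?expR_ge0 ?J_ge0.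
split.
  apply: (smooth_of_bounded jet_tensor) => s.
  have [m m0 hJ] := J_pos hw (size s); have [c hc] := bd m m0.
  exists (c / J w m (size s)) => y; rewrite ler_pdivlMr ?hJ//; apply: le_trans (hc s y).
  rewrite ler_wpM2r ?J_ge0// ler_peMr// -expR0 ler_expR mulr_ge0// w_enorm_ge0//.
move=> m m0; have [c hc] := bd m m0; exists c => s y.
by rewrite (jet_iter s jet_tensor).
Qed.

End TensorProducts.

Section Bump.
Variables (R : realType) (N : nat) (w : R -> R).
Hypotheses (hN : (0 < N)%N) (hw : nqa_weight w).
Implicit Types (v : 'rV[R]_N -> R) (y : 'rV[R]_N).

(** No compact support is sought. From a nonnegative rapidly decreasing [u] with primitive [W] and
    mass [c], the average (W(t) - W(t - 1)) / c of [u] over a unit window inherits the decay, and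
    its integer translates telescope to 1. *)
Lemma exists_bump v : SBr w v -> v 0 != 0 -> exists psi : R -> R,
  SBr w (fun y : 'rV[R]_N => \prod_i psi (y 0 i)) /\
  forall t e, 0 < e -> exists n0, forall n, (n0 <= n)%N ->
    `|\sum_(j < n.*2) psi (t - lattice_pt R j) - 1| <= e.
Proof.
move=> sv v0.
pose i0 := Ordinal hN.
(* The square makes the restriction to the first axis nonnegative and keeps it positive at 0. *)
pose vv y := v y * v y.
have sq : SBr w vv by exact: SBrM.
have [smq _] := sq.
pose u k (t : R) := iter_partial (nseq k i0) vv (t *: unitv R i0).
have du k t : is_derive t (1 : R^o) (u k : R -> R^o) (u k.+1 t).
  have := smooth_ddx i0 (0 + t *: unitv R i0) (smooth_iter (nseq k i0) smq).
  move=> /ddx_slice; rewrite add0r.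
  by under eq_fun do rewrite add0r.
have en t : enorm (t *: unitv R i0 : 'rV[R]_N) = `|t|.
  apply/eqP; rewrite eq_le enorm_unitv.
  by have := coord_le_enorm (t *: unitv R i0) i0; rewrite !mxE !eqxx mulr1.
have bu (m a : R) : 0 <= m -> exists2 C, 0 <= C & forall k t, `|u k t| * expR (a * w `|t|) * J w m k <= C.
  move=> m0; have [C C0 hC] := SBr_wbr hw a sq m0; exists C => // k t.
  by have := hC (nseq k i0) (t *: unitv R i0); rewrite size_nseq en.
have [A hA] : exists A, forall t, `|u 0%N t| <= A * kappa t.
  have [m0 [C [m00 C0 hC]]] := w_poly hw 2.
  have [B B0 hB] := bu 0 m0 (lexx 0).
  exists (B * C) => t; have := hB 0%N t; rewrite J0// mulr1 => h.
  rewrite /kappa ler_pdivlMr; last by rewrite ltr_pwDl// sqr_ge0.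
  apply: (@le_trans _ _ (`|u 0%N t| * (C * expR (m0 * w `|t|)))).
    rewrite ler_wpM2l//; apply: le_trans (hC _ (normr_ge0 t)).
    by rewrite sqrrD expr1n mul1r real_normK ?num_real// addrAC lerDl mulrn_wge0.
  by rewrite mulrCA mulrC ler_wpM2r// ltW.
have cu : continuous (u 0%N) by exact: (is_derive_continuous (du 0%N)).
have [W dW] := exists_primitive cu hA.
have u_ge0 t : 0 <= u 0%N t by rewrite /u /= /vv -expr2 sqr_ge0.
have u_gt0 : 0 < u 0%N 0 by rewrite /u /= scale0r /vv -expr2 exprn_even_gt0.
have [c c0 hc] := primitive_mass dW hA u_ge0 u_gt0.
pose Wk k := if k is k'.+1 then u k' else W.
have dWk k t : is_derive t (1 : R^o) (Wk k : R -> R^o) (Wk k.+1 t) by case: k => [|k]; [exact: dW|exact: du].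
pose psi k t := (Wk k t - Wk k (t - 1)) / c.
have dpsi k t : is_derive t (1 : R^o) (psi k : R -> R^o) (psi k.+1 t).
  have d0 : is_derive t (1 : R^o) (fun t => t - 1 : R^o) 1.
    have := @is_deriveD _ _ _ _ _ _ _ _ _ (is_derive_id t (1 : R^o)) (is_derive_cst (- 1 : R^o) t (1 : R^o)).
    by rewrite addr0.
  have d1 := @is_derive1_comp R (Wk k) (fun t => t - 1) t _ _ (dWk k (t - 1)) d0.
  rewrite mulr1 in d1.
  have d2 := @is_deriveD _ _ _ _ _ _ _ _ _ (dWk k t) (@is_deriveN _ _ _ _ _ _ _ d1).
  have := @is_deriveZ R _ R^o _ c^-1 _ _ _ d2.
  rewrite (_ : psi k.+1 t = c^-1 *: (Wk k.+1 t - Wk k.+1 (t - 1) : R^o)); last by rewrite /psi mulrC.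
  by congr (is_derive _ _ _ _); apply/funext => z; rewrite /psi mulrC.
have [K K1 hK] := w_add hw.
have bpsi (m a : R) : 0 <= m -> 0 <= a -> exists C : R, forall k t,
    `|psi k t| * expR (a * w `|t|) * J w m k <= C.
  move=> m0 a0; have [C C0 hC] := bu m (a * K) m0.
  exists (expR (a * K) * C / c) => k t.
  (* A unit difference of [Wk k] is a value of [u k] within distance 1, so the bounds carry over to
     [psi k] up to a constant in the weight. *)
  have [z /andP[z1 z2] ez] : exists2 z, t - 1 <= z <= t & Wk k t - Wk k (t - 1) = Wk k.+1 z * (t - (t - 1)).
    by apply: (mvt_real (dWk k)); rewrite gerBl.
  rewrite /psi ez opprB addrCA subrr addr0 mulr1 normrM (gtr0_norm (_ : 0 < c^-1)) ?invr_gt0//.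
  rewrite [leRHS]mulrAC mulrAC -[leLHS]mulrA -!mulrA [leLHS]mulrCA.
  rewrite (_ : expR (a * K) * (C / c) = c^-1 * (expR (a * K) * C)); last by ring.
  apply: ler_wpM2l; first by rewrite invr_ge0 ltW.
  apply: le_trans (ler_wpM2l (expR_ge0 _) (hC k z)).
  have : expR (a * w `|t|) <= expR (a * K) * expR (a * K * w `|z|).
    rewrite -expRD -[X in X + _]mulr1 -mulrDr ler_expR -mulrA ler_wpM2l//.
    have tz : `|t| <= `|z| + 1.
      rewrite -[t](subrK z) addrC; apply: (le_trans (ler_normD _ _)); rewrite lerD2l ger0_norm; lra.
    apply: (le_trans (nqa_nondecreasing hw (normr_ge0 _) tz)).
    apply: (le_trans (hK _ _ (normr_ge0 _) ler01)).
    by rewrite (nqa_vanish hw ler01 (lexx _)) addr0.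
  move=> h; rewrite /=.
  have -> : expR (a * K) * (`|u k z| * expR (a * K * w `|z|) * J w m k) =
    `|u k z| * (J w m k * (expR (a * K) * expR (a * K * w `|z|))) by ring.
  apply: ler_wpM2l => //; rewrite mulrC; apply: ler_wpM2l => //; exact: J_ge0.
exists (psi 0%N); split; first exact: (SBr_tensor hN hw dpsi bpsi).
move=> t e e0; have [n0 hn0] := hc t (e * c) (mulr_gt0 e0 c0).
exists n0 => n hn; rewrite /psi /= sum_lattice_pt.
have -> : (W (t + n%:R) - W (t - n%:R)) / c - 1 = (W (t + n%:R) - W (t - n%:R) - c) / c.
  by field; rewrite gt_eqF.
by rewrite normrM (gtr0_norm (_ : 0 < c^-1)) ?invr_gt0// ler_pdivrMr// hn0.
Qed.

End Bump.

(** * Extension of the functional *)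

Section Multiplication.
Variables (R : realType) (N : nat) (w : R -> R).
Hypotheses (hN : (0 < N)%N) (hw : nqa_weight w).
Implicit Types (f g F : cfun R N) (h u v : 'rV[R]_N -> R) (x y k : 'rV[R]_N).

Definition smul h F : cfun R N :=
  fun y => Complex (h y * complex.Re (F y)) (h y * complex.Im (F y)).

Lemma smulD h h' F : smul (h + h') F = smul h F + smul h' F.
Proof.
apply/funext => y; rewrite [RHS](_ : _ = smul h F y + smul h' F y)// /smul.
by rewrite [(h + h') y](_ : _ = h y + h' y)//; case: (F y) => a b /=; congr Complex; ring.
Qed.

Lemma smul0 F : smul 0 F = 0.
Proof. by apply/funext => y; rewrite /smul [(0 : _ -> _) y](_ : _ = 0)// !mul0r. Qed.

Lemma smul_sum (I : finType) (P : pred I) (h : I -> 'rV[R]_N -> R) F :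
  smul (\sum_(i | P i) h i) F = \sum_(i | P i) smul (h i) F.
Proof. exact: (big_morph (smul^~ F) (fun h h' => smulD h h' F) (smul0 F)). Qed.

Lemma smul_lin h (z : R[i]) f g : smul h (z *: f + g) = z *: smul h f + smul h g.
Proof.
apply/funext => y; rewrite [RHS](_ : _ = z * smul h f y + smul h g y)// /smul.
rewrite [(z *: f + g) y](_ : _ = z * f y + g y)//.
by case: z (f y) (g y) => a b [c d] [p q] /=; congr Complex; ring.
Qed.

Lemma wb_smul m : 0 <= m -> exists m' C, [/\ 0 <= m', 0 <= C & forall h F a a' c c',
  smooth_real h -> smooth F -> wbr w m' a c h -> wb w m' a' c' F ->
  wb w m (a + a') (C * (c * c')) (smul h F)].
Proof.
move=> m0; have [m' [C [m'0 C0 hC]]] := wbrM N hw m0; exists m', C; split => //.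
by move=> h F a a' c c' sh [sa sb] hh [ha hb]; split; apply: hC.
Qed.

Lemma SB_smul (n : nat) h F : SBr w h -> O_proj w n%:Z F -> SB w (smul h F).
Proof.
move=> sh /(O_projP hw)[sF hF]; have [smh _] := sh; apply: SB_of_smooth.
  by case: sF => sa sb; split; apply: smoothM.
move=> m m0; have [m' [C [m'0 C0 hC]]] := wb_smul m0.
have [c _ hc] := SBr_wbr hw (m + n%:R) sh m'0; have [c' hc'] := hF m' m'0.
exists (C * (c * c')); have := hC _ _ _ _ _ _ smh sF hc hc'.
by rewrite addrK.
Qed.

Lemma SBr_refl u x : SBr w u -> SBr w (fun y => u (x - y)).
Proof.
move=> [su hu]; split; first exact: smooth_refl.
move=> m m0; have [K K1 hK] := wbr_refl hN hw.
have [c c0 hc] := SBr_wbr hw (m * K) (conj su hu) m0.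
by eexists; apply: hK m0 su hc.
Qed.

Lemma wb_refl_growth : exists2 K, 1 <= K & forall m n c F x, 0 <= n -> smooth F ->
  wb w m (- n) c F -> wb w m (- (n * K)) (expR (n * K * (1 + w (enorm x))) * c) (refl x F).
Proof.
have [K K1 hK] := expR_w_add hN hw; exists K => // m n c F x n0 sf.
suff aux u : smooth_real u -> wbr w m (- n) c u ->
    wbr w m (- (n * K)) (expR (n * K * (1 + w (enorm x))) * c) (fun y => u (x - y)).
  by move: sf => [sa sb] [ha hb]; split; [exact: (aux (re_part F) sa ha)|exact: (aux (im_part F) sb hb)].
move=> su h s y; rewrite (iter_refl _ _ su) normrM normrX normrN1 expr1n mul1r.
have := h s (x - y); have := hK n x (- y) n0; rewrite enormN.
set X := `|_|; set Js := J _ _ _; set e2 := expR (_ * (1 + _)).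
rewrite !mulNr !expRN => he hc.
have XJ : 0 <= X * Js by rewrite mulr_ge0 ?J_ge0// /X.
rewrite mulrAC ler_pdivrMr ?expR_gt0//.
rewrite mulrAC ler_pdivrMr ?expR_gt0// in hc.
apply: (le_trans hc); rewrite mulrAC [leLHS]mulrC ler_wpM2r//.
by move: hc => /(le_trans XJ); rewrite pmulr_lge0 ?expR_gt0.
Qed.

Lemma wbD m a c c' f g : smooth f -> smooth g -> wb w m a c f -> wb w m a c' g -> wb w m a (c + c') (f + g).
Proof.
move=> sf sg hf hg; have := wb_lin 1 sf sg hf hg.
by rewrite scale1r /= normr1 normr0 addr0 mul1r.
Qed.

Lemma SBD f g : SB w f -> SB w g -> SB w (f + g).
Proof. by move=> sf sg; rewrite -[f]scale1r; exact: SB_lin. Qed.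

Lemma wb_sum m a (I : finType) (P : pred I) (c : I -> R) (g : I -> cfun R N) :
  (forall i, SB w (g i)) -> (forall i, P i -> wb w m a (c i) (g i)) ->
  wb w m a (\sum_(i | P i) c i) (\sum_(i | P i) g i).
Proof.
move=> sg hg.
suff [] : SB w (\sum_(i | P i) g i) /\ wb w m a (\sum_(i | P i) c i) (\sum_(i | P i) g i) by [].
apply: (@big_ind2 _ _ (fun f c => SB w f /\ wb w m a c f)) => [|f c1 f' c2 [s1 h1] [s2 h2]|i Pi].
- by split; [exact: SB0|exact: wb0].
- by split; [exact: SBD|exact: (wbD (SB_smooth s1) (SB_smooth s2) h1 h2)].
by split => //; exact: hg.
Qed.

End Multiplication.

(** * Lattice translates of the bump *)

Section LatticeCutoff.
Variables (R : realType) (N : nat) (w : R -> R).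
Hypotheses (hN : (0 < N)%N) (hw : nqa_weight w).
Variable psi : R -> R.
Hypothesis bump_SBr : SBr w (fun y : 'rV[R]_N => \prod_i psi (y 0 i)).
Hypothesis psi_sum : forall t e, 0 < e -> exists n0, forall n, (n0 <= n)%N ->
  `|\sum_(j < n.*2) psi (t - lattice_pt R j) - 1| <= e.
Implicit Types (y k : 'rV[R]_N).

(* The bump is reflected so that its translates [bump k] are of the form [y |-> g (k - y)]
   occurring in the convolution. *)
Definition chi_opp y : R := \prod_i psi (- y 0 i).

Definition lattice n (kap : {ffun 'I_N -> 'I_n}) : 'rV[R]_N := \row_i lattice_pt R (kap i).

Definition bump k y : R := chi_opp (k - y).

(** A product of one-dimensional partial sums: expanding it gives the sum of the bumps over a
    lattice cube ([theta_sum]), while convergence to 1 is read off the factors. *)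
Definition theta n y : R := \prod_i \sum_(j < n.*2) psi (y 0 i - lattice_pt R j).

Definition outer n : pred {ffun 'I_N -> 'I_n.+1.*2} := fun kap => ~~ [forall i, (kap i < n.*2)%N].

Lemma SBr_chi_opp : SBr w chi_opp.
Proof.
have := SBr_refl hN hw 0 bump_SBr.
rewrite (_ : (fun y : 'rV[R]_N => _) = chi_opp)//.
by apply/funext => y; apply: eq_bigr => i _; rewrite !mxE add0r.
Qed.

Lemma SBr_bump k : SBr w (bump k). Proof. exact: SBr_refl SBr_chi_opp. Qed.

Lemma bump_lattice n (kap : {ffun 'I_N -> 'I_n}) y :
  bump (lattice kap) y = \prod_i psi (y 0 i - lattice_pt R (kap i)).
Proof. by apply: eq_bigr => i _; rewrite !mxE opprB. Qed.

Lemma theta_sum n : theta n = \sum_(kap : {ffun 'I_N -> 'I_n.*2}) bump (lattice kap).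
Proof.
apply/funext => y; rewrite fct_sumE /theta bigA_distr_bigA.
by apply: eq_bigr => kap _; rewrite bump_lattice.
Qed.

Lemma theta_step n : theta n.+1 = theta n + \sum_(kap | outer kap) bump (lattice (kap : {ffun 'I_N -> 'I_n.+1.*2})).
Proof.
rewrite theta_sum (bigID (@outer n))/= addrC; congr (_ + _).
apply/funext => y; rewrite fct_sumE /theta.
have nn : (n.*2 <= n.+1.*2)%N by rewrite leq_double.
under [RHS]eq_bigr => i _ do rewrite (big_ord_widen _ (fun j => psi (y 0 i - lattice_pt R j)) nn).
rewrite bigA_distr_big; apply: eq_big => [kap|kap _]; last exact: bump_lattice.
rewrite /outer negbK; apply/forallP/ffun_onP => h i; exact: h.
Qed.

Lemma SBr_theta n : SBr w (theta n).
Proof.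
rewrite theta_sum; apply: (big_ind (SBr w)) => [|u v su sv|i _].
- exact: SBr0.
- exact: SBrD.
exact: SBr_bump.
Qed.

Lemma theta0 : theta 0 = 0.
Proof. by apply/funext => y; rewrite /theta (bigD1 (Ordinal hN))//= big_ord0 mul0r. Qed.

Lemma theta_cvg y e : 0 < e -> exists n0, forall n, (n0 <= n)%N -> `|theta n y - 1| <= e.
Proof.
move=> e0.
have c i : (\sum_(j < n.*2) psi (y 0 i - lattice_pt R j) : R^o) @[n --> \oo] --> (1 : R^o).
  apply/cvgrPdist_le => d d0; have [n0 h] := psi_sum (y 0 i) d0.
  by exists n0 => // n /= hn; rewrite distrC h.
have : (theta n y : R^o) @[n --> \oo] --> (1 : R^o).
  rewrite (_ : 1 = \prod_(i < N) 1); last by rewrite big1.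
  rewrite /theta; elim: (index_enum _) => [|i r IH].
    by rewrite big_nil; under eq_fun do rewrite big_nil; exact: cvg_cst.
  by rewrite big_cons; under eq_fun do rewrite big_cons; exact: cvgM.
move=> /cvgrPdist_le/(_ e e0)[n0 _ h].
by exists n0 => n hn; rewrite distrC; exact: h.
Qed.

(** A lattice point outside the smaller cube has a coordinate of size at least n, and the larger
    cube has (2(n + 1))^N points. The power N + 2 in [w_poly] therefore leaves (n + 1)^-2,
    comparable to the telescoping difference up to a factor 2. *)
Lemma outer_sum : exists p C, [/\ 0 <= p, 0 < C & forall n,
  \sum_(kap | @outer n kap) (expR (p * w (enorm (lattice kap))))^-1 <= C * (inv_succ R n - inv_succ R n.+1)].
Proof.
have [p [C [p0 C0 hC]]] := w_poly hw (N + 2).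
exists p, (C * 2 ^+ N * 2); split => //; first by rewrite !mulr_gt0// exprn_gt0.
move=> n; set a : R := n.+1%:R; have a0 : 0 < a by rewrite ltr0n.
have bd kap : @outer n kap -> (expR (p * w (enorm (lattice kap))))^-1 <= C / a ^+ (N + 2).
  rewrite /outer negb_forall => /existsP[j]; rewrite -leqNgt => hj.
  rewrite -[leLHS]mul1r ler_pdivrMr ?expR_gt0// mulrAC ler_pdivlMr ?exprn_gt0// mul1r.
  apply: le_trans (hC _ (enorm_ge0 _)); rewrite lerXn2r ?nnegrE ?(ltW a0)//.
    by rewrite addr_ge0// enorm_ge0.
  rewrite /a -natr1 addrC lerD2l; apply: le_trans (lattice_pt_abs R hj) _.
  by have := coord_le_enorm (lattice kap) j; rewrite mxE.
apply: (@le_trans _ _ (\sum_(kap : {ffun 'I_N -> 'I_n.+1.*2}) C / a ^+ (N + 2))).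
  apply: (@le_trans _ _ (\sum_(kap | @outer n kap) C / a ^+ (N + 2))); first exact: ler_sum.
  rewrite [leRHS](bigID (@outer n))/= lerDl sumr_ge0// => kap _.
  by apply/ltW/divr_gt0 => //; rewrite exprn_gt0.
rewrite sumr_const card_ffun !card_ord -[leLHS]mulr_natl -mul2n natrX natrM exprMn -/a inv_succ_diff -/a.
rewrite -[n.+2%:R]natr1 -/a.
have -> : 2 ^+ N * a ^+ N * (C / a ^+ (N + 2)) = C * 2 ^+ N * (a * a)^-1.
  by rewrite exprD; field; rewrite !gt_eqF ?exprn_gt0.
rewrite -[leRHS]mulrA ler_wpM2l ?mulr_ge0 ?exprn_ge0 ?(ltW C0)//.
rewrite ler_pdivlMr ?mulr_gt0//; last by lra.
rewrite mulrC ler_pdivrMr ?mulr_gt0//.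
have : 1 <= a by rewrite ler1n.
nra.
Qed.

End LatticeCutoff.

Section Extension.
Variables (R : realType) (N : nat) (w : R -> R).
Hypotheses (hN : (0 < N)%N) (hw : nqa_weight w).
Variable T : cfun R N -> (R[i])^o.
Hypothesis hT : S_dual w T.
Hypothesis hC : forall f : cfun R N, S_space w f -> S_space w (convol T f).
Implicit Types (f g F : cfun R N) (x y k : 'rV[R]_N).

Lemma T_linear (z : R[i]) f g : SB w f -> SB w g -> T (z *: f + g) = z * T f + T g.
Proof. by move=> sf sg; have [lT _] := hT; exact: (SB_linear_on hN hw lT). Qed.

Lemma T_zero : T 0 = 0.
Proof. by have [lT _] := hT; exact: (linear_on0 lT (S_space0 hN hw)). Qed.

Lemma T_sum (I : finType) (P : pred I) (g : I -> cfun R N) : (forall i, SB w (g i)) ->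
  T (\sum_(i | P i) g i) = \sum_(i | P i) T (g i).
Proof.
move=> sg.
suff [] : SB w (\sum_(i | P i) g i) /\ T (\sum_(i | P i) g i) = \sum_(i | P i) T (g i) by [].
apply: (@big_ind2 _ _ (fun f t => SB w f /\ T f = t)) => [|f t f' t' [s1 <-] [s2 <-]|i Pi].
- by split; [exact: SB0|exact: T_zero].
- by split; [exact: SBD|rewrite -[f in T (f + _)]scale1r T_linear// mul1r].
by split.
Qed.

Lemma cmod_sum (I : finType) (P : pred I) (z : I -> R[i]) :
  cmod (\sum_(i | P i) z i) <= \sum_(i | P i) cmod (z i).
Proof.
apply: (big_ind2 (fun (a : R[i]) (b : R) => cmod a <= b)) => [|a b a' b' h h'|//].
  by rewrite cmod0.
exact: le_trans (cmodD _ _) (lerD h h').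
Qed.

(** [uniform_bound] is applied to the family indexed by the points [x], with the weight included in
    [L x]: property (2) gives pointwise boundedness, and continuity of [T] bounds each single
    member. *)
Lemma convol_decay lam : 0 <= lam -> exists M C, [/\ 0 <= M, 0 <= C &
  forall f c x, SB w f -> wb w M M c f ->
    cmod (convol T f x) * expR (lam * w (enorm x)) <= C * c].
Proof.
move=> lam0.
have [M0 [M00 [C0 C00 hb]]] := S_dual_bound hN hw hT.
have [K K1 hK] := wb_refl hN hw.
pose L x f : R[i] := Complex (expR (lam * w (enorm x))) 0 * convol T f x.
have Lmod x f : cmod (L x f) = cmod (convol T f x) * expR (lam * w (enorm x)).
  by rewrite /L cmodM cmod_real ger0_norm ?expR_ge0// mulrC.
have [x z f g sf sg|x|f sf|M [C h]] := @uniform_bound R N w hw _ L.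
- rewrite /L /convol; have := T_linear z (SB_refl hN hw x sf) (SB_refl hN hw x sg).
  rewrite /refl => e; rewrite [X in T X](_ : _ = z *: (fun y => f (x - y)) + (fun y => g (x - y)))//.
  by rewrite e mulrDr mulrCA.
- pose M := (Num.trunc (M0%:R * K)).+1.
  have hM : M0%:R * K <= M%:R by apply/ltW/Num.Theory.truncnS_gt.
  have M0M : M0%:R <= M%:R :> R by apply: le_trans hM; rewrite ler_peMr.
  exists M, (C0 * expR (M0%:R * K * (1 + w (enorm x))) * expR (lam * w (enorm x))).
  split; first by rewrite !mulr_ge0 ?expR_ge0.
  move=> f c sf hf; rewrite Lmod [leRHS]mulrAC ler_wpM2r ?expR_ge0// -[leRHS]mulrA.
  apply: hb; first exact: SB_refl.
  apply: hK => //; first exact: SB_smooth sf.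
  exact: wb_mono hf.
- have [ra rb] : SB w (convol T f) by apply/(S_spaceP hN hw)/hC/(S_spaceP hN hw).
  have [_ /(_ lam [::] lam0)[a ha]] := SBr_RD hw ra.
  have [_ /(_ lam [::] lam0)[b hb']] := SBr_RD hw rb.
  exists (a + b) => x; rewrite Lmod; apply: le_trans (lerD (ha x) (hb' x)).
  by rewrite -mulrDl ler_wpM2r ?expR_ge0//; exact: cmod_le.
exists M%:R, `|C|; split => // f c x sf hf; rewrite -Lmod.
by apply: (le_trans (h x f c sf hf)); rewrite ler_wpM2r ?ler_norm// (wb_ge0 hf).
Qed.

Variable psi : R -> R.
Hypothesis bump_SBr : SBr w (fun y : 'rV[R]_N => \prod_i psi (y 0 i)).
Hypothesis psi_sum : forall t e, 0 < e -> exists n0, forall n, (n0 <= n)%N ->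
  `|\sum_(j < n.*2) psi (t - lattice_pt R j) - 1| <= e.

Notation bmp := (@bump R N psi).
Notation th := (@theta R N psi).

(** [T] applied to a localized [F] is the value at [k] of a convolution whose second argument
    depends on [k]. Reflecting [F] at [k] costs exp (n0 K w(k)), so [convol_decay] is used with
    exponent [p + n0 * K], leaving decay of order [p]. *)
Lemma bump_estimate p (n0 : nat) : 0 <= p -> exists (M : nat) C, [/\ (0 < M)%N, 0 <= C &
  forall F c k, O_proj w n0%:Z F -> wb w M%:R (- n0%:R) c F ->
    cmod (T (smul (bmp k) F)) * expR (p * w (enorm k)) <= C * c].
Proof.
move=> p0.
have [K K1 hK] := wb_refl_growth hN hw.
have n0K : 0 <= n0%:R * K by rewrite mulr_ge0//; lra.
have [M1 [C1 [M10 C10 h1]]] := convol_decay (addr_ge0 p0 n0K).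
have [M2 [C2 [M20 C20 h2]]] := wb_smul N hw M10.
have schi := SBr_chi_opp hN hw bump_SBr.
have [cc cc0 hcc] := SBr_wbr hw (M1 + n0%:R * K) schi M20.
pose M := (Num.trunc M2).+1.
have hM : M2 <= M%:R by apply/ltW/Num.Theory.truncnS_gt.
exists M, (C1 * C2 * cc * expR (n0%:R * K)); split => //; first by rewrite !mulr_ge0 ?expR_ge0.
move=> F c k OF hF; have [sF _] : smooth F /\ True by split => //; case: ((O_projP hw n0 F).1 OF).
have {}hF : wb w M2 (- n0%:R) c F by apply: wb_mono hF.
have hR := hK _ _ _ _ k (ler0n R n0) sF hF.
have := h2 _ _ _ _ _ _ (proj1 schi) (smooth_refl_cfun k sF) hcc hR.
rewrite addrK => hg.
have e : smul (bmp k) F = refl k (smul (chi_opp psi (N := N)) (refl k F)).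
  by apply/funext => y; rewrite /refl /smul subKr.
have sg : SB w (smul (chi_opp psi (N := N)) (refl k F)).
  have -> : smul (chi_opp psi (N := N)) (refl k F) = refl k (smul (bmp k) F).
    by apply/funext => y; rewrite /refl /smul /bump subKr.
  by apply: SB_refl => //; apply: (SB_smul hw) OF; exact: SBr_bump.
have := h1 _ _ k sg hg.
rewrite [convol _ _ _](_ : _ = T (smul (bmp k) F)); last by rewrite e.
set X := cmod _; rewrite mulrDl expRD.
have -> : n0%:R * K * (1 + w (enorm k)) = n0%:R * K + n0%:R * K * w (enorm k) by ring.
rewrite expRD; set E1 := expR (p * _); set E2 := expR (_ * w _); set E3 := expR (_ * K).
have E20 : 0 < E2 := expR_gt0 _.
rewrite (_ : C1 * (C2 * (cc * (E3 * E2 * c))) = C1 * C2 * cc * E3 * c * E2); last by ring.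
by rewrite mulrA ler_pM2r.
Qed.

(** For [f] in the space S the localized pieces decay in every seminorm, not merely under [T]; this
    gives convergence of the cutoffs of [f] in S. *)
Lemma bump_seminorm f m p : SB w f -> 0 <= m -> 0 <= p -> exists2 C, 0 <= C & forall k,
  wb w m m (C * (expR (p * w (enorm k)))^-1) (smul (bmp k) f).
Proof.
move=> sf m0 p0.
have [K K1 hK] := wb_refl_neg hN hw.
have pK0 : 0 <= p * K by rewrite mulr_ge0//; lra.
have [M2 [C2 [M20 C20 h2]]] := wb_smul N hw m0.
have schi := SBr_chi_opp hN hw bump_SBr.
pose cchi_opp : cfun R N := fun y => Complex (chi_opp psi y) 0.
have scchi_opp : SB w cchi_opp by split => //; exact: SBr0.
have [cc cc0 hcc] := SB_wb hw (p * K) scchi_opp M20.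
have [cf cf0 hcf] := SB_wb hw (m + p * K) sf M20.
exists (C2 * expR (p * K) * cc * cf); first by rewrite !mulr_ge0 ?expR_ge0.
move=> k; have [hb _] := hK _ _ _ _ _ k p0 (lexx _) (SB_smooth scchi_opp) hcc.
have := h2 (bmp k) f _ _ _ _ _ (SB_smooth sf) hb hcf.
rewrite (_ : - (p * K) + (m + p * K) = m); last by ring.
rewrite (_ : C2 * (_ * cf) = C2 * expR (p * K) * cc * cf * (expR (p * w (enorm k)))^-1); last by ring.
by apply; case: (SBr_bump hN hw bump_SBr k).
Qed.

(** Convergence with rate 1 / (n + 1) and a free constant: the relation is stable under linear
    combinations and determines [l]. *)
Definition approx F (l : R[i]) := exists C, forall n, cmod (l - T (smul (th n) F)) <= C * inv_succ R n.

(* The junk value 0 is taken when the cutoffs do not converge. *)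
Definition ext F : (R[i])^o := xget 0 [set l | approx F l].

Lemma approx_unique F l l' : approx F l -> approx F l' -> l = l'.
Proof.
move=> [C h] [C' h']; apply/eqP; rewrite -subr_eq0; apply/eqP/ComplexField.Normc.eq0_normc.
apply/eqP; rewrite eq_le cmod_ge0 andbT.
apply: (@le_of_le_inv_succ R 0%N _ _ (C + C')) => n _; rewrite add0r mulrDl.
rewrite -[l - l'](subrKA (T (smul (th n) F))).
apply: (le_trans (cmodD _ _)); rewrite lerD// cmodB; exact: h'.
Qed.

Lemma ext_eq F l : approx F l -> ext F = l.
Proof.
move=> h; have := @xgetPex _ (0 : R[i]) [set l | approx F l] (ex_intro _ l h).
by move=> /approx_unique; apply.
Qed.

Lemma T_theta_step (n0 : nat) F n : O_proj w n0%:Z F ->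
  T (smul (th n.+1) F) = T (smul (th n) F) +
    \sum_(kap | @outer N n kap) T (smul (bmp (lattice R (kap : {ffun 'I_N -> 'I_n.+1.*2}))) F).
Proof.
move=> OF; rewrite theta_step smulD smul_sum.
have sb k : SB w (smul (bmp k) F) by apply: (SB_smul hw) OF; exact: SBr_bump.
rewrite -[smul (th n) F]scale1r T_linear ?mul1r; [|apply: (SB_smul hw) OF; exact: SBr_theta|].
  by rewrite scale1r T_sum.
by apply: (big_ind (SB w)) => [|u v su sv|i _]; [exact: SB0|exact: SBD|].
Qed.

Lemma complex_tail_lim (a : nat -> R[i]) C : 0 <= C ->
  (forall n, cmod (a n.+1 - a n) <= C * (inv_succ R n - inv_succ R n.+1)) ->
  exists l, forall n, cmod (l - a n) <= (C + C) * inv_succ R n.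
Proof.
move=> C0 h.
have [p hp] : exists p, forall n, (0 <= n)%N -> `|p - complex.Re (a n)| <= C * inv_succ R n.
  apply: tail_lim => // n _; apply: le_trans (h n).
  by case: (a n.+1) (a n) => b c [d e] /=; exact: (Re_le_cmod (Complex (b - d) _)).
have [q hq] : exists q, forall n, (0 <= n)%N -> `|q - complex.Im (a n)| <= C * inv_succ R n.
  apply: tail_lim => // n _; apply: le_trans (h n).
  by case: (a n.+1) (a n) => b c [d e] /=; exact: (Im_le_cmod (Complex _ (c - e))).
exists (Complex p q) => n; rewrite mulrDl; apply: le_trans (lerD (hp n isT) (hq n isT)).
by case: (a n) => b c; exact: cmod_le.
Qed.

(** [M] and [C] depend on [n0] only and the bound is linear in [c]; this uniformity is what
    continuity of [ext] requires. The increments in [n] are sums over the shells of [outer], which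
    [outer_sum] makes telescoping. *)
Lemma ext_estimate (n0 : nat) : exists (M : nat) C, [/\ (0 < M)%N, 0 <= C &
  forall F c, O_proj w n0%:Z F -> wb w M%:R (- n0%:R) c F ->
    forall n, cmod (ext F - T (smul (th n) F)) <= C * c * inv_succ R n].
Proof.
have [p [D [p0 D0 hD]]] := outer_sum N hw.
have [M [C [M0 C0 h]]] := bump_estimate n0 p0.
exists M, (C * D + C * D); split => //; first by rewrite addr_ge0 ?mulr_ge0// ltW.
move=> F c OF hF; have c0 := wb_ge0 hF.
have CDc0 : 0 <= C * D * c by rewrite !mulr_ge0// ltW.
have [l hl] : exists l, forall n, cmod (l - T (smul (th n) F)) <= (C * D * c + C * D * c) * inv_succ R n.
  apply: complex_tail_lim => // n; rewrite (T_theta_step _ OF) addrAC subrr add0r.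
  apply: (le_trans (cmod_sum _ _)).
  apply: (@le_trans _ _ (\sum_(kap | @outer N n kap) C * c * (expR (p * w (enorm (lattice R kap))))^-1)).
    apply: ler_sum => kap _; rewrite ler_pdivlMr ?expR_gt0//; exact: h.
  rewrite -mulr_sumr; apply: (@le_trans _ _ (C * c * (D * (inv_succ R n - inv_succ R n.+1)))).
    by rewrite ler_wpM2l// mulr_ge0.
  by rewrite le_eqVlt; apply/orP; left; apply/eqP; ring.
have -> : ext F = l by apply: ext_eq; exists (C * D * c + C * D * c).
by rewrite -mulrDl in hl.
Qed.

Lemma O_proj_approx (n0 : nat) F : O_proj w n0%:Z F -> approx F (ext F).
Proof.
move=> OF; have [M [C [M0 C0 h]]] := ext_estimate n0.
have [_ hF] := (O_projP hw n0 F).1 OF.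
have [c hc] := hF M%:R (ler0n _ _).
by exists (C * c) => n; exact: h.
Qed.

Lemma ext_bound (n0 : nat) : exists (M : nat) C, [/\ (0 < M)%N, 0 <= C &
  forall F c, O_proj w n0%:Z F -> wb w M%:R (- n0%:R) c F -> cmod (ext F) <= C * c].
Proof.
have [M [C [M0 C0 h]]] := ext_estimate n0; exists M, C; split => // F c OF hF.
have := h F c OF hF 0%N; rewrite theta0// smul0 T_zero subr0.
by rewrite /inv_succ invr1 mulr1.
Qed.

Lemma O_proj_mono (n n' : nat) F : (n <= n')%N -> O_proj w n%:Z F -> O_proj w n'%:Z F.
Proof.
move=> nn /(O_projP hw)[sF h]; apply/(O_projP hw); split => // m m0.
by have [c hc] := h m m0; exists c; apply: wb_mono hc => //; rewrite lerN2 ler_nat.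
Qed.

Lemma O_proj_lin (n : nat) (z : R[i]) f g : O_proj w n%:Z f -> O_proj w n%:Z g ->
  O_proj w n%:Z (z *: f + g).
Proof.
move=> /(O_projP hw)[sf hf] /(O_projP hw)[sg hg]; apply/(O_projP hw).
split; first exact: smooth_lin.
move=> m m0; have [c hc] := hf m m0; have [d hd] := hg m m0.
by eexists; apply: wb_lin hc hd.
Qed.

Lemma OC_common f g : OC_space w f -> OC_space w g ->
  exists n : nat, [/\ (0 < n)%N, O_proj w n%:Z f & O_proj w n%:Z g].
Proof.
move=> [n [n0 hf]] [n' [n'0 hg]]; exists (maxn n n'); split.
- by rewrite leq_max n0.
- by apply: O_proj_mono hf; exact: leq_maxl.
by apply: O_proj_mono hg; exact: leq_maxr.
Qed.

Lemma OC_space0 : OC_space w (0 : cfun R N).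
Proof. by exists 1%N; split; [|exact: (SB_O_proj hw 1 (SB0 N w))]. Qed.

Lemma OC_space_lin (a b : R[i]) f g : OC_space w f -> OC_space w g -> OC_space w (a *: f + b *: g).
Proof.
move=> Of Og; have [n [n0 h1 h2]] := OC_common Of Og; exists n; split; first exact: n0.
apply: O_proj_lin; first exact: h1.
by rewrite -[b *: g]addr0; apply: O_proj_lin; [exact: h2|exact: (SB_O_proj hw n (SB0 N w))].
Qed.

Lemma ext_linear : linear_on (OC_space w) ext.
Proof.
move=> z f g /OC_common /[apply] -[n [n0 Of Og]].
have [C h] := O_proj_approx Of; have [D h'] := O_proj_approx Og.
apply: ext_eq; exists (cmod z * C + D) => k.
have st := SBr_theta hN hw bump_SBr k.
rewrite smul_lin T_linear; [|exact: (SB_smul hw) st Of|exact: (SB_smul hw) st Og].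
have -> : z *: ext f + ext g - (z * T (smul (th k) f) + T (smul (th k) g)) =
    z * (ext f - T (smul (th k) f)) + (ext g - T (smul (th k) g)).
  by rewrite [z *: ext f](_ : _ = z * ext f)// mulrBr opprD addrACA.
apply: (le_trans (cmodD _ _)); rewrite cmodM mulrDl lerD// -mulrA.
by rewrite ler_wpM2l// cmod_ge0.
Qed.

(** The cutoffs of [f] converge in S by completeness, and their pointwise limit identifies the
    result as [f]; continuity of [T] then passes to the limit with the required rate. *)
Lemma ext_S f : SB w f -> ext f = T f.
Proof.
move=> sf; apply: ext_eq.
have [p [D [p0 D0 hD]]] := outer_sum N hw.
have st n : SB w (smul (th n) f).
  by apply: (SB_smul hw) (SB_O_proj hw 0 sf); exact: SBr_theta.
have sb k : SB w (smul (bmp k) f).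
  by apply: (SB_smul hw) (SB_O_proj hw 0 sf); exact: SBr_bump.
have inc m : 0 <= m -> exists C, forall n, wb w m m (C * (inv_succ R n - inv_succ R n.+1)) (smul (th n.+1) f - smul (th n) f).
  move=> m0; have [C C0 h] := bump_seminorm sf m0 p0.
  exists (C * D) => n; rewrite theta_step smulD smul_sum addrAC subrr add0r.
  have := wb_sum (P := @outer N n) (g := fun kap => smul (bmp (lattice R kap)) f)
    (c := fun kap => C * (expR (p * w (enorm (lattice R kap))))^-1) _ _.
  move=> /(_ w m m (fun=> sb _) (fun kap _ => h _)); apply: le_wb.
  by rewrite -mulr_sumr -mulrA ler_wpM2l.
have [n|m m0|g [sg hg]] := @S_complete R N w hw (fun n => smul (th n) f).
- exact: st.
- by have [C h] := inc m m0; exists 0%N, C => n _; exact: h.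
(* Order 0 with [m = a = 0] is plain uniform convergence, to be compared with [theta_cvg]. *)
have eg : g = f.
  have [C h] := inc 0 (lexx 0).
  have hn n : wb w 0 0 (C * inv_succ R n) (g - smul (th n) f) by apply: hg => k _; exact: h.
  suff aux (a b : 'rV[R]_N -> R) : (forall n, wbr w 0 0 (C * inv_succ R n) (a \+ (fun x => -1 * (th n x * b x)))) -> a = b.
    have ere : re_part g = re_part f.
      by apply: aux => n; have [hr _] := hn n; rewrite re_sub in hr.
    have eim : im_part g = im_part f.
      by apply: aux => n; have [_ hi] := hn n; rewrite im_sub in hi.
    apply/funext => x; have := congr1 (@^~ x) ere; have := congr1 (@^~ x) eim.
    by rewrite /re_part /im_part; case: (g x) (f x) => ? ? [? ?] /= -> ->.
  move=> hab; apply/funext => x; apply/eqP; rewrite -subr_eq0 -normr_le0.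
  apply/ler_addgt0Pr => e e0; rewrite add0r.
  have B0 : 0 < `|b x| + 1 by rewrite ltr_wpDl.
  have [n0 hn0] := theta_cvg psi_sum x (divr_gt0 e0 B0).
  apply: (@le_of_le_inv_succ R n0 _ _ C) => n nn0.
  have := hab n [::] x; rewrite /= mul0r expR0 J0// !mulr1 mulN1r => h1.
  rewrite (_ : a x - b x = (th n x - 1) * b x + (a x - th n x * b x)); last by ring.
  apply: (le_trans (ler_normD _ _)); rewrite lerD// normrM.
  apply: (@le_trans _ _ (e / (`|b x| + 1) * `|b x|)); first by rewrite ler_wpM2r// hn0.
  by rewrite mulrAC ler_pdivrMr// ler_wpM2l ?(ltW e0)// lerDl.
have [M [M0 [C C0 hb]]] := S_dual_bound hN hw hT.
have [c h] := inc M%:R (ler0n _ _).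
exists (C * c) => n.
have hn : wb w M%:R M%:R (c * inv_succ R n) (f - smul (th n) f).
  by have := hg M%:R M%:R c n (fun j _ => h j); rewrite eg.
have sd : SB w (f - smul (th n) f) := SB_sub sf (st n).
have := hb _ _ sd hn; rewrite mulrA; apply: le_trans.
have e := T_linear 1 sd (st n); rewrite scale1r subrK mul1r in e.
by rewrite e addrK.
Qed.

Lemma ext_continuous F : OC_space w F -> ext @ OC_nbhs w F --> ext F.
Proof.
move=> OF A /nbhs_complex[e e0 hA].
(* The preimage of the disc of radius [e] is absolutely convex by linearity, and [ext_bound] makes
   it a neighbourhood of 0 in each step of the inductive limit. *)
exists [set v | OC_space w v /\ cmod (ext v : R[i]) < e]; split.
- move=> a b f g ab [Of hf] [Og hg].
  have O1 : OC_space w (b *: g) by have := OC_space_lin 0 b Og Og; rewrite scale0r add0r.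
  split; first exact: OC_space_lin.
  have e1 := ext_linear a Of O1.
  have e2 := @linear_onZ R N (OC_space w) ext b g ext_linear OC_space0 Og.
  rewrite e1 e2.
  apply: (le_lt_trans (cmodD _ _)); rewrite [a *: ext f](_ : _ = a * ext f)// !cmodM.
  have a0 := cmod_ge0 a; have b0 := cmod_ge0 b.
  pose m := Num.max (cmod (ext f : R[i])) (cmod (ext g : R[i])).
  have me : m < e by rewrite gt_max hf.
  have m0 : 0 <= m by rewrite le_max cmod_ge0.
  apply: (@le_lt_trans _ _ m) => //.
  apply: (@le_trans _ _ ((cmod a + cmod b) * m)); last by rewrite ler_piMl.
  by rewrite mulrDl lerD// ler_wpM2l// le_max lexx ?orbT.
- by move=> v [].
- move=> n n0; have [M [C [M0 C0 h]]] := ext_bound n.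
  have C1 : 0 < C + 1 by lra.
  exists [:: M], (e / (C + 1)); split; first by rewrite divr_gt0.
  move=> g Og hg; split; first by exists n.
  have hM := hg M (mem_head _ _) M0; rewrite subr0 in hM.
  have [sg _] := (O_projP hw n g).1 Og.
  have := gnorm_ge M0 sg (ltW hM) => hw'.
  apply: (le_lt_trans (h _ _ Og hw')).
  by rewrite mulrA mulrAC -[ltRHS]mul1r ltr_pM2r// ltr_pdivrMr// mul1r ltrDl.
move=> v [Ov hv]; apply: hA.
have := ext_linear 1 OF Ov; rewrite !scale1r => ->.
rewrite opprD addrA subrr add0r cmodN.
exact: hv.
Qed.

End Extension.

(** * From the convolution property to the dual of [OC_space] *)

Section MainTheorem.
Variables (R : realType) (N : nat) (w : R -> R).
Hypotheses (hN : (0 < N)%N) (hw : nqa_weight w).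

(** The degenerate case: a linear functional on the zero space is extended by the zero
    functional. *)
Lemma OC_dual_trivial (T : cfun R N -> (R[i])^o) : S_dual w T -> (forall f : cfun R N, SB w f -> f = 0) -> in_OC_dual w T.
Proof.
move=> [lT _] h0; pose T0 : cfun R N -> (R[i])^o := fun=> 0; exists T0; split.
  split; first by move=> z f g _ _; rewrite /T0 scaler0 addr0.
  move=> F OF A /nbhs_complex[e e0 hA].
  have A0 v : A (T0 (F + v)) by apply: hA; rewrite /T0 subrr cmod0.
  exists (OC_space w); split.
  - by move=> a b f g _; exact: (OC_space_lin hw).
  - by move=> f Of.
  - by move=> n n0; exists [::], 1; split => // g Og _; exists n; split.
  exact (fun v _ => A0 v).
move=> f /(S_spaceP hN hw)/h0 ->; apply/esym; apply: linear_on0 lT _.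
exact: S_space0.
Qed.

Lemma in_OC_dual_of_convol (T : cfun R N -> (R[i])^o) : S_dual w T ->
  (forall f : cfun R N, S_space w f -> S_space w (convol T f)) -> in_OC_dual w T.
Proof.
move=> hT hC.
have [[v [sv v0]]|nv] := pselect (exists v : 'rV[R]_N -> R, SBr w v /\ v 0 != 0); last first.
  apply: OC_dual_trivial => // f [sa sb].
  suff aux (u : 'rV[R]_N -> R) : SBr w u -> u = fun=> 0.
    apply/funext => x; have := congr1 (@^~ x) (aux (re_part f) sa); have := congr1 (@^~ x) (aux (im_part f) sb).
    by rewrite /re_part /im_part; case: (f x) => ? ? /= -> ->.
  move=> su; apply/funext => x; apply: contrapT => ux; apply: nv.
  (* A reflected translate moves a nonzero value to the origin, as [exists_bump] requires. *)
  exists (fun y => u (x - y)); split; first exact: SBr_refl.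
  by rewrite subr0; apply/eqP.
have [psi [sb hs]] := exists_bump hN hw sv v0.
exists (ext T psi); split; last first.
  by move=> f /(S_spaceP hN hw) sf; exact: (ext_S hN hw hT sb hs sf).
split; first exact: (ext_linear hN hw hT hC sb).
by move=> F OF; exact: (ext_continuous hN hw hT hC sb OF).
Qed.

End MainTheorem.

Theorem theorem5p3 (R : realType) (N : nat) (hN : (0 < N)%N) (w : R -> R)
    (hw : nqa_weight w) (T : cfun R N -> (R[i])^o) (hT : S_dual w T) :
  [/\ in_OC_dual w T ->
        (forall f : cfun R N, S_space w f -> S_space w (convol T f)),
      log_littleo w ->
        (forall f : cfun R N, S_space w f -> S_space w (convol T f)) -> in_OC_dual w T
    & in_OC_dual w T ->
        linear_on (S_space w) (convol T) /\
        forall f : cfun R N, S_space w f ->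
          convol T @ S_nbhs w f `=>` S_nbhs w (convol T f)].
Proof.
split.
- by move=> hO f /(S_spaceP hN hw) sf; apply/(S_spaceP hN hw); exact: SB_convol.
- by move=> _ hC; exact: in_OC_dual_of_convol.
move=> hO; split; first exact: convol_linear.
by move=> f Sf; exact: convol_continuous.
Qed.
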